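(* Let $D\subset\mathbb{C}$ be a domain, let $A\subset D$ be a closed polar set, and let $f$ be holomorphic on $D\setminus A$. Then the set $\Gamma_f\cup(A\times\mathbb{C})$ is complete pluripolar in $D\times\mathbb{C}$. Moreover, if $f$ does not extend holomorphically over $A$, then the set $\Gamma_f\cup(A'\times\mathbb{C})$ is complete pluripolar in $D\times\mathbb{C}$, where $A'$ denotes the set of accumulation (density) points of $A$ in $D$.
   Context: $\Gamma_f=\{(z,f(z)):z\in D\setminus A\}$ is the graph of $f$ over $D\setminus A$. A set $E\subset\Omega$ ($\Omega\subset\mathbb{C}^n$ open) is complete pluripolar in $\Omega$ if there exists a plurisubharmonic function $u$ on $\Omega$ with $\{z\in\Omega:u(z)=-\infty\}=E$. ''$f$ does not extend holomorphically over $A$'' is understood as: for no point $a\in A$ does $f$ extend holomorphically to a neighbourhood of $a$. *)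

(* Defs.v *)
From HB Require Import structures.
From mathcomp Require Import all_boot all_order all_algebra.
From mathcomp Require Import complex.
From mathcomp Require Import all_classical all_reals all_analysis.
Import Order.TTheory GRing.Theory Num.Theory.

Set Implicit Arguments.
Unset Strict Implicit.
Unset Printing Implicit Defensive.

Local Open Scope ring_scope.
Local Open Scope classical_set_scope.

Section Defs.
Variable R : realType.

Definition Cplx : normedModType R[i] := R[i]^o.

Definition usc_on {T : topologicalType} (U : set T) (u : T -> \bar R) :=
  forall x, U x -> forall c : R, (u x < c%:E)%E ->
    \forall y \near x, (u y < c%:E)%E.

Definition circ_pt (a : Cplx) (r t : R) : Cplx :=
  a + ((r%:C)%C : Cplx) * ((cos t) +i* (sin t))%C.

Definition cdisc (a : Cplx) (r : R) : set Cplx :=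
  [set z : Cplx | `|z - a| <= (r%:C)%C].

Definition subharmonic (U : set Cplx) (u : Cplx -> \bar R) :=
  [/\ open U,
      (forall z, U z -> u z < +oo)%E,
      usc_on U u &
      forall (a : Cplx) (r : R), 0 < r -> cdisc a r `<=` U ->
        (u a <= (2 * pi)^-1%:E *
               \int[lebesgue_measure]_(t in `[0%R, (2 * pi)%R]) u (circ_pt a r t))%E].

Definition cline (p v : Cplx * Cplx) (l : Cplx) : Cplx * Cplx :=
  (p.1 + l * v.1, p.2 + l * v.2).

Definition plurisubharmonic (W : set (Cplx * Cplx)) (u : Cplx * Cplx -> \bar R) :=
  [/\ open W,
      (forall z, W z -> u z < +oo)%E,
      usc_on W u &
      forall p v : Cplx * Cplx,
        subharmonic [set l | W (cline p v l)] (fun l => u (cline p v l))].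

Definition complete_pluripolar (W E : set (Cplx * Cplx)) :=
  E `<=` W /\
  exists u, plurisubharmonic W u /\
    forall z, W z -> (u z = -oo%E <-> E z).

Definition polar (A : set Cplx) :=
  exists u, subharmonic setT u /\ (exists z, u z <> -oo%E) /\
    A `<=` [set z | u z = -oo%E].

Definition domain (D : set Cplx) := [/\ open D, connected D & D !=set0].

Definition closed_in (D A : set Cplx) :=
  exists F : set Cplx, closed F /\ A = F `&` D.

Definition holomorphic_on (U : set Cplx) (f : Cplx -> Cplx) :=
  forall z, U z -> derivable f z 1.

Definition graph_over (D A : set Cplx) (f : Cplx -> Cplx) : set (Cplx * Cplx) :=
  [set p | (D `\` A) p.1 /\ p.2 = f p.1].

Definition extends_holo_at (D A : set Cplx) (f : Cplx -> Cplx) (a : Cplx) :=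
  exists (V : set Cplx) (g : Cplx -> Cplx),
    [/\ open V, V a, V `<=` D, holomorphic_on V g &
        forall z, (V `\` A) z -> g z = f z].

Definition accum_in (D A : set Cplx) : set Cplx := D `&` limit_point A.

End Defs.

(* Main.v *)
(** The sum of a series of plurisubharmonic functions v_k is used, where v_k is at most 2^-k on compact
    sets, at most -1 on the set E in question and at least -C 2^-k off E.  Near a disc meeting A in no
    point, v_k comes from max (u' + e log|w - f z|, -c) with c large and e small; here u' is the
    subharmonic function that is -oo on A, made finite on the disc by a Poisson modification, and the
    formula is replaced by -c near A, where u' is very negative.  Near a disc meeting A in one point a,
    u' + k log|z - a| replaces u', and the constant -c is replaced by a barrier which is -c away from a
    and bounded at a.  Since f does not extend over a, on every small circle around a there are points
    where |f| is as large as we like, so that {|f| > M} is not thin at a: a suitable logarithmic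
    potential of masses in this set is such a barrier, subharmonic except where |f| > M, and there
    log|w - f z| is positive.  Subharmonicity is handled through domination by real parts of holomorphic
    functions (the predicates HMat and HM), which is equivalent to the sub-mean value property. *)

Require Import Defs.
From HB Require Import structures.
From mathcomp Require Import all_boot all_order all_algebra.
From mathcomp Require Import complex.
From mathcomp Require Import all_classical all_reals all_analysis.
From mathcomp Require Import measurable_realfun.
From mathcomp Require Import ring lra.

Import Order.TTheory GRing.Theory Num.Theory.
Import numFieldNormedType.Exports.

Set Implicit Arguments.
Unset Strict Implicit.
Unset Printing Implicit Defensive.

Local Open Scope ring_scope.
Local Open Scope classical_set_scope.

(** The obstacle is the order of choices. To make the weighted terms at most -1 on the set, [c] must
    be at least 2^k, yet the lower bound at a point off the set must not feel [c]. So each disc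
    first fixes an upper bound per level and a lower bound per point, and only then come [c], the
    coefficients of the logarithms and the masses of the barrier. Coefficients in (0, 1] cost
    nothing, since e x >= min 0 x. The barrier depends on [c], but its value at the isolated point a
    stays above -1; the price is that it equals -c only outside a disc about a, so that at step k
    the part of the graph closer than 2^-k to a is given up. Each fixed point of the graph is
    recovered once k is large. Both claims are one statement with a parameter [A2], which is [A] or
    the set of accumulation points; for [A2 = A] the discs in use never meet [A]. The function given
    by polarity may also be -oo off [A], which is why it has to be made finite on each disc.
    Domination by harmonic functions gives sums, maxima and decreasing limits without integrals of
    extended-valued functions; the mean inequality appears only on entry and on exit. *)

Section RealIntegral.
Context {R : realType}.
Implicit Types (f g : R -> R) (a b : R).

(** * Integrals of continuous real functions over segments *)

Definition cont_on a b f := forall x, a <= x <= b -> {for x, continuous f}.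

Definition rint a b f : R := \int[@lebesgue_measure R]_(x in `[a, b]) f x.

Lemma cont_atP f x :
  {for x, continuous f} <->
  forall e, 0 < e -> exists2 d, 0 < d & forall y, `|y - x| < d -> `|f y - f x| < e.
Proof.
split.
  move/cvgrPdist_lt => h e e0; have /nbhs_ballP[d /= d0 hd] := h e e0.
  by exists d => // y yd; rewrite distrC; apply: hd; rewrite /ball /= distrC.
move=> h; apply/cvgrPdist_lt => e e0; have [d d0 hd] := h e e0.
by apply/nbhs_ballP; exists d => //= y; rewrite /ball /= distrC => /hd; rewrite distrC.
Qed.

Lemma cont_onW a b f : cont_on a b f -> {within `[a, b], continuous f}.
Proof.
by move=> cf; apply: continuous_in_subspaceT => x; rewrite inE /= in_itv /=; apply: cf.
Qed.

Lemma integrable_cont a b f : cont_on a b f ->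
  (@lebesgue_measure R).-integrable `[a, b] (EFin \o f).
Proof.
by move=> /cont_onW cf; apply: continuous_compact_integrable => //; exact: segment_compact.
Qed.

Lemma cont_onD a b f g : cont_on a b f -> cont_on a b g -> cont_on a b (fun x => f x + g x).
Proof. by move=> cf cg x xab; exact: (cvgD (cf x xab) (cg x xab)). Qed.

Lemma cont_onN a b f : cont_on a b f -> cont_on a b (fun x => - f x).
Proof. by move=> cf x xab; exact: (cvgN (cf x xab)). Qed.

Lemma cont_onB a b f g : cont_on a b f -> cont_on a b g -> cont_on a b (fun x => f x - g x).
Proof. by move=> cf cg; apply: cont_onD => //; apply: cont_onN. Qed.

Lemma cont_onM a b f g : cont_on a b f -> cont_on a b g -> cont_on a b (fun x => f x * g x).
Proof. by move=> cf cg x xab; exact: (cvgM (cf x xab) (cg x xab)). Qed.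

Lemma cont_on_cst a b (c : R) : cont_on a b (fun=> c).
Proof. by move=> x _; exact: cvg_cst. Qed.

Lemma cont_onZ a b c f : cont_on a b f -> cont_on a b (fun x => c * f x).
Proof. by move=> cf; apply: cont_onM => //; apply: cont_on_cst. Qed.

Lemma cont_on_sub a b a' b' f : a <= a' -> b' <= b -> cont_on a b f -> cont_on a' b' f.
Proof.
move=> aa bb cf x /andP[x1 x2]; apply: cf.
by rewrite (le_trans aa x1) (le_trans x2 bb).
Qed.

Lemma rintD a b f g : cont_on a b f -> cont_on a b g ->
  rint a b (fun x => f x + g x) = rint a b f + rint a b g.
Proof. by move=> cf cg; apply: RintegralD => //; exact: integrable_cont. Qed.

Lemma rintB a b f g : cont_on a b f -> cont_on a b g ->
  rint a b (fun x => f x - g x) = rint a b f - rint a b g.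
Proof. by move=> cf cg; apply: RintegralB => //; exact: integrable_cont. Qed.

Lemma rintZ a b c f : cont_on a b f -> rint a b (fun x => c * f x) = c * rint a b f.
Proof. by move=> cf; apply: RintegralZl => //; exact: integrable_cont. Qed.

Lemma rint_cst a b c : a <= b -> rint a b (fun=> c) = c * (b - a).
Proof.
move=> ab; rewrite /rint Rintegral_cst//= lebesgue_measure_itv /= lte_fin.
by case: (ltgtP a b) ab => //= -> _; rewrite subrr.
Qed.

Lemma rint_le a b f g : cont_on a b f -> cont_on a b g ->
  (forall x, a <= x <= b -> f x <= g x) -> rint a b f <= rint a b g.
Proof.
move=> cf cg fg; apply: le_Rintegral => //; try exact: integrable_cont.
Qed.

Lemma eq_rint a b f g : (forall x, a <= x <= b -> f x = g x) -> rint a b f = rint a b g.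
Proof.
by move=> fg; apply: eq_Rintegral => x; rewrite inE /= in_itv /=; exact: fg.
Qed.

Lemma rint_chasles a c b f : a <= c <= b -> cont_on a b f ->
  rint a b f = rint a c f + rint c b f.
Proof.
move=> /andP[ac cb] cf; have itf := integrable_cont cf.
have := @Rintegral_itvB R f (BLeft a) (BRight b) c itf.
rewrite !bnd_simp => /(_ ac cb) h.
rewrite /rint -[X in X = _](subrK (\int[lebesgue_measure]_(x in `[a, c]) f x)) h addrC.
congr (_ + _); apply: Rintegral_itv_obnd_cbnd.
apply: integrableS itf => //.
by apply: subset_itvr; rewrite bnd_simp.
Qed.

Lemma rint_bound a b f M : a <= b -> cont_on a b f ->
  (forall x, a <= x <= b -> `|f x| <= M) -> `|rint a b f| <= M * (b - a).
Proof.
move=> ab cf fM; rewrite ler_norml -mulNr -!(rint_cst _ ab).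
by apply/andP; split; apply: rint_le => //; try exact: cont_on_cst;
  move=> x /fM; rewrite ler_norml => /andP[].
Qed.

End RealIntegral.

(** * Goursat's theorem on rectangles, in real form *)

Section Goursat.
Context {R : realType}.
Implicit Types (U V : R -> R -> R).

(** The linear part is multiplication by p + iq, so the Cauchy-Riemann equations are built into the
    two remainders. A pair of real functions is used because the integrals are real. *)
Definition cdiff_at U V (x y : R) := exists p q, forall e, 0 < e ->
  exists2 d, 0 < d & forall x' y', `|x' - x| < d -> `|y' - y| < d ->
   `|U x' y' - U x y - (p * (x' - x) - q * (y' - y))| <= e * (`|x' - x| + `|y' - y|) /\
   `|V x' y' - V x y - (q * (x' - x) + p * (y' - y))| <= e * (`|x' - x| + `|y' - y|).

Definition cdiff_on U V x1 x2 y1 y2 := forall x y, x1 <= x <= x2 -> y1 <= y <= y2 -> cdiff_at U V x y.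

(* The real part of the boundary integral of (U + iV)(dx + i dy). *)
Definition bint U V x1 x2 y1 y2 :=
  rint x1 x2 (fun x => U x y1 - U x y2) - rint y1 y2 (fun y => V x2 y - V x1 y).

Lemma cdiff_at_cont U V x y : cdiff_at U V x y ->
  [/\ {for x, continuous (U^~ y)}, {for y, continuous (U x)},
      {for x, continuous (V^~ y)} & {for y, continuous (V x)}].
Proof.
move=> [p [q h]].
have key (F G : R -> R -> R) (k l : R) : (forall e, 0 < e -> exists2 d, 0 < d &
    forall x' y', `|x' - x| < d -> `|y' - y| < d ->
   `|F x' y' - F x y - (k * (x' - x) + l * (y' - y))| <= e * (`|x' - x| + `|y' - y|)) ->
   forall e, 0 < e -> exists2 d, 0 < d &
    forall x' y', `|x' - x| < d -> `|y' - y| < d -> `|F x' y' - F x y| < e.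
  move=> hF e e0; have [d d0 hd] := hF _ ltr01.
  have K0 : 0 < 2 * (1 + `|k| + `|l|) by rewrite mulr_gt0// -addrA ltr_wpDr// addr_ge0.
  exists (Num.min d (e / (2 * (1 + `|k| + `|l|)))); first by rewrite lt_min d0 divr_gt0.
  move=> x' y'; rewrite !lt_min => /andP[x1 x2] /andP[y1 y2].
  have := hd x' y' x1 y1; rewrite mul1r => hh.
  rewrite ltr_pdivlMr// in x2; rewrite ltr_pdivlMr// in y2.
  have n1 := normr_ge0 (x' - x); have n2 := normr_ge0 (y' - y).
  have k1 : `|k * (x' - x)| = `|k| * `|x' - x| by rewrite normrM.
  have k2 : `|l * (y' - y)| = `|l| * `|y' - y| by rewrite normrM.
  have t1 := ler_normD (F x' y' - F x y - (k * (x' - x) + l * (y' - y))) (k * (x' - x) + l * (y' - y)).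
  have t2 := ler_normD (k * (x' - x)) (l * (y' - y)).
  rewrite subrK in t1.
  have l0 := normr_ge0 l; have k0 := normr_ge0 k.
  nra.
have hU := key U V p (- q) _.
have hV := key V U q p _.
have {}hU : forall e, 0 < e -> exists2 d, 0 < d &
    forall x' y', `|x' - x| < d -> `|y' - y| < d -> `|U x' y' - U x y| < e.
  apply: hU => e e0; have [d d0 hd] := h e e0; exists d => // x' y' h1 h2.
  by rewrite mulNr; have [] := hd _ _ h1 h2.
have {}hV : forall e, 0 < e -> exists2 d, 0 < d &
    forall x' y', `|x' - x| < d -> `|y' - y| < d -> `|V x' y' - V x y| < e.
  apply: hV => e e0; have [d d0 hd] := h e e0; exists d => // x' y' h1 h2.
  by have [] := hd _ _ h1 h2.
split; apply/cont_atP => e e0.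
- by have [d d0 hd] := hU e e0; exists d => // z zd; apply: hd => //; rewrite subrr normr0.
- by have [d d0 hd] := hU e e0; exists d => // z zd; apply: hd => //; rewrite subrr normr0.
- by have [d d0 hd] := hV e e0; exists d => // z zd; apply: hd => //; rewrite subrr normr0.
- by have [d d0 hd] := hV e e0; exists d => // z zd; apply: hd => //; rewrite subrr normr0.
Qed.

Lemma cdiff_on_cont U V x1 x2 y1 y2 : cdiff_on U V x1 x2 y1 y2 ->
  (forall y, y1 <= y <= y2 -> cont_on x1 x2 (U^~ y) /\ cont_on x1 x2 (V^~ y)) /\
  (forall x, x1 <= x <= x2 -> cont_on y1 y2 (U x) /\ cont_on y1 y2 (V x)).
Proof.
by move=> h; split=> [y hy|x hx]; split=> z hz;
  [have [] := cdiff_at_cont (h _ _ hz hy)|have [] := cdiff_at_cont (h _ _ hz hy)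
  |have [] := cdiff_at_cont (h _ _ hx hz)|have [] := cdiff_at_cont (h _ _ hx hz)].
Qed.

Lemma cdiff_on_sub U V x1 x2 y1 y2 x1' x2' y1' y2' :
  x1 <= x1' -> x2' <= x2 -> y1 <= y1' -> y2' <= y2 ->
  cdiff_on U V x1 x2 y1 y2 -> cdiff_on U V x1' x2' y1' y2'.
Proof. by move=> a b c d h x y /andP[? ?] /andP[? ?]; apply: h; apply/andP; split; lra. Qed.

Lemma bint_split U V x1 c x2 y1 d y2 : x1 <= c <= x2 -> y1 <= d <= y2 ->
  cdiff_on U V x1 x2 y1 y2 ->
  bint U V x1 x2 y1 y2 = bint U V x1 c y1 d + bint U V c x2 y1 d +
                         (bint U V x1 c d y2 + bint U V c x2 d y2).
Proof.
move=> hc hd h; have [cx cy] := cdiff_on_cont h.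
have /andP[c1 c2] := hc; have /andP[d1 d2] := hd.
have y1i : y1 <= y1 <= y2 by lra.
have y2i : y1 <= y2 <= y2 by lra.
have di : y1 <= d <= y2 by lra.
have x1i : x1 <= x1 <= x2 by lra.
have x2i : x1 <= x2 <= x2 by lra.
have ci : x1 <= c <= x2 by lra.
have Ux y a b : y1 <= y <= y2 -> x1 <= a -> b <= x2 -> cont_on a b (U^~ y).
  by move=> hy ha hb; apply: cont_on_sub ha hb (cx _ hy).1.
have Vy x a b : x1 <= x <= x2 -> y1 <= a -> b <= y2 -> cont_on a b (V x).
  by move=> hx ha hb; apply: cont_on_sub ha hb (cy _ hx).2.
rewrite /bint !rintB; try (by apply: Ux) || (by apply: Vy).
rewrite (rint_chasles hc (Ux _ _ _ y1i (lexx _) (lexx _))).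
rewrite (rint_chasles hc (Ux _ _ _ y2i (lexx _) (lexx _))).
rewrite (rint_chasles hd (Vy _ _ _ x1i (lexx _) (lexx _))).
rewrite (rint_chasles hd (Vy _ _ _ x2i (lexx _) (lexx _))).
ring.
Qed.

(** The affine part at (x, y) contributes q (x2 - x1) (y2 - y1) to each of the two integrals and
    cancels in the difference; only the remainders are left. *)
Lemma bint_small U V x1 x2 y1 y2 x y p q (e : R) : x1 <= x <= x2 -> y1 <= y <= y2 ->
  cdiff_on U V x1 x2 y1 y2 ->
  (forall x' y', x1 <= x' <= x2 -> y1 <= y' <= y2 ->
   `|U x' y' - U x y - (p * (x' - x) - q * (y' - y))| <= e /\
   `|V x' y' - V x y - (q * (x' - x) + p * (y' - y))| <= e) ->
  `|bint U V x1 x2 y1 y2| <= 2 * e * ((x2 - x1) + (y2 - y1)).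
Proof.
move=> hx hy h he; have [cx cy] := cdiff_on_cont h.
have y1i : y1 <= y1 <= y2 by lra.
have y2i : y1 <= y2 <= y2 by lra.
have x1i : x1 <= x1 <= x2 by lra.
have x2i : x1 <= x2 <= x2 by lra.
have x12 : x1 <= x2 by lra.
have y12 : y1 <= y2 by lra.
have c1 : cont_on x1 x2 (fun x => U x y1 - U x y2).
  by apply: cont_onB; [exact: (cx _ y1i).1|exact: (cx _ y2i).1].
have c2 : cont_on y1 y2 (fun y => V x2 y - V x1 y).
  by apply: cont_onB; [exact: (cy _ x2i).2|exact: (cy _ x1i).2].
have -> : bint U V x1 x2 y1 y2 =
  rint x1 x2 (fun x => U x y1 - U x y2 - q * (y2 - y1)) -
  rint y1 y2 (fun y => V x2 y - V x1 y - q * (x2 - x1)).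
  rewrite /bint (rintB c1 (@cont_on_cst _ _ _ _)) (rintB c2 (@cont_on_cst _ _ _ _)) !rint_cst//.
  by ring.
apply: (le_trans (ler_normB _ _)); rewrite [leRHS]mulrDr; apply: lerD; apply: rint_bound => //.
- by apply: cont_onB => //; exact: cont_on_cst.
- move=> z hz; have [+ _] := he _ _ hz y1i; have [+ _] := he _ _ hz y2i.
  rewrite !ler_norml; lra.
- by apply: cont_onB => //; exact: cont_on_cst.
- move=> z hz; have [_ +] := he _ _ x1i hz; have [_ +] := he _ _ x2i hz.
  rewrite !ler_norml; lra.
Qed.

Lemma ex_lt_pow2 (x : R) : exists n, x < 2 ^+ n.
Proof.
exists (Num.bound `|x|); apply: (le_lt_trans (ler_norm x)).
apply: (lt_trans (archi_boundP (normr_ge0 x))).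
by rewrite -natrX ltr_nat ltn_expl.
Qed.

Lemma bint_bisect U V x1 x2 y1 y2 (c : R) : x1 <= x2 -> y1 <= y2 ->
  cdiff_on U V x1 x2 y1 y2 -> c <= `|bint U V x1 x2 y1 y2| ->
  exists x y, [/\ x = x1 \/ x = x1 + (x2 - x1) / 2, y = y1 \/ y = y1 + (y2 - y1) / 2 &
    c / 4 <= `|bint U V x (x + (x2 - x1) / 2) y (y + (y2 - y1) / 2)|].
Proof.
move=> x12 y12 h hc; apply: contrapT => hn.
have key x y : x = x1 \/ x = x1 + (x2 - x1) / 2 -> y = y1 \/ y = y1 + (y2 - y1) / 2 ->
   `|bint U V x (x + (x2 - x1) / 2) y (y + (y2 - y1) / 2)| < c / 4.
  by move=> hx hy; rewrite ltNge; apply/negP => hb; apply: hn; exists x, y.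
set cx := x1 + (x2 - x1) / 2; set cy := y1 + (y2 - y1) / 2.
have e1 : cx + (x2 - x1) / 2 = x2 by rewrite /cx; field.
have e2 : cy + (y2 - y1) / 2 = y2 by rewrite /cy; field.
have := key x1 y1 (or_introl erefl) (or_introl erefl).
have := key cx y1 (or_intror erefl) (or_introl erefl).
have := key x1 cy (or_introl erefl) (or_intror erefl).
have := key cx cy (or_intror erefl) (or_intror erefl).
rewrite e1 e2 -/cx -/cy => k1 k2 k3 k4.
move: hc; rewrite (@bint_split _ _ _ cx _ _ cy) //; last 2 first.
- by rewrite /cx; apply/andP; split; lra.
- by rewrite /cy; apply/andP; split; lra.
move: k1 k2 k3 k4.
set u1 := bint _ _ _ _ _ _; set u2 := bint _ _ _ _ _ _.
set u3 := bint _ _ _ _ _ _; set u4 := bint _ _ _ _ _ _ => k1 k2 k3 k4.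
have := ler_normD (u4 + u3) (u2 + u1); have := ler_normD u4 u3; have := ler_normD u2 u1.
lra.
Qed.

Lemma dist_itv (l A x X : R) : l <= x -> x <= l + A -> l <= X -> X <= l + A -> `|x - X| <= A.
Proof. by move=> h1 h2 h3 h4; rewrite ler_norml; apply/andP; split; lra. Qed.

Lemma goursat U V x1 x2 y1 y2 : x1 <= x2 -> y1 <= y2 ->
  cdiff_on U V x1 x2 y1 y2 -> bint U V x1 x2 y1 y2 = 0.
Proof.
move=> x12 y12 h; apply/eqP; rewrite -normr_le0 leNgt; apply/negP.
set c := `|_| => c0.
set a := x2 - x1; set b := y2 - y1.
have a0 : 0 <= a by rewrite subr_ge0.
have b0 : 0 <= b by rewrite subr_ge0.
have pow0 n : 0 < 2 ^+ n :> R by rewrite exprn_gt0.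
(* Nested rectangles recorded by their lower left corners: the sides halve at each step, while the
   boundary integral loses at most a factor 4. *)
pose Bad n (p : R * R) := [/\ x1 <= p.1, p.1 + a / 2 ^+ n <= x2, y1 <= p.2,
   p.2 + b / 2 ^+ n <= y2 & c / 4 ^+ n <= `|bint U V p.1 (p.1 + a / 2 ^+ n) p.2 (p.2 + b / 2 ^+ n)|].
pose Nxt n (p p' : R * R) := [/\ Bad n.+1 p', p.1 <= p'.1, p'.1 + a / 2 ^+ n.+1 <= p.1 + a / 2 ^+ n,
   p.2 <= p'.2 & p'.2 + b / 2 ^+ n.+1 <= p.2 + b / 2 ^+ n].
have halve (t : R) n : t / 2 ^+ n = t / 2 ^+ n.+1 + t / 2 ^+ n.+1.
  by rewrite exprSr; have := pow0 n; move=> ?; field; rewrite gt_eqF.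
have step n p : Bad n p -> exists p', Nxt n p p'.
  case=> p1 p2 p3 p4 p5.
  have an : 0 <= a / 2 ^+ n.+1 by rewrite divr_ge0// ltW.
  have bn : 0 <= b / 2 ^+ n.+1 by rewrite divr_ge0// ltW.
  have ha := halve a n; have hb := halve b n.
  have [|||x [y [hx hy hh]]] := @bint_bisect U V p.1 (p.1 + a / 2 ^+ n) p.2 (p.2 + b / 2 ^+ n) _ _ _ _ p5.
  - by lra.
  - by lra.
  - by apply: cdiff_on_sub h; lra.
  have ea : (p.1 + a / 2 ^+ n - p.1) / 2 = a / 2 ^+ n.+1 by rewrite ha; field; rewrite gt_eqF.
  have eb : (p.2 + b / 2 ^+ n - p.2) / 2 = b / 2 ^+ n.+1 by rewrite hb; field; rewrite gt_eqF.
  rewrite ea in hx hh; rewrite eb in hy hh.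
  exists (x, y); rewrite /Nxt /Bad /=.
  have -> : c / 4 ^+ n.+1 = c / 4 ^+ n / 4 by rewrite exprSr; field; rewrite gt_eqF// exprn_gt0.
  move: hh; move: (bint _ _ _ _ _ _) => I hh.
  move: (a / 2 ^+ n.+1) (a / 2 ^+ n) (b / 2 ^+ n.+1) (b / 2 ^+ n) an bn ha hb p1 p2 p3 p4 hx hy {ea eb p5}.
  move=> A A' B B' an bn ha hb p1 p2 p3 p4 hx hy.
  clear -an bn ha hb p1 p2 p3 p4 hx hy hh.
  by split; [split=> //|..]; case: hx => hx; case: hy => hy; lra.
(* The default [p] is never taken along the sequence, as [step] gives every bad corner a
   successor. *)
pose nxt n p := if pselect (exists p', Nxt n p p') is left e then sval (cid e) else p.
pose s := fix s n := if n is m.+1 then nxt m (s m) else (x1, y1).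
have sbad n : Bad n (s n).
  elim: n => [|n IH].
    rewrite /Bad /= !expr0 !divr1 /a /b.
    have -> : x1 + (x2 - x1) = x2 by ring.
    by have -> : y1 + (y2 - y1) = y2 by ring.
  by rewrite /= /nxt; case: pselect => [e|]; [case: cid => p' []|case; exact: step].
have snxt n : Nxt n (s n) (s n.+1).
  by rewrite /= /nxt; case: pselect => [e|]; [case: cid => p' /=|case; exact: step].
have mono m n : (m <= n)%N -> [/\ (s m).1 <= (s n).1, (s n).1 + a / 2 ^+ n <= (s m).1 + a / 2 ^+ m,
   (s m).2 <= (s n).2 & (s n).2 + b / 2 ^+ n <= (s m).2 + b / 2 ^+ m].
  elim: n => [|n IH]; first by rewrite leqn0 => /eqP ->; split.
  rewrite leq_eqVlt => /orP[/eqP ->|]; first by split.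
  rewrite ltnS => /IH [h1 h2 h3 h4]; have [_ g1 g2 g3 g4] := snxt n.
  by split; lra.
have upx m n : (s m).1 <= (s n).1 + a / 2 ^+ n.
  have [+ _ _ _] := mono m _ (leq_maxl m n); have [_ + _ _] := mono n _ (leq_maxr m n).
  have : 0 <= a / 2 ^+ maxn m n by rewrite divr_ge0// ltW.
  lra.
have upy m n : (s m).2 <= (s n).2 + b / 2 ^+ n.
  have [_ _ + _] := mono m _ (leq_maxl m n); have [_ _ _] := mono n _ (leq_maxr m n).
  have : 0 <= b / 2 ^+ maxn m n by rewrite divr_ge0// ltW.
  lra.
pose X := sup [set (s n).1 | n in setT]; pose Y := sup [set (s n).2 | n in setT].
have supX : has_sup [set (s n).1 | n in setT].
  split; first by exists (s 0%N).1; exists 0%N.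
  by exists ((s 0%N).1 + a / 2 ^+ 0) => _ [n _ <-].
have supY : has_sup [set (s n).2 | n in setT].
  split; first by exists (s 0%N).2; exists 0%N.
  by exists ((s 0%N).2 + b / 2 ^+ 0) => _ [n _ <-].
have Xn n : (s n).1 <= X <= (s n).1 + a / 2 ^+ n.
  apply/andP; split; first by apply: sup_upper_bound => //; exists n.
  by apply: sup_le_ub => [|_ [m _ <-]//]; case: supX.
have Yn n : (s n).2 <= Y <= (s n).2 + b / 2 ^+ n.
  apply/andP; split; first by apply: sup_upper_bound => //; exists n.
  by apply: sup_le_ub => [|_ [m _ <-]//]; case: supY.
have hX : x1 <= X <= x2.
  by have := Xn 0%N; have [h1 h2 _ _ _] := sbad 0%N => /andP[h3 h4]; apply/andP; split; lra.
have hY : y1 <= Y <= y2.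
  by have := Yn 0%N; have [_ _ h1 h2 _] := sbad 0%N => /andP[h3 h4]; apply/andP; split; lra.
have [p [q hd]] := h _ _ hX hY.
(* This makes 2 e (a + b)^2 < c; the summand 2 keeps the denominator positive for a degenerate
   rectangle. *)
pose e := c / (2 * (a + b) ^+ 2 + 2).
have den0 : 0 < 2 * (a + b) ^+ 2 + 2 by have := sqr_ge0 (a + b); lra.
have e0 : 0 < e by rewrite divr_gt0.
have [d d0 hdd] := hd _ e0.
have [n hn] := ex_lt_pow2 ((a + b) / d).
have abd : (a + b) / 2 ^+ n < d.
  by rewrite ltr_pdivrMr// mulrC -ltr_pdivrMr.
have [b1 b2 b3 b4 b5] := sbad n.
have an : 0 <= a / 2 ^+ n by rewrite divr_ge0// ltW.
have bn : 0 <= b / 2 ^+ n by rewrite divr_ge0// ltW.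
have hab : (a + b) / 2 ^+ n = a / 2 ^+ n + b / 2 ^+ n by rewrite mulrDl.
rewrite hab in abd.
have := @bint_small U V (s n).1 ((s n).1 + a / 2 ^+ n) (s n).2 ((s n).2 + b / 2 ^+ n)
  X Y p q (e * (a / 2 ^+ n + b / 2 ^+ n)) (Xn n) (Yn n).
have /andP[X1 X2] := Xn n; have /andP[Y1 Y2] := Yn n.
have -> : 2 * (e * (a / 2 ^+ n + b / 2 ^+ n)) * ((s n).1 + a / 2 ^+ n - (s n).1 + ((s n).2 + b / 2 ^+ n - (s n).2))
   = 2 * e * (a + b) ^+ 2 / 4 ^+ n.
  have -> : 4 ^+ n = 2 ^+ n * 2 ^+ n :> R by rewrite -exprMn; congr (_ ^+ n); ring.
  by field; rewrite gt_eqF.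
have lt : 2 * e * (a + b) ^+ 2 / 4 ^+ n < c / 4 ^+ n.
  rewrite ltr_pM2r ?invr_gt0 ?exprn_gt0//.
  rewrite /e -mulrA [_ / _ * _]mulrAC mulrA ltr_pdivrMr// mulrDr; have := sqr_ge0 (a + b); nra.
move=> /(_ _ _) /= hfin.
have hsub : cdiff_on U V (s n).1 ((s n).1 + a / 2 ^+ n) (s n).2 ((s n).2 + b / 2 ^+ n).
  by apply: cdiff_on_sub h.
move: hfin => /(_ hsub) hfin.
suff : `|bint U V (s n).1 ((s n).1 + a / 2 ^+ n) (s n).2 ((s n).2 + b / 2 ^+ n)| <= 2 * e * (a + b) ^+ 2 / 4 ^+ n.
  by move=> hle; have := le_lt_trans (le_trans b5 hle) lt; rewrite ltxx.
apply: hfin.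
clear b5 lt den0 hn hab snxt sbad mono upx upy c0 halve step.
move=> x' y' /andP[x'1 x'2] /andP[y'1 y'2].
have ax := dist_itv x'1 x'2 X1 X2.
have ay := dist_itv y'1 y'2 Y1 Y2.
have axy := lerD ax ay; have e0' := ltW e0.
have [||k1 k2] := hdd x' y'.
- by apply: le_lt_trans ax (le_lt_trans _ abd); rewrite lerDl.
- by apply: le_lt_trans ay (le_lt_trans _ abd); rewrite lerDr.
by split; [apply: (le_trans k1)|apply: (le_trans k2)]; rewrite ler_pM2l.
Qed.

End Goursat.

(** * Real-valued modulus, complex derivatives and the exponential *)

Section ComplexBasics.
Context {R : realType}.
Local Notation C := (Cplx R).
Local Notation "x %:C" := (real_complex _ x) (format "x %:C") : ring_scope.
Local Notation Re := (@complex.Re R).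
Local Notation Im := (@complex.Im R).
Implicit Types (z w : R[i]).

(** The norm of [R[i]] takes values in [R[i]], whose order is only partial; this modulus lives in
    [R], where real analysis applies. *)
Definition nrm (z : R[i]) : R := Num.sqrt (Re z ^+ 2 + Im z ^+ 2).

Lemma nrmE z : `|z| = (nrm z)%:C. Proof. exact: normc_def. Qed.

Lemma nrm_ge0 z : 0 <= nrm z. Proof. exact: sqrtr_ge0. Qed.

Lemma nrm_sqr z : nrm z ^+ 2 = Re z ^+ 2 + Im z ^+ 2.
Proof. by rewrite sqr_sqrtr// addr_ge0// sqr_ge0. Qed.

Lemma nrm0 : nrm 0 = 0. Proof. by rewrite /nrm /= expr0n /= addr0 sqrtr0. Qed.

Lemma nrmr (x : R) : nrm x%:C = `|x|.
Proof. by rewrite /nrm /= expr0n /= addr0 sqrtr_sqr. Qed.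

Lemma nrm1 : nrm 1 = 1. Proof. by rewrite (nrmr 1) normr1. Qed.

Lemma nrm_eq0 z : (nrm z == 0) = (z == 0).
Proof.
rewrite -(inj_eq (@complexI R)) -nrmE.
by rewrite (_ : (0 : R)%:C = 0)// normr_eq0.
Qed.

Lemma nrm_gt0 z : (0 < nrm z) = (z != 0).
Proof. by rewrite lt_def nrm_eq0 nrm_ge0 andbT. Qed.

Lemma nrmM z w : nrm (z * w) = nrm z * nrm w.
Proof. by apply: (@complexI R); rewrite rmorphM /= -!nrmE normrM. Qed.

Lemma nrmV z : nrm z^-1 = (nrm z)^-1.
Proof.
have [->|z0] := eqVneq z 0; first by rewrite invr0 nrm0 invr0.
have nz : nrm z != 0 by rewrite nrm_eq0.
by apply: (mulfI nz); rewrite -nrmM !divff// nrm1.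
Qed.

Lemma nrmD z w : nrm (z + w) <= nrm z + nrm w.
Proof. by rewrite -lecR rmorphD /= -!nrmE ler_normD. Qed.

Lemma nrmN z : nrm (- z) = nrm z.
Proof. by apply: (@complexI R); rewrite -!nrmE normrN. Qed.

Lemma nrmX z n : nrm (z ^+ n) = nrm z ^+ n.
Proof. by elim: n => [|n IH]; rewrite ?expr0 ?nrm1// !exprS nrmM IH. Qed.

Lemma nrmBC z w : nrm (z - w) = nrm (w - z).
Proof. by rewrite -nrmN opprB. Qed.

Lemma nrmB_ge z w : nrm z - nrm w <= nrm (z - w).
Proof. by have := nrmD (z - w) w; rewrite subrK lerBlDr. Qed.

Lemma nrmD_ge z w : nrm z - nrm w <= nrm (z + w).
Proof. by rewrite -[w in nrm (z + w)]opprK -(nrmN w) nrmB_ge. Qed.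

Lemma nrm_tri z w x : nrm (z - x) <= nrm (z - w) + nrm (w - x).
Proof. by apply: le_trans (nrmD _ _); rewrite addrA subrK. Qed.

Lemma Re_nrm z : `|Re z| <= nrm z.
Proof. by rewrite -sqrtr_sqr ler_wsqrtr// lerDl sqr_ge0. Qed.

Lemma Im_nrm z : `|Im z| <= nrm z.
Proof. by rewrite -sqrtr_sqr ler_wsqrtr// lerDr sqr_ge0. Qed.

Lemma nrm_ReIm z : nrm z <= `|Re z| + `|Im z|.
Proof.
rewrite -[leRHS]ger0_norm ?addr_ge0// -sqrtr_sqr ler_wsqrtr//.
rewrite sqrrD !real_normK ?num_real// addrAC lerDl.
by rewrite mulrn_wge0// mulr_ge0.
Qed.

Lemma cReD z w : Re (z + w) = Re z + Re w. Proof. by case: z; case: w. Qed.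
Lemma cImD z w : Im (z + w) = Im z + Im w. Proof. by case: z; case: w. Qed.
Lemma cReN z : Re (- z) = - Re z. Proof. by case: z. Qed.
Lemma cImN z : Im (- z) = - Im z. Proof. by case: z. Qed.
Lemma cReM z w : Re (z * w) = Re z * Re w - Im z * Im w. Proof. by case: z; case: w. Qed.
Lemma cImM z w : Im (z * w) = Re z * Im w + Im z * Re w. Proof. by case: z; case: w. Qed.
Lemma cReZ (c : R) z : Re (c%:C * z) = c * Re z. Proof. by rewrite cReM /= mul0r subr0. Qed.
Lemma cImZ (c : R) z : Im (c%:C * z) = c * Im z. Proof. by rewrite cImM /= mul0r addr0. Qed.

Lemma complex_eq z w : Re z = Re w -> Im z = Im w -> z = w.
Proof. by case: z => a b; case: w => c d /= -> ->. Qed.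

Lemma nbhsCP (z : C) (P : set C) :
  nbhs z P <-> exists2 e : R, 0 < e & forall y : C, nrm (y - z) < e -> P y.
Proof.
split=> [/nbhs_ballP[e /= e0 h]|[e e0 h]].
  have e0' : 0 < Re e by move: e0; rewrite ltcE /= => /andP[].
  exists (Re e) => // y yz; apply: h; rewrite /ball /= distrC nrmE.
  by move: e0; rewrite !ltcE /= => /andP[/eqP -> _]; rewrite eqxx yz.
apply/nbhs_ballP; exists e%:C => /=; first by rewrite ltcR.
by move=> y; rewrite /ball /= distrC nrmE ltcR; exact: h.
Qed.

Lemma openCP (U : set C) : open U <->
  forall z, U z -> exists2 e : R, 0 < e & forall y : C, nrm (y - z) < e -> U y.
Proof.
split=> [+ z Uz|h]; first by rewrite openE => /(_ z Uz) /nbhsCP.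
by rewrite openE => z /h ?; apply/nbhsCP.
Qed.

Lemma open_disc (a : C) (r : R) : open [set z : C | nrm (z - a) < r].
Proof.
apply/openCP => z /= zr; exists (r - nrm (z - a)); first by rewrite subr_gt0.
by move=> y; rewrite ltrBrDr; apply: le_lt_trans (nrm_tri _ _ _).
Qed.

Lemma cdiscE (a : C) (r : R) (z : C) : cdisc a r z <-> nrm (z - a) <= r.
Proof. by rewrite /cdisc /= nrmE lecR. Qed.

(** Complex differentiability with derivative [d], with the quotient cleared so that h = 0 needs no
    exclusion. *)
Definition cdf (f : R[i] -> R[i]) (d z : R[i]) := forall e : R, 0 < e ->
  exists2 r : R, 0 < r & forall h, nrm h < r -> nrm (f (z + h) - f z - d * h) <= e * nrm h.

Lemma derivableCP (f : C -> C) (z : C) : derivable f z 1 <-> exists d, cdf f d z.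
Proof.
split.
  move=> /cvg_ex[d /cvgrPdist_le /= hd]; exists d => e e0.
  have ec0 : 0 < e%:C by rewrite ltcR.
  have /nbhs_ballP[r /= r0 hr] := hd _ ec0.
  have r0' : 0 < Re r by move: r0; rewrite ltcE /= => /andP[].
  exists (Re r) => // h hr'.
  have [->|h0] := eqVneq h 0; first by rewrite mulr0 nrm0 mulr0 addr0 subrr subr0 nrm0.
  have := hr h; rewrite /ball /= sub0r normrN nrmE.
  have -> : (nrm h)%:C < r by move: r0; rewrite !ltcE /= => /andP[/eqP -> _]; rewrite eqxx.
  move=> /(_ isT h0); rewrite nrmE lecR => hh.
  have -> : f (z + h) - f z - d * h = - ((d - h^-1 *: (f (h *: 1 + z) - f z)) * h).
    by rewrite /GRing.scale /= mulr1 [h + z]addrC mulrBl -mulrA [(f _ - f _) * h]mulrC mulrA mulVf// mul1r opprB.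
  by rewrite nrmN nrmM ler_wpM2r ?nrm_ge0.
move=> [d hd]; apply/cvg_ex; exists d; apply/cvgrPdist_le => /= e e0.
have e0' : 0 < Re e by move: e0; rewrite ltcE /= => /andP[].
have eE : e = (Re e)%:C by apply: complex_eq => //=; move: e0; rewrite ltcE /= => /andP[/eqP].
have [r r0 hr] := hd _ e0'.
apply/nbhs_ballP; exists r%:C; first by rewrite /= ltcR.
move=> h; rewrite /ball /= sub0r normrN nrmE ltcR => hr' h0.
rewrite nrmE eE lecR.
have := hr h hr'.
have -> : f (z + h) - f z - d * h = - ((d - h^-1 *: (f (h *: 1 + z) - f z)) * h).
  by rewrite /GRing.scale /= mulr1 [h + z]addrC mulrBl -mulrA [(f _ - f _) * h]mulrC mulrA mulVf// mul1r opprB.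
by rewrite nrmN nrmM ler_pM2r// nrm_gt0.
Qed.

Lemma cdf_lip f d z : cdf f d z -> exists2 r : R, 0 < r & forall h, nrm h < r ->
  nrm (f (z + h) - f z) <= (1 + nrm d) * nrm h.
Proof.
move=> /(_ 1 ltr01)[r r0 hr]; exists r => // h /hr hh.
have := nrmD (f (z + h) - f z - d * h) (d * h); rewrite subrK => H.
by apply: (le_trans H); rewrite nrmM mulrDl lerD2r.
Qed.

Lemma cdf_cst c z : cdf (fun=> c) 0 z.
Proof. by move=> e e0; exists 1 => // h _; rewrite subrr mul0r subr0 nrm0 mulr_ge0 ?nrm_ge0// ltW. Qed.

Lemma cdf_id z : cdf id 1 z.
Proof. by move=> e e0; exists 1 => // h _; rewrite (_ : id (z + h) - id z - 1 * h = 0) ?nrm0 ?mulr_ge0 ?nrm_ge0 ?ltW//=; ring. Qed.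

Lemma cdfD f g d1 d2 z : cdf f d1 z -> cdf g d2 z -> cdf (fun x => f x + g x) (d1 + d2) z.
Proof.
move=> hf hg e e0; have e2 : 0 < e / 2 by rewrite divr_gt0.
have [r1 r10 h1] := hf _ e2; have [r2 r20 h2] := hg _ e2.
exists (Num.min r1 r2); first by rewrite lt_min r10.
move=> h; rewrite lt_min => /andP[/h1 k1 /h2 k2].
have -> : f (z + h) + g (z + h) - (f z + g z) - (d1 + d2) * h =
  (f (z + h) - f z - d1 * h) + (g (z + h) - g z - d2 * h) by ring.
apply: (le_trans (nrmD _ _)); rewrite [e]splitr mulrDl; exact: lerD.
Qed.

Lemma cdf_comp f g d1 d2 z : cdf f d1 z -> cdf g d2 (f z) -> cdf (fun x => g (f x)) (d2 * d1) z.
Proof.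
move=> hf hg e e0.
have [r1 r10 h1] := cdf_lip hf.
have K0 : 0 < 1 + nrm d1 by rewrite ltr_pwDl// nrm_ge0.
have K2 : 0 < 1 + nrm d2 by rewrite ltr_pwDl// nrm_ge0.
have e2 : 0 < e / 2 / (1 + nrm d1) by rewrite !divr_gt0.
have e3 : 0 < e / 2 / (1 + nrm d2) by rewrite !divr_gt0.
have [r2 r20 h2] := hg _ e2.
have [r3 r30 h3] := hf _ e3.
exists (Num.min r1 (Num.min r3 (r2 / (1 + nrm d1)))); first by rewrite !lt_min r10 r30 divr_gt0.
move=> h; rewrite !lt_min => /and3P[/h1 k1 /h3 k3 k4].
have l2 : nrm (f (z + h) - f z) < r2.
  by apply: (le_lt_trans k1); rewrite mulrC -ltr_pdivlMr.
have := h2 _ l2; rewrite addrCA subrr addr0 => k2.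
have -> : g (f (z + h)) - g (f z) - d2 * d1 * h = (g (f (z + h)) - g (f z) - d2 * (f (z + h) - f z))
   + d2 * (f (z + h) - f z - d1 * h) by ring.
apply: (le_trans (nrmD _ _)); rewrite [e]splitr mulrDl; apply: lerD.
  apply: (le_trans k2).
  rewrite [leRHS](_ : _ = e / 2 / (1 + nrm d1) * ((1 + nrm d1) * nrm h)).
    by rewrite ler_pM2l.
  by field; rewrite gt_eqF.
rewrite nrmM; apply: (le_trans (ler_wpM2l (nrm_ge0 _) k3)).
have -> : nrm d2 * (e / 2 / (1 + nrm d2) * nrm h) = e / 2 * nrm h * (nrm d2 / (1 + nrm d2)).
  by field; rewrite gt_eqF.
rewrite ler_piMr ?mulr_ge0 ?nrm_ge0// ?ltW ?divr_gt0//.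
by rewrite ltr_pdivrMr// mul1r ltrDr.
Qed.

Lemma divr1D_le (a b : R) : 0 <= a -> 0 <= b -> a / (1 + b) * b <= a.
Proof.
move=> a0 b0; have b1 : 0 < 1 + b by rewrite ltr_pwDl.
by rewrite -mulrA mulrC ler_piMl// mulrC ler_pdivrMr// mul1r lerDr.
Qed.

Lemma cdfM f g d1 d2 z : cdf f d1 z -> cdf g d2 z ->
  cdf (fun x => f x * g x) (d1 * g z + f z * d2) z.
Proof.
move=> hf hg e e0.
have [r1 r10 h1] := cdf_lip hf.
have [r2 r20 h2] := cdf_lip hg.
have pos t : 0 <= nrm t by exact: nrm_ge0.
set A := (1 + nrm d1) * (1 + nrm d2).
have A0 : 0 < A by rewrite mulr_gt0// ltr_pwDl.
have P1 : 0 < 1 + nrm (g z) by rewrite ltr_pwDl.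
have P2 : 0 < 1 + nrm (f z) by rewrite ltr_pwDl.
have e3 : 0 < e / 3 / (1 + nrm (g z)) by rewrite !divr_gt0.
have e4 : 0 < e / 3 / (1 + nrm (f z)) by rewrite !divr_gt0.
have [r3 r30 h3] := hf _ e3.
have [r4 r40 h4] := hg _ e4.
exists (Num.min (Num.min r1 r2) (Num.min (Num.min r3 r4) (e / 3 / A))).
  by rewrite !lt_min r10 r20 r30 r40 !divr_gt0.
move=> h; rewrite !lt_min => /and3P[/andP[/h1 k1 /h2 k2] /andP[/h3 k3 /h4 k4] k5].
have -> : f (z + h) * g (z + h) - f z * g z - (d1 * g z + f z * d2) * h =
  (f (z + h) - f z) * (g (z + h) - g z) + (f (z + h) - f z - d1 * h) * g z +
   f z * (g (z + h) - g z - d2 * h) by ring.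
have -> : e * nrm h = e / 3 * nrm h + e / 3 * nrm h + e / 3 * nrm h by field.
apply: (le_trans (nrmD _ _)); apply: lerD; first (apply: (le_trans (nrmD _ _)); apply: lerD).
- rewrite nrmM; apply: (le_trans (ler_pM (pos _) (pos _) k1 k2)).
  rewrite mulrACA -/A mulrA ler_wpM2r//.
  by rewrite mulrC -ler_pdivlMr// ltW.
- rewrite nrmM; apply: (le_trans (ler_wpM2r (pos _) k3)).
  by rewrite mulrAC ler_wpM2r// divr1D_le// divr_ge0// ltW.
- rewrite nrmM; apply: (le_trans (ler_wpM2l (pos _) k4)).
  by rewrite mulrA ler_wpM2r// mulrC divr1D_le// divr_ge0// ltW.
Qed.

Lemma cdf_inv z : z != 0 -> cdf GRing.inv (- (z^-1 ^+ 2)) z.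
Proof.
move=> z0 e e0.
have n0 : 0 < nrm z by rewrite nrm_gt0.
exists (Num.min (nrm z / 2) (e / 2 * nrm z ^+ 3)).
  by rewrite lt_min !divr_gt0//= mulr_gt0 ?exprn_gt0// divr_gt0.
move=> h; rewrite lt_min => /andP[h1 h2].
have zh : nrm z / 2 <= nrm (z + h).
  by have := nrmD_ge z h; apply: le_trans; rewrite lerBrDr -lerBrDl [X in _ <= X - _]splitr addrK ltW.
have zh0 : z + h != 0 by rewrite -nrm_gt0; apply: lt_le_trans zh; rewrite divr_gt0.
have -> : (z + h)^-1 - z^-1 - - z^-1 ^+ 2 * h = h ^+ 2 * (z^-1 ^+ 2 * (z + h)^-1).
  by field; rewrite z0 zh0.
rewrite nrmM nrmX expr2 -mulrA mulrC ler_wpM2r ?nrm_ge0//.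
rewrite nrmM nrmX !nrmV.
have : (nrm (z + h))^-1 <= 2 / nrm z.
  by rewrite -[2]invrK -invfM lef_pV2 ?posrE// ?nrm_gt0// ?mulr_gt0// mulrC.
move=> hi; apply: (le_trans (ler_wpM2l (nrm_ge0 _) (ler_wpM2l (exprn_ge0 _ _) hi))).
  by rewrite invr_ge0 nrm_ge0.
apply: (le_trans (ler_wpM2r _ (ltW h2))).
  by rewrite mulr_ge0 ?exprn_ge0 ?invr_ge0 ?divr_ge0 ?nrm_ge0.
by rewrite le_eqVlt; apply/orP; left; apply/eqP; field; rewrite gt_eqF.
Qed.

Lemma cdf_ext (f g : R[i] -> R[i]) d (z : R[i]) (r : R) : 0 < r -> (forall y, nrm (y - z) < r -> f y = g y) ->
  cdf f d z -> cdf g d z.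
Proof.
move=> r0 fg hf e e0; have [s s0 hs] := hf _ e0.
exists (Num.min r s); first by rewrite lt_min r0.
move=> h; rewrite lt_min => /andP[h1 h2]; rewrite -!fg; first exact: hs.
  by rewrite subrr nrm0.
by rewrite addrAC subrr add0r.
Qed.

Lemma is_derive_eps (f : R -> R) (x d : R) : is_derive x 1 f d ->
  forall e : R, 0 < e -> exists2 r : R, 0 < r & forall h, `|h| < r -> `|f (x + h) - f x - d * h| <= e * `|h|.
Proof.
move=> fd e e0.
have hd : derivable f x 1 by [].
have := @derive_val _ _ _ _ _ _ _ fd; rewrite /derive => dE.
have : (fun h => h^-1 *: (f (h *: 1 + x) - f x)) @ 0^' --> d by rewrite -dE; exact: hd.
move=> /cvgrPdist_le /(_ e e0) /nbhs_ballP[r /= r0 hr]; exists r => // h hr'.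
have [->|h0] := eqVneq h 0; first by rewrite mulr0 normr0 mulr0 addr0 subrr subr0 normr0.
have := hr h; rewrite /ball /= sub0r normrN => /(_ hr' h0) hh.
have -> : f (x + h) - f x - d * h = - ((d - h^-1 *: (f (h *: 1 + x) - f x)) * h).
  by rewrite /GRing.scale /= mulr1 [h + x]addrC mulrBl -mulrA [(f _ - f _) * h]mulrC mulrA mulVf// mul1r opprB.
by rewrite normrN normrM ler_wpM2r.
Qed.

Definition cexp z : R[i] := (expR (Re z))%:C * (cos (Im z) +i* sin (Im z))%C.

Lemma cexpD z w : cexp (z + w) = cexp z * cexp w.
Proof.
rewrite /cexp cReD cImD expRD cosD sinD.
by apply: complex_eq => /=; ring.
Qed.

Lemma cexp0 : cexp 0 = 1.
Proof. by rewrite /cexp /= expR0 cos0 sin0 mul1r. Qed.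

Lemma nrm_cexp z : nrm (cexp z) = expR (Re z).
Proof.
by rewrite nrmM nrmr ger0_norm ?expR_ge0// /nrm /= cos2Dsin2 sqrtr1 mulr1.
Qed.

Lemma cdf_cexp0 : cdf cexp 1 0.
Proof.
move=> e e0.
have e8 : 0 < e / 8 by rewrite divr_gt0.
have [r1 r10 h1] := is_derive_eps (is_derive_expR (0 : R)) e8.
have [r2 r20 h2] := is_derive_eps (is_derive_cos (0 : R)) e8.
have [r3 r30 h3] := is_derive_eps (is_derive_sin (0 : R)) e8.
have [r4 r40 h4] := is_derive_eps (is_derive_expR (0 : R)) ltr01.
(* The bound 1/4 on |h| keeps exp (Re h) below 2, and the bound e / 8 turns the quadratic term (exp
   x - 1) y into a multiple of e |h|. In all 7/8 of e |h| is spent: three eighths on the real part,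
   four on the imaginary part. *)
exists (Num.min (Num.min r1 r2) (Num.min (Num.min r3 r4) (Num.min 4^-1 (e / 8)))).
  by rewrite !lt_min r10 r20 r30 r40 e8 invr_gt0 ltr0n.
move=> h; rewrite !lt_min => /and3P[/andP[m1 m2] /andP[m3 m4] /andP[m5 m6]].
have hx := Re_nrm h; have hy := Im_nrm h.
have k1 := h1 _ (le_lt_trans hx m1); have k2 := h2 _ (le_lt_trans hy m2).
have k3 := h3 _ (le_lt_trans hy m3); have k4 := h4 _ (le_lt_trans hx m4).
rewrite !add0r expR0 mul1r in k1 k4; rewrite !add0r cos0 sin0 oppr0 mul0r subr0 in k2.
rewrite !add0r cos0 sin0 subr0 mul1r in k3; rewrite mul1r in k4.
rewrite add0r cexp0; apply: (le_trans (nrm_ReIm _)).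
rewrite !cReD !cImD !cReN !cImN cReM cImM /cexp cReZ cImZ /= !mul0r !mul1r subr0 addr0.
have E1 : expR (Re h) * cos (Im h) - 1 - Re h = expR (Re h) * (cos (Im h) - 1) + (expR (Re h) - 1 - Re h) by ring.
have E2 : expR (Re h) * sin (Im h) - 0 - Im h = expR (Re h) * (sin (Im h) - Im h) + (expR (Re h) - 1) * Im h by ring.
rewrite E1 E2.
have n0 := nrm_ge0 h.
have b1 : `|expR (Re h) - 1| <= 2 * nrm h.
  have := ler_normD (expR (Re h) - 1 - Re h) (Re h); rewrite subrK => /le_trans; apply.
  by rewrite mulr_natl mulr2n; apply: lerD => //; apply: le_trans hx.
have b2 : expR (Re h) <= 2.
  by move: b1; rewrite ler_norml => /andP[_]; move: m5; clear; lra.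
have ep := expR_gt0 (Re h).
have c1 : `|expR (Re h) * (cos (Im h) - 1)| <= 2 * (e / 8 * nrm h).
  rewrite normrM (ger0_norm (ltW ep)); apply: ler_pM => //.
  by apply: (le_trans k2); rewrite ler_pM2l.
have c2 : `|expR (Re h) * (sin (Im h) - Im h)| <= 2 * (e / 8 * nrm h).
  rewrite normrM (ger0_norm (ltW ep)); apply: ler_pM => //.
  by apply: (le_trans k3); rewrite ler_pM2l.
have c3 : `|expR (Re h) - 1 - Re h| <= e / 8 * nrm h by apply: (le_trans k1); rewrite ler_pM2l.
have c4 : `|(expR (Re h) - 1) * Im h| <= 2 * (e / 8 * nrm h).
  rewrite normrM; apply: (le_trans (ler_pM _ _ b1 hy)) => //.
  by rewrite -[leLHS]mulrA ler_pM2l// ler_wpM2r// ltW.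
have := ler_normD (expR (Re h) * (cos (Im h) - 1)) (expR (Re h) - 1 - Re h).
have := ler_normD (expR (Re h) * (sin (Im h) - Im h)) ((expR (Re h) - 1) * Im h).
have : e * nrm h = 8 * (e / 8 * nrm h) by field.
have X0 : 0 <= e / 8 * nrm h by rewrite mulr_ge0// ltW.
move: X0 c1 c2 c3 c4; clear; lra.
Qed.

Lemma cdf_cexp z : cdf cexp (cexp z) z.
Proof.
move=> e e0.
have n0 : 0 < nrm (cexp z) by rewrite nrm_cexp expR_gt0.
have e1 : 0 < e / nrm (cexp z) by rewrite divr_gt0.
have [r r0 hr] := cdf_cexp0 e1; exists r => // h /hr.
rewrite add0r cexp0 mul1r cexpD => hh.
have -> : cexp z * cexp h - cexp z - cexp z * h = cexp z * (cexp h - 1 - h) by ring.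
by rewrite nrmM mulrC -ler_pdivlMr// mulrAC.
Qed.

End ComplexBasics.

(** * Compactness arguments and maxima of upper semicontinuous functions *)

Section Compactness.
Context {R : realType}.
Local Notation C := (Cplx R).

(** Finite subcovers in the form used throughout: by monotonicity the finitely many local indices
    are replaced by the largest. Uniform continuity, boundedness and Dini arguments below are
    instances. *)
Lemma compact_unif_nat (T : topologicalType) (K : set T) (P : nat -> T -> Prop) :
  compact K -> (forall m n x, (m <= n)%N -> P m x -> P n x) ->
  (forall x, K x -> exists n, \forall y \near x, P n y) ->
  exists n, forall x, K x -> P n x.
Proof.
move=> /compact_near_coveringP cK mono h.
have := cK nat \oo%classic P _.
case=> [x /h[n hn]|n _ hn].
  exists ([set y | P n y], [set m | (n <= m)%N]) => /=.
    by split=> //; exists n.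
  by move=> [y m] /= [Py nm]; apply: mono Py.
by exists n; apply: hn => /=.
Qed.

Lemma inv_lt (e : R) : 0 < e -> exists n : nat, n.+1%:R^-1 < e.
Proof.
move=> e0; exists (Num.bound e^-1).
have e1 : 0 < e^-1 by rewrite invr_gt0.
rewrite -[ltRHS]invrK ltf_pV2 ?posrE//; apply: (lt_le_trans (archi_boundP (ltW e1))).
by rewrite ler_nat.
Qed.

Lemma compact_unif (T : topologicalType) (K : set T) (P : R -> T -> Prop) :
  compact K -> (forall d d' x, 0 < d' -> d' <= d -> P d x -> P d' x) ->
  (forall x, K x -> exists2 d, 0 < d & \forall y \near x, P d y) ->
  exists2 d, 0 < d & forall x, K x -> P d x.
Proof.
move=> cK mono h.
have [|x /h[d d0 hd]|n hn] := @compact_unif_nat _ K (fun n => P n.+1%:R^-1) cK.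
- move=> m n x mn; apply: mono; first by rewrite invr_gt0.
  by rewrite lef_pV2 ?posrE// ler_nat.
- have [n hn] := inv_lt d0; exists n; near=> y.
  apply: (mono d); [by rewrite invr_gt0|exact: ltW|by near: y].
- by exists n.+1%:R^-1 => //; rewrite invr_gt0.
Unshelve. all: by end_near. Qed.

Lemma usc_lt_bounded (T : topologicalType) (K : set T) (u : T -> \bar R) : compact K ->
  (forall x, K x -> (u x < +oo)%E) -> usc_on K u -> exists M : R, forall x, K x -> (u x < M%:E)%E.
Proof.
move=> cK uoo usc.
have [|x Kx|n hn] := @compact_unif_nat _ K (fun n x => (u x < n%:R%:E)%E) cK.
- by move=> m n x mn /lt_le_trans; apply; rewrite lee_fin ler_nat.
- have [c uc] : exists c : R, (u x < c%:E)%E.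
    have := uoo _ Kx; case: (u x) => [r _|//|_]; last by exists 0; rewrite ltNyr.
    by exists (r + 1); rewrite lte_fin ltrDl.
  have := usc _ Kx _ uc => h; exists (Num.bound `|c|); near=> y.
  apply: (@lt_trans _ _ c%:E); first by near: y.
  by rewrite lte_fin; apply: le_lt_trans (archi_boundP _) => //; rewrite ler_norm.
- by exists n%:R.
Unshelve. all: by end_near. Qed.

(** The value -oo is allowed, so the supremum is taken over the finite values only. If no maximum
    existed, some value would exceed another and hence be finite, and finitely many sets {u < sup -
    1/(n + 1)} would cover [K], against the definition of the supremum. *)
Lemma usc_max (T : topologicalType) (K : set T) (u : T -> \bar R) : compact K -> K !=set0 ->
  (forall x, K x -> (u x < +oo)%E) -> usc_on K u ->
  exists2 x, K x & forall y, K y -> (u y <= u x)%E.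
Proof.
move=> cK [x0 Kx0] uoo usc.
apply: contrapT => hn.
have hlt x : K x -> exists2 y, K y & (u x < u y)%E.
  move=> Kx; apply: contrapT => hx; apply: hn; exists x => // y Ky.
  by rewrite leNgt; apply/negP => xy; apply: hx; exists y.
have [M hM] := usc_lt_bounded cK uoo usc.
have [y0 Ky0 uy0] := hlt _ Kx0.
pose E := [set r : R | exists2 x, K x & u x = r%:E].
have fin y : K y -> (-oo < u y)%E -> u y = (fine (u y))%:E.
  by move=> Ky yoo; rewrite fineK// fin_real// yoo uoo.
have supE : has_sup E.
  split; first by exists (fine (u y0)), y0 => //; apply: fin => //; apply: le_lt_trans uy0; rewrite leNye.
  by exists M => r [x Kx ux]; rewrite -lee_fin -ux ltW// hM.
have [|x Kx|n hlast] := @compact_unif_nat _ K (fun n x => (u x < (sup E - n.+1%:R^-1)%:E)%E) cK.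
- move=> m n x mn /lt_le_trans; apply; rewrite lee_fin lerB// lef_pV2 ?posrE// ?ler_nat//.
- have [y Ky xy] := hlt _ Kx.
  have uE : u y = (fine (u y))%:E by apply: fin => //; apply: le_lt_trans xy; rewrite leNye.
  have ys : fine (u y) <= sup E by apply: sup_upper_bound => //; exists y.
  have [c xc cs] : exists2 c : R, (u x < c%:E)%E & c < sup E.
    move: xy; rewrite uE; case: (u x) => [r| |] //.
      rewrite lte_fin => rf; exists ((r + sup E) / 2).
        by rewrite lte_fin midf_lt// (lt_le_trans rf).
      by rewrite midf_lt// (lt_le_trans rf).
    by move=> _; exists (sup E - 1); rewrite ?ltNyr// ltrBlDr ltrDl.
  have cs' : 0 < sup E - c by rewrite subr_gt0.
  have [n hnn] := inv_lt cs'.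
  exists n; have := usc _ Kx _ xc; apply: filterS => z /lt_trans; apply.
  by rewrite lte_fin ltrBrDr -ltrBrDl.
have n0 : 0 < n.+1%:R^-1 :> R by rewrite invr_gt0.
have [r [x Kx ux] hr] := sup_adherent n0 supE.
by have := hlast _ Kx; rewrite ux lte_fin => /(lt_trans hr); rewrite ltxx.
Qed.

Lemma compact_cdisc (a : C) (r : R) : compact [set z : C | nrm (z - a) <= r].
Proof.
have [r0|r0] := ltP r 0.
  rewrite (_ : [set _ | _] = set0); first exact: compact0.
  rewrite -subset0 => z /= zr; have := nrm_ge0 (z - a).
  by rewrite leNgt (le_lt_trans zr r0).
pose F (p : R * R) : C := a + (p.1 +i* p.2)%C.
have cF : continuous F.
  move=> p P /nbhsCP[e e0 hP].
  have e2 : 0 < e / 2 by rewrite divr_gt0.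
  exists (ball p.1 (e / 2), ball p.2 (e / 2)) => /=.
    by split; exact: nbhsx_ballx.
  move=> [x y] [/= bx by_]; apply: hP; rewrite /F /=.
  have -> : a + (x +i* y)%C - (a + (p.1 +i* p.2)%C) = ((x - p.1) +i* (y - p.2))%C.
    by rewrite opprD addrACA subrr add0r.
  apply: (le_lt_trans (nrm_ReIm _)) => /=; rewrite [e]splitr; apply: ltrD.
    by move: bx; rewrite /ball /= distrC.
  by move: by_; rewrite /ball /= distrC.
apply: (@subclosed_compact _ _ (F @` (`[- r, r] `*` `[- r, r]))).
- rewrite -openC; apply/openCP => z /= /negP; rewrite -ltNge => zr.
  exists (nrm (z - a) - r); first by rewrite subr_gt0.
  move=> y yz; apply/negP; rewrite -ltNge.
  have := nrm_tri z y a; rewrite (nrmBC z y) => h.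
  by move: yz h; clear; lra.
- apply: continuous_compact; first by apply: continuous_subspaceT.
  by apply: compact_setX; exact: segment_compact.
- move=> z /= zr; exists (complex.Re (z - a), complex.Im (z - a)); last first.
    have e1 : (complex.Re (z - a) +i* complex.Im (z - a))%C = z - a by apply: complex_eq.
    by rewrite /F [X in a + X]e1 addrC subrK.
  by split; rewrite /= in_itv /= -ler_norml; apply: le_trans zr; [exact: Re_nrm|exact: Im_nrm].
Qed.

Lemma closed_bounded_compact (K : set C) (M : R) : closed K -> (forall z, K z -> nrm z <= M) -> compact K.
Proof.
move=> cK h; have cd := @compact_cdisc 0 M.
apply: subclosed_compact cK cd _ => z /h /=.
by rewrite subr0.
Qed.

Lemma compact_circle (a : C) (r : R) : compact [set z : C | nrm (z - a) = r].
Proof.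
have cd := @compact_cdisc a r.
apply: (subclosed_compact _ cd); last by move=> z /= ->.
rewrite -openC; apply/openCP => z /= /eqP zr.
exists `|nrm (z - a) - r|; first by rewrite normr_gt0 subr_eq0.
move=> y yz /= yr.
have := nrm_tri z y a; have := nrm_tri y z a; rewrite (nrmBC z y) yr => h1 h2.
by move: yz; apply/negP; rewrite -leNgt ler_norml; apply/andP; split; move: h1 h2; clear; lra.
Qed.

End Compactness.

(** * Means over circles and the mean value property *)

Section CircleMeans.
Context {R : realType}.
Local Notation C := (Cplx R).
Local Notation "x %:C" := (real_complex _ x) (format "x %:C") : ring_scope.
Local Notation Re := (@complex.Re R).
Local Notation Im := (@complex.Im R).
Implicit Types (z w a : R[i]) (q g : R[i] -> R[i]) (F G : R -> R[i]).

Lemma pi2_gt0 : 0 < 2 * pi :> R. Proof. by rewrite mulr_gt0// pi_gt0. Qed.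

Definition mean (f : R -> R) : R := (2 * pi)^-1 * rint 0 (2 * pi) f.

Definition cmean F : R[i] := (mean (Re \o F) +i* mean (Im \o F))%C.

Definition tcont (f : R -> R) := cont_on 0 (2 * pi) f.

Definition tccont F := tcont (Re \o F) /\ tcont (Im \o F).

Definition ccont q z := forall e : R, 0 < e ->
  exists2 d : R, 0 < d & forall y, nrm (y - z) < d -> nrm (q y - q z) < e.

Lemma meanD (f g : R -> R) : tcont f -> tcont g -> mean (fun t => f t + g t) = mean f + mean g.
Proof. by move=> cf cg; rewrite /mean rintD// mulrDr. Qed.

Lemma meanB (f g : R -> R) : tcont f -> tcont g -> mean (fun t => f t - g t) = mean f - mean g.
Proof. by move=> cf cg; rewrite /mean rintB// mulrBr. Qed.

Lemma meanZ c f : tcont f -> mean (fun t => c * f t) = c * mean f.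
Proof. by move=> cf; rewrite /mean rintZ// mulrCA. Qed.

Lemma mean_cst c : mean (fun=> c) = c.
Proof.
rewrite /mean rint_cst ?(ltW pi2_gt0)// subr0 mulrCA mulVf ?mulr1// gt_eqF//.
exact: pi2_gt0.
Qed.

Lemma mean_le (f g : R -> R) : tcont f -> tcont g -> (forall t, f t <= g t) -> mean f <= mean g.
Proof.
move=> cf cg fg; rewrite /mean ler_pM2l ?invr_gt0 ?pi2_gt0//.
by apply: rint_le.
Qed.

Lemma eq_mean (f g : R -> R) : f =1 g -> mean f = mean g.
Proof. by move=> fg; congr (_ * _); apply: eq_rint. Qed.

Lemma mean_bound f M : tcont f -> (forall t, `|f t| <= M) -> `|mean f| <= M.
Proof.
move=> cf fM; rewrite -[M]mean_cst ler_norml -[X in X <= _]mulN1r -meanZ; last exact: cont_on_cst.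
apply/andP; split; apply: mean_le => //; try exact: cont_on_cst.
- by move=> t; rewrite mulN1r; have := fM t; rewrite ler_norml => /andP[].
- by move=> t; have := fM t; rewrite ler_norml => /andP[].
Qed.

(** The two components are bounded separately, whence the factor 2; it is harmless, since the bound
    only serves to let quantities tend to 0. *)
Lemma cmean_nrm F M : tccont F -> (forall t, nrm (F t) <= M) -> nrm (cmean F) <= 2 * M.
Proof.
move=> [c1 c2] FM; apply: (le_trans (nrm_ReIm _)) => /=; rewrite mulr_natl mulr2n.
apply: lerD; apply: mean_bound => // t /=; apply: le_trans (FM t).
  exact: Re_nrm.
exact: Im_nrm.
Qed.

Lemma tccontD F G : tccont F -> tccont G -> tccont (fun t => F t + G t).
Proof.
move=> [f1 f2] [g1 g2]; split.
  rewrite (_ : _ \o _ = fun t => (Re \o F) t + (Re \o G) t); first exact: cont_onD.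
  by apply/funext => t /=; rewrite cReD.
rewrite (_ : _ \o _ = fun t => (Im \o F) t + (Im \o G) t); first exact: cont_onD.
by apply/funext => t /=; rewrite cImD.
Qed.

Lemma cmeanD F G : tccont F -> tccont G -> cmean (fun t => F t + G t) = cmean F + cmean G.
Proof.
move=> [f1 f2] [g1 g2]; apply: complex_eq; rewrite ?cReD ?cImD /= -meanD//; apply: eq_mean => t /=.
  by rewrite cReD.
by rewrite cImD.
Qed.

Lemma tccontZ c F : tccont F -> tccont (fun t => c * F t).
Proof.
move=> [f1 f2]; split.
  rewrite (_ : _ \o _ = fun t => Re c * (Re \o F) t - Im c * (Im \o F) t).
    by apply: cont_onB; apply: cont_onZ.
  by apply/funext => t /=; rewrite cReM.
rewrite (_ : _ \o _ = fun t => Re c * (Im \o F) t + Im c * (Re \o F) t).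
  by apply: cont_onD; apply: cont_onZ.
by apply/funext => t /=; rewrite cImM.
Qed.

Lemma cmeanZ c F : tccont F -> cmean (fun t => c * F t) = c * cmean F.
Proof.
move=> [f1 f2]; apply: complex_eq; rewrite ?cReM ?cImM /=.
  rewrite -!meanZ// -meanB; try exact: cont_onZ.
  by apply: eq_mean => t /=; rewrite cReM.
rewrite -!meanZ// -meanD; try exact: cont_onZ.
by apply: eq_mean => t /=; rewrite cImM.
Qed.

Lemma cmeanB F G : tccont F -> tccont G -> cmean (fun t => F t - G t) = cmean F - cmean G.
Proof.
move=> cF cG; have cG' := tccontZ (-1) cG.
rewrite -[- cmean G]mulN1r -cmeanZ// -cmeanD//.
by congr (cmean _); apply/funext => t; rewrite mulN1r.
Qed.

Lemma nrm_circ a (r t : R) : nrm (circ_pt a r t - a) = `|r|.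
Proof.
rewrite /circ_pt addrC addKr nrmM nrmr.
by rewrite /nrm /= cos2Dsin2 sqrtr1 mulr1.
Qed.

Lemma circ_ptE a (r t : R) : circ_pt a r t = a + r%:C * (cos t +i* sin t)%C.
Proof. by []. Qed.

Lemma circ_cont a (r t e : R) : 0 < e -> exists2 d, 0 < d & forall s, `|s - t| < d ->
  nrm (circ_pt a r s - circ_pt a r t) < e.
Proof.
move=> e0; have K0 : 0 < 1 + `|r| by rewrite ltr_pwDl.
have e1 : 0 < e / 2 / (1 + `|r|) by rewrite !divr_gt0.
have [d1 d10 h1] := (cont_atP _ _).1 (@continuous_cos R t) _ e1.
have [d2 d20 h2] := (cont_atP _ _).1 (@continuous_sin R t) _ e1.
exists (Num.min d1 d2); first by rewrite lt_min d10.
move=> s; rewrite lt_min => /andP[/h1 k1 /h2 k2].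
have -> : circ_pt a r s - circ_pt a r t = r%:C * ((cos s - cos t) +i* (sin s - sin t))%C.
  by rewrite !circ_ptE; apply: complex_eq => /=; case: a => x y /=; ring.
rewrite nrmM nrmr.
have := nrm_ReIm ((cos s - cos t) +i* (sin s - sin t))%C => /= h.
apply: (le_lt_trans (ler_wpM2l (normr_ge0 _) h)).
have le1 : `|r| * (`|cos s - cos t| + `|sin s - sin t|) <= (1 + `|r|) * (`|cos s - cos t| + `|sin s - sin t|).
  by rewrite ler_wpM2r ?addr_ge0// lerDr.
apply: (le_lt_trans le1); rewrite mulrC -ltr_pdivlMr//.
have -> : e / (1 + `|r|) = e / 2 / (1 + `|r|) + e / 2 / (1 + `|r|) by field; rewrite gt_eqF.
exact: ltrD.
Qed.

Lemma tccont_circ q a (r : R) : 0 <= r -> (forall z, nrm (z - a) = r -> ccont q z) ->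
  tccont (fun t => q (circ_pt a r t)).
Proof.
move=> r0 cq.
have key t e : 0 < e -> exists2 d, 0 < d & forall s, `|s - t| < d ->
    nrm (q (circ_pt a r s) - q (circ_pt a r t)) < e.
  move=> e0; have [d d0 hd] := cq (circ_pt a r t) (etrans (nrm_circ _ _ _) (ger0_norm r0)) _ e0.
  by have [s s0 hs] := circ_cont a r t d0; exists s => // u /hs /hd.
split=> t _; apply/cont_atP => e e0; have [d d0 hd] := key t e e0; exists d => // s /hd /=;
  apply: le_lt_trans.
  by rewrite -cReN -cReD; exact: Re_nrm.
by rewrite -cImN -cImD; exact: Im_nrm.
Qed.

Lemma cdf_ccont g d z : cdf g d z -> ccont g z.
Proof.
move=> /cdf_lip[r r0 hr] e e0.
have D0 : 0 < 1 + nrm d by rewrite ltr_pwDl// nrm_ge0.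
exists (Num.min r (e / (1 + nrm d))); first by rewrite lt_min r0 divr_gt0.
move=> y; rewrite lt_min => /andP[y1 y2].
have := hr _ y1; rewrite addrCA subrr addr0 => hh.
by apply: (le_lt_trans hh); rewrite mulrC -ltr_pdivlMr.
Qed.

Lemma cdf_cdiff d (x y : R) (H : R[i] -> R[i]) : cdf H d (x +i* y)%C ->
  cdiff_at (fun x y => Re (H (x +i* y)%C)) (fun x y => Im (H (x +i* y)%C)) x y.
Proof.
move=> hd; exists (Re d), (Im d) => e e0.
have [r r0 hr] := hd _ e0.
exists (r / 2); first by rewrite divr_gt0.
move=> x' y' hx hy.
pose h : R[i] := ((x' - x) +i* (y' - y))%C.
have hle : nrm h <= `|x' - x| + `|y' - y| by exact: nrm_ReIm.
have hlt : nrm h < r by apply: (le_lt_trans hle); rewrite [r]splitr; apply: ltrD.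
have := hr _ hlt.
have -> : (x +i* y)%C + h = (x' +i* y')%C by apply: complex_eq => /=; ring.
move=> hh; have {}hh := le_trans hh (ler_wpM2l (ltW e0) hle).
split; apply: le_trans hh.
  have := Re_nrm (H (x' +i* y')%C - H (x +i* y)%C - d * h).
  by rewrite !cReD !cReN cReM.
have := Im_nrm (H (x' +i* y')%C - H (x +i* y)%C - d * h).
by rewrite !cImD !cImN cImM /= [_ + Im d * _]addrC.
Qed.

Lemma circ_exp a (x t : R) : a + cexp (x +i* t)%C = circ_pt a (expR x) t.
Proof. by []. Qed.

(** The map z -> a + exp z carries the rectangle [ln r1, ln r2] x [0, 2 pi] onto the annulus. By
    periodicity the horizontal sides cancel, and Goursat's theorem equates the integrals over the
    vertical ones. *)
Lemma mean_annulus_Im g a (r1 r2 : R) : 0 < r1 -> r1 <= r2 ->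
  (forall z, r1 <= nrm (z - a) <= r2 -> exists d, cdf g d z) ->
  mean (fun t => Im (g (circ_pt a r1 t))) = mean (fun t => Im (g (circ_pt a r2 t))).
Proof.
move=> r10 r12 hg; have r20 := lt_le_trans r10 r12.
pose H z := g (a + cexp z).
have hH : cdiff_on (fun x y => Re (H (x +i* y)%C)) (fun x y => Im (H (x +i* y)%C)) (ln r1) (ln r2) 0 (2 * pi).
  move=> x y /andP[x1 x2] _.
  have [|d hd] := hg (a + cexp (x +i* y)%C).
    rewrite circ_exp nrm_circ ger0_norm ?expR_ge0//.
    rewrite -ler_expR lnK ?posrE// in x1; rewrite -ler_expR lnK ?posrE// in x2.
    by rewrite x1 x2.
  have hc := cdfD (cdf_cst a (x +i* y)%C) (cdf_cexp (x +i* y)%C).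
  exact: cdf_cdiff (cdf_comp hc hd).
have l12 : ln r1 <= ln r2 by rewrite ler_ln ?posrE.
have := goursat l12 (ltW pi2_gt0) hH; rewrite /bint.
have [_ cy] := cdiff_on_cont hH.
have l1 : ln r1 <= ln r1 <= ln r2 by rewrite lexx.
have l2 : ln r1 <= ln r2 <= ln r2 by rewrite l12 lexx.
rewrite (rintB (cy _ l2).2 (cy _ l1).2).
have -> : rint (ln r1) (ln r2) (fun x => Re (H (x +i* 0)%C) - Re (H (x +i* (2 * pi))%C)) = 0.
  rewrite (@eq_rint _ _ _ _ (fun=> 0)) ?rint_cst ?mul0r// => x _.
  by rewrite /H !circ_exp !circ_ptE cos0 sin0 mulr_natl cos2pi sin2pi subrr.
rewrite sub0r => /eqP; rewrite oppr_eq0 subr_eq0 => /eqP h.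
congr (_ * _).
rewrite [LHS](@eq_rint _ _ _ _ (fun y => Im (H (ln r1 +i* y)%C))).
  rewrite -h; apply: eq_rint => y _.
  by rewrite /H circ_exp lnK.
by move=> y _; rewrite /H circ_exp lnK.
Qed.

Lemma cdfZ c g d z : cdf g d z -> cdf (fun x => c * g x) (c * d) z.
Proof.
move=> hg; have := cdfM (cdf_cst c z) hg.
by rewrite mul0r add0r.
Qed.

(** The real part of the contour integral only controls imaginary means; the real ones follow by
    passing to i g. *)
Lemma cmean_annulus g a (r1 r2 : R) : 0 < r1 -> r1 <= r2 ->
  (forall z, r1 <= nrm (z - a) <= r2 -> exists d, cdf g d z) ->
  cmean (fun t => g (circ_pt a r1 t)) = cmean (fun t => g (circ_pt a r2 t)).
Proof.
move=> r10 r12 hg; apply: complex_eq => /=; last exact: mean_annulus_Im.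
have := @mean_annulus_Im (fun z => 'i%C * g z) a r1 r2 r10 r12 _.
rewrite (@eq_mean _ (fun t => Re (g (circ_pt a r1 t)))); last first.
  by move=> t; rewrite cImM /= mul0r add0r mul1r.
rewrite (@eq_mean (fun t => Im ('i%C * g (circ_pt a r2 t))) (fun t => Re (g (circ_pt a r2 t)))); last first.
  by move=> t; rewrite cImM /= mul0r add0r mul1r.
by apply=> z /hg[d hd]; exists ('i%C * d); exact: cdfZ.
Qed.

(** Differentiability on the bounding circle is meant in the full complex sense, so continuity of
    the boundary values comes for free. *)
Definition hol_disc g a (r : R) := forall z, nrm (z - a) <= r -> exists d, cdf g d z.

Lemma hol_disc_tccont g a (r s : R) : hol_disc g a r -> 0 <= s <= r -> tccont (fun t => g (circ_pt a s t)).
Proof.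
move=> hg /andP[s0 sr]; apply: tccont_circ => // z zs; have [|d] := hg z; first by rewrite zs.
exact: cdf_ccont.
Qed.

Lemma nrm_eps_eq z w : (forall e : R, 0 < e -> nrm (z - w) <= e) -> z = w.
Proof.
move=> h; apply/eqP; rewrite -subr_eq0 -nrm_eq0 eq_le nrm_ge0 andbT.
by apply/ler_addgt0Pr => e e0; rewrite add0r h.
Qed.

Lemma cmean_cst c : cmean (fun=> c) = c.
Proof. by apply: complex_eq => /=; rewrite -[RHS]mean_cst; apply: eq_mean. Qed.

Lemma tccont_cst c : tccont (fun=> c).
Proof. by split; exact: cont_on_cst. Qed.

Lemma cmean_value g a (r : R) : 0 < r -> hol_disc g a r ->
  cmean (fun t => g (circ_pt a r t)) = g a.
Proof.
move=> r0 hg; apply: nrm_eps_eq => e e0.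
have [|d hd] := hg a; first by rewrite subrr nrm0 ltW.
have e2 : 0 < e / 2 by rewrite divr_gt0.
have [s s0 hs] := cdf_ccont hd e2.
pose p := Num.min (s / 2) r.
have p0 : 0 < p by rewrite lt_min r0 divr_gt0.
have pr : p <= r by rewrite ge_min lexx orbT.
rewrite -(@cmean_annulus g a p r) //; last first.
  by move=> z /andP[_]; exact: hg.
have cg : tccont (fun t => g (circ_pt a p t)) by apply: (hol_disc_tccont hg); rewrite ltW.
rewrite -[X in _ - X](cmean_cst (g a)) -(cmeanB cg (tccont_cst _)).
have -> : e = 2 * (e / 2) by field.
apply: cmean_nrm; first by apply: (tccontD cg); exact: tccont_cst.
move=> t; apply/ltW/hs; rewrite nrm_circ gtr0_norm// gt_min.
by rewrite ltr_pdivrMr// ltr_pMr// ltr1n.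
Qed.

Lemma mean_value g a (r : R) : 0 < r -> hol_disc g a r ->
  mean (fun t => Re (g (circ_pt a r t))) = Re (g a).
Proof. by move=> r0 /(cmean_value r0) <-. Qed.

End CircleMeans.

(** * Cauchy and Poisson kernels *)

Section Kernels.
Context {R : realType}.
Local Notation C := (Cplx R).
Local Notation "x %:C" := (real_complex _ x) (format "x %:C") : ring_scope.
Local Notation Re := (@complex.Re R).
Local Notation Im := (@complex.Im R).
Local Notation cj := (@conjc R).
Implicit Types (z w a : R[i]) (q g : R[i] -> R[i]) (F G : R -> R[i]).

Lemma ccont_unif (K : set C) q : compact K -> (forall z, K z -> ccont q z) ->
  forall e : R, 0 < e -> exists2 d : R, 0 < d &
    forall z, K z -> forall y, nrm (y - z) < d -> nrm (q y - q z) < e.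
Proof.
move=> cK cq e e0.
apply: (@compact_unif _ _ K (fun d z => forall y : R[i], nrm (y - z) < d -> nrm (q y - q z) < e) cK).
  by move=> d d' x _ d'd h y yx; apply: h; apply: lt_le_trans d'd.
move=> x Kx; have e2 : 0 < e / 2 by rewrite divr_gt0.
have [d d0 hd] := cq x Kx _ e2.
have d2 : 0 < d / 2 by rewrite divr_gt0.
exists (d / 2) => //; apply/nbhsCP; exists (d / 2) => // z zx y yz.
have h1 : nrm (y - x) < d.
  by apply: (le_lt_trans (nrm_tri _ z _)); rewrite [d]splitr; apply: ltrD.
have h2 : nrm (z - x) < d by apply: (lt_trans zx); rewrite ltr_pdivrMr// ltr_pMr// ltr1n.
apply: (le_lt_trans (nrm_tri _ (q x) _)); rewrite [e]splitr; apply: ltrD; first exact: hd.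
by rewrite nrmBC; exact: hd.
Qed.

Lemma nrm_cj z : nrm (cj z) = nrm z.
Proof. by rewrite /nrm; case: z => x y /=; rewrite sqrrN. Qed.

Lemma cj_mul z : z * cj z = ((nrm z) ^+ 2)%:C.
Proof. by rewrite nrm_sqr; apply: complex_eq; case: z => x y /=; ring. Qed.

Lemma cjM z w : cj (z * w) = cj z * cj w.
Proof. by case: z => a b; case: w => c d; apply: complex_eq => /=; ring. Qed.

Lemma cjB z w : cj (z - w) = cj z - cj w.
Proof. by case: z => a b; case: w => c d; apply: complex_eq => /=; ring. Qed.

Lemma cmean_cj F : tccont F -> cmean (fun t => cj (F t)) = cj (cmean F).
Proof.
move=> [c1 c2]; apply: complex_eq => /=; last first.
  rewrite -[RHS]mulN1r -(meanZ _ c2); apply: eq_mean => t /=.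
  by rewrite mulN1r; case: (F t).
by apply: eq_mean => t /=; case: (F t).
Qed.

Lemma cdf_kernel z w : w - z != 0 -> exists d, cdf (fun x => x / (x - z)) d w.
Proof.
move=> wz.
have h1 := cdfD (cdf_id w) (cdf_cst (- z) w).
have h2 := cdf_comp h1 (cdf_inv wz).
by eexists; exact: (cdfM (cdf_id w) h2).
Qed.

Lemma circ0_nrm (r t : R) : 0 <= r -> nrm (circ_pt 0 r t) = r.
Proof. by move=> r0; rewrite -[X in nrm X]subr0 nrm_circ ger0_norm. Qed.

Lemma sub_nz z w : nrm z < nrm w -> w - z != 0.
Proof. by apply: contraL => /eqP/subr0_eq ->; rewrite ltxx. Qed.

Lemma tccont_kernel z (r : R) : nrm z < r -> tccont (fun t => circ_pt 0 r t / (circ_pt 0 r t - z)).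
Proof.
move=> zr; have r0 : 0 <= r by apply: le_trans (ltW zr); exact: nrm_ge0.
apply: (@tccont_circ _ (fun x => x / (x - z)) 0 r r0) => w; rewrite subr0 => wr.
have [|d] := @cdf_kernel z w; first by apply: sub_nz; rewrite wr.
exact: cdf_ccont.
Qed.

Lemma hol_disc_refl z (r : R) : nrm z < r -> forall c : R[i],
  hol_disc (fun x => c / ((r ^+ 2)%:C - cj z * x)) 0 r.
Proof.
move=> zr c x; rewrite subr0 => xr.
have r0 : 0 < r by apply: le_lt_trans zr; exact: nrm_ge0.
have nz : (r ^+ 2)%:C - cj z * x != 0.
  apply: sub_nz; rewrite nrmM nrm_cj nrmr ger0_norm ?sqr_ge0// expr2.
  have [->|x0] := eqVneq x 0; first by rewrite nrm0 mulr0 mulr_gt0.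
  by apply: (@le_lt_trans _ _ (nrm z * r)); rewrite ?ler_wpM2l ?nrm_ge0// ltr_pM2r.
have h1 := cdfD (cdf_cst (r ^+ 2)%:C x) (cdfZ (-1) (cdfZ (cj z) (cdf_id x))).
have -> : (fun x => c / ((r ^+ 2)%:C - cj z * x)) = (fun x => c * ((r ^+ 2)%:C + -1 * (cj z * x))^-1).
  by apply/funext => y; rewrite mulN1r.
have nz' : (r ^+ 2)%:C + -1 * (cj z * x) != 0 by rewrite mulN1r.
by eexists; exact: cdfZ (cdf_comp h1 (cdf_inv nz')).
Qed.

(** On the circle w conj(w) = r^2, so the Cauchy kernel is there the conjugate of a function of [w]
    holomorphic on the closed disc. Its mean can thus be read off at the centre. *)
Lemma kernel_cj z w (r : R) : 0 < r -> nrm z < r -> nrm w = r ->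
  w / (w - z) = cj ((r ^+ 2)%:C / ((r ^+ 2)%:C - cj z * w)).
Proof.
move=> r0 zr wr.
have wz : w - z != 0 by apply: sub_nz; rewrite wr.
have w0 : w != 0 by rewrite -nrm_gt0 wr.
have ww : w * cj w = (r ^+ 2)%:C by rewrite cj_mul wr.
have cw0 : cj w != 0 by rewrite -nrm_gt0 nrm_cj wr.
rewrite cjM conjc_inv cjB cjM conjcK conjc_real -ww.
by rewrite -mulrBl invfM mulrACA divff// mulr1.
Qed.

Lemma cmean_kernel z (r : R) : nrm z < r ->
  cmean (fun t => circ_pt 0 r t / (circ_pt 0 r t - z)) = 1.
Proof.
move=> zr; have r0 : 0 < r by apply: le_lt_trans zr; exact: nrm_ge0.
have h := hol_disc_refl zr ((r ^+ 2)%:C).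
have r00 : 0 <= r <= r by rewrite lexx ltW.
rewrite (_ : (fun t => _) = (fun t => cj ((r ^+ 2)%:C / ((r ^+ 2)%:C - cj z * circ_pt 0 r t)))).
  rewrite (cmean_cj (hol_disc_tccont h r00)) (cmean_value r0 h) mulr0 subr0 divff ?conjc1//.
  by rewrite -nrm_gt0 nrmr normr_gt0 expf_neq0// gt_eqF.
by apply/funext => t; apply: kernel_cj => //; exact: circ0_nrm (ltW r0).
Qed.

(** This is Re ((w + z) / (w - z)), that is (|w|^2 - |z|^2) / |w - z|^2; the form chosen exhibits it
    as a real part of the Cauchy kernel. *)
Definition poisson z w : R := 2 * Re (w / (w - z)) - 1.

Lemma poissonE z w (r : R) : nrm z < r -> nrm w = r ->
  poisson z w * nrm (w - z) ^+ 2 = r ^+ 2 - nrm z ^+ 2.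
Proof.
move=> zr wr; have wz : w - z != 0 by apply: sub_nz; rewrite wr.
pose k : R[i] := w / (w - z); have kE : k * (w - z) = w by rewrite /k divfK.
have e1 : Re k * (Re w - Re z) - Im k * (Im w - Im z) = Re w.
  by rewrite -[in RHS]kE cReM cReD cReN cImD cImN.
have e2 : Re k * (Im w - Im z) + Im k * (Re w - Re z) = Im w.
  by rewrite -[in RHS]kE cImM cReD cReN cImD cImN.
rewrite /poisson -/k -wr !nrm_sqr cReD cImD cReN cImN.
have -> : (2 * Re k - 1) * ((Re w - Re z) ^+ 2 + (Im w - Im z) ^+ 2) =
  2 * ((Re w - Re z) * (Re k * (Re w - Re z) - Im k * (Im w - Im z)) +
       (Im w - Im z) * (Re k * (Im w - Im z) + Im k * (Re w - Re z)))
  - ((Re w - Re z) ^+ 2 + (Im w - Im z) ^+ 2) by ring.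
by rewrite e1 e2; ring.
Qed.

Lemma poisson_ge0 z w (r : R) : nrm z < r -> nrm w = r -> 0 <= poisson z w.
Proof.
move=> zr wr; have wz : w - z != 0 by apply: sub_nz; rewrite wr.
have n0 : 0 < nrm (w - z) ^+ 2 by rewrite exprn_gt0// nrm_gt0.
rewrite -(pmulr_lge0 _ n0) (poissonE zr wr) subr_ge0 ler_sqr ?nnegrE ?nrm_ge0//; first exact: ltW.
by rewrite (le_trans _ (ltW zr))// nrm_ge0.
Qed.

Lemma tcont_poisson z (r : R) : nrm z < r -> tcont (fun t => poisson z (circ_pt 0 r t)).
Proof.
move=> zr; apply: cont_onB; last exact: cont_on_cst.
by apply: cont_onZ; exact: (tccont_kernel zr).1.
Qed.

Lemma mean_poisson z (r : R) : nrm z < r -> mean (fun t => poisson z (circ_pt 0 r t)) = 1.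
Proof.
move=> zr; have [c1 _] := tccont_kernel zr.
rewrite /poisson meanB; [|exact: cont_onZ|exact: cont_on_cst].
rewrite meanZ// mean_cst.
have /(congr1 Re) /= h := cmean_kernel zr.
rewrite (_ : mean _ = 1); first by ring.
exact: h.
Qed.

Lemma tccontM_real (f : R -> R) F : tcont f -> tccont F -> tccont (fun t => (f t)%:C * F t).
Proof.
move=> cf [c1 c2]; split.
  rewrite (_ : _ \o _ = fun t => f t * (Re \o F) t); first exact: cont_onM.
  by apply/funext => t /=; rewrite cReZ.
rewrite (_ : _ \o _ = fun t => f t * (Im \o F) t); first exact: cont_onM.
by apply/funext => t /=; rewrite cImZ.
Qed.

(** Differentiation under the mean: the remainder of the kernel is h^2 w / ((w - z)^2 (w - z - h)),
    and both distances are bounded below in terms of 1 - |z|. *)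
Lemma cauchy_integral_cdf (psi : R -> R) (M : R) z : tcont psi -> (forall t, `|psi t| <= M) -> nrm z < 1 ->
  exists d, cdf (fun x => cmean (fun t => (psi t)%:C * (circ_pt 0 1 t / (circ_pt 0 1 t - x)))) d z.
Proof.
move=> cpsi psiM z1.
have M0 : 0 <= M by apply: le_trans (psiM 0).
pose k2 t := circ_pt 0 1 t / (circ_pt 0 1 t - z) * (circ_pt 0 1 t - z)^-1.
have ck2 : tccont k2.
  apply: (@tccont_circ _ (fun x => x / (x - z) * (x - z)^-1) 0 1 ler01) => w; rewrite subr0 => w1.
  have wz : w - z != 0 by apply: sub_nz; rewrite w1.
  have h1 := cdfD (cdf_id w) (cdf_cst (- z) w).
  have h2 := cdf_comp h1 (cdf_inv wz).
  exact: cdf_ccont (cdfM (cdfM (cdf_id w) h2) h2).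
exists (cmean (fun t => (psi t)%:C * k2 t)) => e e0.
set dl := 1 - nrm z; have dl0 : 0 < dl by rewrite subr_gt0.
have K0 : 0 < 4 * M + 1 by rewrite ltr_wpDl// mulr_ge0.
(* In 4 M one factor 2 comes from [cmean_nrm] and one from |w - z - h| >= dl / 2; the 1 guards
   against M = 0. *)
exists (Num.min (dl / 2) (e * dl ^+ 3 / (4 * M + 1))).
  by rewrite lt_min !divr_gt0// mulr_gt0// exprn_gt0.
move=> h; rewrite lt_min => /andP[h1 h2].
have zh1 : nrm (z + h) < 1.
  apply: (le_lt_trans (nrmD _ _)); move: h1; rewrite /dl => h1.
  by have := nrm_ge0 h; move: h1 z1; clear; lra.
have c1 := tccontM_real cpsi (tccont_kernel zh1).
have c2 := tccontM_real cpsi (tccont_kernel z1).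
have c3 := tccontM_real cpsi ck2.
have c3h := tccontZ h c3.
rewrite -(cmeanB c1 c2) [_ * h]mulrC -(cmeanZ _ c3) -(cmeanB _ c3h); last first.
  by have := tccontD c1 (tccontZ (-1) c2); under [X in tccont X]eq_fun do rewrite mulN1r.
have bnd : forall t, nrm ((psi t)%:C * (circ_pt 0 1 t / (circ_pt 0 1 t - (z + h))) -
    (psi t)%:C * (circ_pt 0 1 t / (circ_pt 0 1 t - z)) - h * ((psi t)%:C * k2 t)) <= M * (nrm h ^+ 2 * (2 / dl ^+ 3)).
  move=> t; rewrite /k2; move: (circ_pt 0 1 t : R[i]) (circ0_nrm t ler01) => w w1.
  have wz : w - z != 0 by apply: sub_nz; rewrite w1.
  have wzh : w - (z + h) != 0 by apply: sub_nz; rewrite w1.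
  have -> : (psi t)%:C * (w / (w - (z + h))) - (psi t)%:C * (w / (w - z)) - h * ((psi t)%:C * (w / (w - z) / (w - z)))
     = (psi t)%:C * (h ^+ 2 * (w * ((w - z)^-1 ^+ 2 * (w - (z + h))^-1))).
    by field; rewrite wz wzh.
  rewrite nrmM nrmr nrmM nrmX nrmM w1 mul1r nrmM nrmX !nrmV.
  rewrite (expr2 (nrm (w - z))^-1).
  have d1 : dl <= nrm (w - z) by have := nrmB_ge w z; rewrite w1.
  have d2 : dl / 2 <= nrm (w - (z + h)).
    have := nrmB_ge w (z + h); rewrite w1; have := nrmD z h; move: h1; rewrite /dl; clear; lra.
  apply: ler_pM => //; first by rewrite ?mulr_ge0 ?invr_ge0 ?nrm_ge0.
  apply: ler_wpM2l; first by rewrite mulr_ge0 ?nrm_ge0.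
  have i1 : (nrm (w - z))^-1 <= dl^-1 by rewrite lef_pV2// posrE (lt_le_trans dl0).
  have i2 : (nrm (w - (z + h)))^-1 <= 2 / dl.
    by rewrite -[2]invrK -invfM lef_pV2 ?posrE ?mulr_gt0 ?invr_gt0// ?nrm_gt0// mulrC.
  rewrite (_ : 2 / dl ^+ 3 = dl^-1 * dl^-1 * (2 / dl)); last by field; rewrite gt_eqF.
  by apply: (ler_pM _ _ (ler_pM _ _ i1 i1) i2); rewrite ?mulr_ge0 ?invr_ge0 ?nrm_ge0.
apply: (le_trans (cmean_nrm _ bnd)).
  have := tccontD (tccontD c1 (tccontZ (-1) c2)) (tccontZ (-1) c3h).
  by under [X in tccont X]eq_fun do rewrite !mulN1r.
rewrite (_ : 2 * (M * (nrm h ^+ 2 * (2 / dl ^+ 3))) = 4 * M * nrm h / dl ^+ 3 * nrm h); last by field; rewrite gt_eqF.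
rewrite ler_wpM2r ?nrm_ge0// ler_pdivrMr ?exprn_gt0//.
apply: (@le_trans _ _ ((4 * M + 1) * nrm h)); first by rewrite ler_wpM2r ?nrm_ge0// lerDl.
by rewrite mulrC -ler_pdivlMr// ltW.
Qed.

End Kernels.

(** * Harmonic functions with nearly prescribed Lipschitz boundary values *)

Section HarmonicExtension.
Context {R : realType}.
Local Notation C := (Cplx R).
Local Notation "x %:C" := (real_complex _ x) (format "x %:C") : ring_scope.
Local Notation Re := (@complex.Re R).
Implicit Types (z w a : R[i]) (q g : R[i] -> R[i]).

Lemma circ_scale a (r t : R) : circ_pt a r t = a + r%:C * circ_pt 0 1 t.
Proof. by rewrite !circ_ptE add0r mul1r. Qed.

Definition lipschitz (L : R) (phi : R[i] -> R) := forall z w, `|phi z - phi w| <= L * nrm (z - w).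

Lemma lipschitz_tcont L (phi : R[i] -> R) a (r : R) : 0 <= L -> lipschitz L phi ->
  tcont (fun t => phi (circ_pt a r t)).
Proof.
move=> L0 lip t _; apply/cont_atP => e e0.
have L1 : 0 < 1 + L by rewrite ltr_pwDl.
have [|d d0 hd] := @circ_cont _ a r t (e / (1 + L)); first by rewrite divr_gt0.
exists d => // s /hd h; apply: (le_lt_trans (lip _ _)).
apply: (@le_lt_trans _ _ ((1 + L) * nrm (circ_pt a r s - circ_pt a r t))).
  by rewrite ler_wpM2r ?nrm_ge0// lerDr.
by rewrite mulrC -ltr_pdivlMr.
Qed.

(** Use |w - u| <= d + |w - u|^2 / d together with |w - u| <= 2 |w - r u|: the square then cancels
    the denominator |w - r u|^2 of the kernel, leaving the numerator 1 - r^2. *)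
Lemma poisson_lip_weight (u w : R[i]) (d r : R) : 0 < d -> 0 <= r -> r < 1 -> nrm u = 1 -> nrm w = 1 ->
  nrm (w - u) * poisson (r%:C * u) w <= d * poisson (r%:C * u) w + 4 * (1 - r ^+ 2) / d.
Proof.
move=> d0 r0 r1 u1 w1.
have x1 : nrm (r%:C * u) < 1 by rewrite nrmM u1 mulr1 nrmr ger0_norm.
have P0 := poisson_ge0 x1 w1.
have PE := poissonE x1 w1.
have nx : nrm (r%:C * u) = r by rewrite nrmM u1 mulr1 nrmr ger0_norm.
rewrite nx expr1n in PE.
set P := poisson _ _ in P0 PE *; set y := nrm (w - r%:C * u) in PE.
have y0 : 0 <= y by exact: nrm_ge0.
have hy : nrm (w - u) <= 2 * y.
  have h1 := nrm_tri w (r%:C * u) u.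
  have h2 : nrm (r%:C * u - u) = 1 - r.
    have -> : r%:C * u - u = (r - 1)%:C * u by rewrite rmorphB /=; ring.
    by rewrite nrmM u1 mulr1 nrmr distrC ger0_norm// subr_ge0 ltW.
  have h3 := nrmB_ge w (r%:C * u); rewrite nx w1 in h3.
  by move: h1 h2 h3; rewrite -/y; clear; lra.
have n0 := nrm_ge0 (w - u).
have hsq : nrm (w - u) <= d + nrm (w - u) ^+ 2 / d.
  rewrite -lerBlDl ler_pdivlMr//.
  move: (nrm (w - u)) n0 (mulr_ge0 n0 (ltW d0)) => n _ nd.
  have := sqr_ge0 (n - d); have -> : (n - d) ^+ 2 = n ^+ 2 - 2 * (n * d) + d ^+ 2 by ring.
  have -> : (n - d) * d = n * d - d ^+ 2 by ring.
  by move: nd; clear; lra.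
apply: (le_trans (ler_wpM2r P0 hsq)); rewrite mulrDl lerD2l mulrAC ler_pM2r ?invr_gt0//.
rewrite -PE mulrC [4 * _]mulrCA ler_wpM2l//.
have -> : 4 * y ^+ 2 = (2 * y) ^+ 2 by ring.
by rewrite ler_sqr ?nnegrE ?mulr_ge0.
Qed.

(* The Poisson integral of phi, taken on a slightly larger circle after rescaling. *)
Lemma harmonic_approx (phi : R[i] -> R) (L : R) a (r e : R) : 0 <= L -> lipschitz L phi -> 0 < r -> 0 < e ->
  exists2 g, hol_disc g a r & forall z, nrm (z - a) = r -> `|Re (g z) - phi z| <= e.
Proof.
move=> L0 lip r0 e0.
pose psi t := phi (circ_pt a r t).
have cpsi : tcont psi by exact: lipschitz_tcont lip.
pose M := `|phi a| + L * r.
have psiM t : `|psi t| <= M.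
  have := lip (circ_pt a r t) a; rewrite nrm_circ (gtr0_norm r0) => h.
  by have := ler_normD (phi (circ_pt a r t) - phi a) (phi a); rewrite subrK /M /psi; move: h; clear; lra.
pose d0 := e / (2 * (L * r + 1)).
have Lr0 : 0 <= L * r by rewrite mulr_ge0// ltW.
have d00 : 0 < d0 by rewrite divr_gt0// mulr_gt0// ltr_wpDl.
pose d := Num.min d0 1.
have dpos : 0 < d by rewrite lt_min d00 ltr01.
have d1 : d <= 1 by rewrite ge_min lexx orbT.
have dd0 : d <= d0 by rewrite ge_min lexx.
(* With this choice 4 (1 - rho^2) <= d^2, so the error L r (d + 4 (1 - rho^2) / d) is at most 2 L r
   d, and [d <= d0] brings it below [e]. *)
pose rho := 1 - d ^+ 2 / 8.
have dsq : d ^+ 2 <= 1 by rewrite exprn_ile1// ltW.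
have dsq0 : 0 < d ^+ 2 by rewrite exprn_gt0.
have rho0 : 0 <= rho by rewrite /rho; move: dsq; clear; lra.
have rho1 : rho < 1 by rewrite /rho; move: dsq0; clear; lra.
have rho2 : 4 * (1 - rho ^+ 2) <= d ^+ 2.
  have -> : 1 - rho ^+ 2 = (1 - rho) * (1 + rho) by ring.
  by rewrite {1}/rho; move: dsq0 rho0 rho1; clear; nra.
pose ca x := cmean (fun t => (psi t)%:C * (circ_pt 0 1 t / (circ_pt 0 1 t - x))).
pose sc z : R[i] := (rho / r)%:C * (z - a).
have sc1 z : nrm (z - a) <= r -> nrm (sc z) < 1.
  have rr0 : 0 <= rho / r by rewrite divr_ge0// ltW.
  move=> za; rewrite /sc nrmM nrmr ger0_norm//.
  apply: (@le_lt_trans _ _ (rho / r * r)); first by rewrite ler_wpM2l.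
  by rewrite divfK// gt_eqF.
(* Since the Poisson kernel is 2 Re (w / (w - z)) - 1, the real part of [g] is the Poisson integral
   of [psi] at [sc z]. *)
pose g z := 2%:C * ca (sc z) + (- mean psi)%:C.
exists g => [z za|z za].
  have [dd hd] := cauchy_integral_cdf cpsi psiM (sc1 _ za).
  have hs := cdfZ (rho / r)%:C (cdfD (cdf_id z) (cdf_cst (- a) z)).
  eexists; exact: cdfD (cdfZ 2%:C (cdf_comp hs hd)) (cdf_cst _ z).
have zle : nrm (z - a) <= r by rewrite za.
pose u : R[i] := (r^-1)%:C * (z - a).
have u1 : nrm u = 1 by rewrite nrmM nrmr ger0_norm ?invr_ge0 ?ltW// za mulVf// gt_eqF.
have scu : sc z = rho%:C * u by rewrite /sc /u rmorphM /= mulrA.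
have zu : z = a + r%:C * u.
  by rewrite /u mulrA -rmorphM /= divff ?gt_eqF// mul1r addrC subrK.
have x1 : nrm (rho%:C * u) < 1 by rewrite -scu; exact: sc1.
have cP := tcont_poisson x1.
have cPsi := cont_onM cpsi cP.
have gE : Re (g z) = mean (fun t => psi t * poisson (rho%:C * u) (circ_pt 0 1 t)).
  rewrite /g scu cReD cReZ /=.
  have [ck _] := tccontM_real cpsi (tccont_kernel x1).
  rewrite -meanZ// -meanB//; last exact: cont_onZ.
  by apply: eq_mean => t /=; rewrite cReZ /poisson; ring.
have -> : phi z = mean (fun t => phi z * poisson (rho%:C * u) (circ_pt 0 1 t)).
  by rewrite meanZ// mean_poisson// mulr1.
rewrite gE -meanB//; last exact: cont_onZ.
have cW : tcont (fun t => L * r * (d * poisson (rho%:C * u) (circ_pt 0 1 t) + 4 * (1 - rho ^+ 2) / d)).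
  by apply: cont_onZ; apply: cont_onD; [exact: cont_onZ|exact: cont_on_cst].
have cD : tcont (fun t => psi t * poisson (rho%:C * u) (circ_pt 0 1 t) - phi z * poisson (rho%:C * u) (circ_pt 0 1 t)).
  by apply: cont_onB => //; exact: cont_onZ.
have key t : `|psi t * poisson (rho%:C * u) (circ_pt 0 1 t) - phi z * poisson (rho%:C * u) (circ_pt 0 1 t)|
   <= L * r * (d * poisson (rho%:C * u) (circ_pt 0 1 t) + 4 * (1 - rho ^+ 2) / d).
  have w1 : nrm (circ_pt 0 1 t) = 1 by rewrite circ0_nrm.
  have P0 := poisson_ge0 x1 w1.
  rewrite -mulrBl normrM (ger0_norm P0).
  have hl : `|psi t - phi z| <= L * r * nrm (circ_pt 0 1 t - u).
    rewrite /psi {1}zu; apply: (le_trans (lip _ _)); rewrite circ_scale.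
    have -> : a + r%:C * circ_pt 0 1 t - (a + r%:C * u) = r%:C * (circ_pt 0 1 t - u) by ring.
    by rewrite nrmM nrmr (gtr0_norm r0) mulrA.
  apply: (le_trans (ler_wpM2r P0 hl)); rewrite -[leLHS]mulrA ler_wpM2l//.
  exact: poisson_lip_weight.
have mW : mean (fun t => L * r * (d * poisson (rho%:C * u) (circ_pt 0 1 t) + 4 * (1 - rho ^+ 2) / d)) = L * r * (d + 4 * (1 - rho ^+ 2) / d).
  rewrite meanZ; last by apply: cont_onD; [exact: cont_onZ|exact: cont_on_cst].
  rewrite meanD; [|exact: cont_onZ|exact: cont_on_cst].
  by rewrite meanZ// mean_poisson// mulr1 mean_cst.
have tot : L * r * (d + 4 * (1 - rho ^+ 2) / d) <= e.
  have h1 : 4 * (1 - rho ^+ 2) / d <= d by rewrite ler_pdivrMr// -expr2.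
  apply: (@le_trans _ _ (L * r * (2 * d0))).
    by rewrite ler_wpM2l//; move: h1 dd0; clear; lra.
  rewrite /d0 (_ : L * r * (2 * (e / (2 * (L * r + 1)))) = e * (L * r / (L * r + 1))).
    rewrite ler_piMr ?(ltW e0)// ler_pdivrMr ?mul1r ?lerDl//.
    by rewrite ltr_wpDl.
  by field; rewrite gt_eqF// ltr_wpDl.
rewrite ler_norml; apply/andP; split.
  rewrite lerNl; apply: le_trans tot; rewrite -mW.
  rewrite -[- mean _]mulN1r -meanZ//; apply: mean_le => //; first exact: cont_onZ.
  by move=> t; apply: le_trans (key t); rewrite mulN1r -normrN ler_norm.
by apply: le_trans tot; rewrite -mW; apply: mean_le => // t; apply: le_trans (key t); rewrite ler_norm.
Qed.

End HarmonicExtension.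

(** * Cauchy and Poisson formulas, Harnack's inequality *)

Section CauchyFormula.
Context {R : realType}.
Local Notation C := (Cplx R).
Local Notation "x %:C" := (real_complex _ x) (format "x %:C") : ring_scope.
Local Notation Re := (@complex.Re R).
Local Notation cj := (@conjc R).
Implicit Types (z w a : R[i]) (q g : R[i] -> R[i]).

Lemma ccontM q g z : ccont q z -> ccont g z -> ccont (fun x => q x * g x) z.
Proof.
move=> hq hg e e0.
have Q0 : 0 < 1 + nrm (q z) by rewrite ltr_pwDl// nrm_ge0.
have G0 : 0 < 1 + nrm (g z) by rewrite ltr_pwDl// nrm_ge0.
have e1 : 0 < e / 2 / (1 + nrm (g z)) by rewrite !divr_gt0.
have e2 : 0 < Num.min 1 (e / 2 / (1 + nrm (q z))) by rewrite lt_min ltr01 !divr_gt0.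
have e1' : 0 < Num.min 1 (e / 2 / (2 + nrm (g z))).
  by rewrite lt_min ltr01 !divr_gt0// ltr_pwDl// nrm_ge0.
have [d1 d10 h1] := hq _ e1'; have [d2 d20 h2] := hg _ e2.
exists (Num.min d1 d2); first by rewrite lt_min d10.
move=> y; rewrite lt_min => /andP[/h1 + /h2]; rewrite !lt_min => /andP[_ k1] /andP[k2 k3].
have -> : q y * g y - q z * g z = (q y - q z) * g y + q z * (g y - g z) by ring.
apply: (le_lt_trans (nrmD _ _)); rewrite !nrmM [e]splitr; apply: ltr_leD.
  have gy : nrm (g y) < 2 + nrm (g z).
    by have := nrmB_ge (g y) (g z); move: k2; have := nrm_ge0 (g z); clear; lra.
  have G2 : 0 < 2 + nrm (g z) by rewrite ltr_pwDl// nrm_ge0.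
  rewrite ltr_pdivlMr// in k1; apply: le_lt_trans k1.
  by rewrite ler_wpM2l ?nrm_ge0// ltW.
rewrite ltr_pdivlMr// in k3; apply: le_trans (ltW k3).
by rewrite mulrC ler_wpM2l ?nrm_ge0// lerDr.
Qed.

(** Only some arbitrarily small circles are asked for, not a neighbourhood: this is exactly the
    negation of having large values on all small circles, as the barrier will need. *)
Definition bounded_near0 g := exists M : R, forall d : R, 0 < d ->
  exists2 s : R, 0 < s < d & forall z, nrm z = s -> nrm (g z) <= M.

Lemma cmean_near q (s0 e : R) : 0 < s0 -> (forall z, nrm z = s0 -> ccont q z) -> 0 < e ->
  exists2 d : R, 0 < d & forall s : R, 0 <= s -> `|s - s0| < d ->
    tccont (fun t => q (circ_pt 0 s t)) ->
    nrm (cmean (fun t => q (circ_pt 0 s t)) - cmean (fun t => q (circ_pt 0 s0 t))) <= e.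
Proof.
move=> s00 cq e0; have e2 : 0 < e / 2 by rewrite divr_gt0.
have cK : compact [set z : C | nrm z = s0].
  by have := @compact_circle R 0 s0; congr compact; apply/funext => z; rewrite /= subr0.
have [d d0 hd] := ccont_unif cK cq e2.
exists d => // s s_ge0 sd cs.
have cs0 : tccont (fun t => q (circ_pt 0 s0 t)).
  by apply: tccont_circ; [exact: ltW|move=> z; rewrite subr0; exact: cq].
rewrite -cmeanB// (_ : e = 2 * (e / 2)); last by field.
apply: cmean_nrm => [|t].
  by have := tccontD cs (tccontZ (-1) cs0); under [X in tccont X]eq_fun do rewrite mulN1r.
apply/ltW/hd; first by rewrite /= circ0_nrm// ltW.
have -> : circ_pt 0 s t - circ_pt 0 s0 t = circ_pt 0 (s - s0) t - 0.
  by rewrite !circ_ptE rmorphB /=; ring.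
by rewrite nrm_circ.
Qed.

(* The two sides of the circle through z are compared by continuity of the mean,
   so that no differentiability of the difference quotient at z is needed. *)
Lemma cauchy_formula g z (r : R) : 0 < nrm z < r ->
  (forall w, 0 < nrm w <= r -> exists d, cdf g d w) -> bounded_near0 g ->
  g z = cmean (fun t => g (circ_pt 0 r t) * (circ_pt 0 r t / (circ_pt 0 r t - z))).
Proof.
move=> /andP[z0 zr] hg [M hM].
have r0 : 0 < r by apply: lt_trans zr.
have [|dz hdz] := hg z; first by rewrite z0 ltW.
pose p w := if w == z then dz else (g w - g z) / (w - z).
(* The factor [w] stems from dw = i w dt on the circle. It also forces the means over small circles
   to 0, although [g] may be singular at 0. *)
pose q w := p w * w.
have qE w : w != z -> q w = (g w - g z) * (w / (w - z)).
  by move=> wz; rewrite /q /p (negbTE wz) mulrAC mulrA.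
have cp : ccont p z.
  move=> e e0; have e2 : 0 < e / 2 by rewrite divr_gt0.
  have [d d0 hd] := hdz _ e2; exists d => // y yz; rewrite /p eqxx.
  case: eqVneq => [_|yz0]; first by rewrite subrr nrm0.
  have := hd _ yz; rewrite addrCA subrr addr0.
  have nz : y - z != 0 by rewrite subr_eq0.
  have -> : g y - g z - dz * (y - z) = ((g y - g z) / (y - z) - dz) * (y - z) by field.
  rewrite nrmM ler_pM2r ?nrm_gt0// => h; apply: (le_lt_trans h).
  by rewrite ltr_pdivrMr// ltr_pMr// ltr1n.
have cqz : ccont q z by apply: ccontM => //; exact: cdf_ccont (cdf_id z).
have dq w : w != z -> 0 < nrm w <= r -> exists d, cdf q d w.
  move=> wz wr; have [d hd] := hg w wr.
  have nz : w - z != 0 by rewrite subr_eq0.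
  have [d' hd'] := cdf_kernel nz.
  exists ((d + 0) * (w / (w - z)) + (g w + - g z) * d').
  apply: (@cdf_ext _ (fun w => (g w - g z) * (w / (w - z))) _ _ w (nrm (w - z))); first by rewrite nrm_gt0.
    move=> y yw; rewrite qE//; apply: contraTneq yw => ->.
    by rewrite -leNgt nrmBC.
  exact: cdfM (cdfD hd (cdf_cst (- g z) w)) hd'.
have cq w : 0 < nrm w <= r -> ccont q w.
  move=> wr; have [->//|wz] := eqVneq w z; have [d hd] := dq w wz wr; exact: cdf_ccont hd.
pose m s := cmean (fun t => q (circ_pt 0 s t)).
have tq (s : R) : 0 < s <= r -> tccont (fun t => q (circ_pt 0 s t)).
  move=> /andP[s0 sr]; apply: tccont_circ; first exact: ltW.
  by move=> w; rewrite subr0 => ws; apply: cq; rewrite ws s0.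
have mL (s1 s2 : R) : 0 < s1 -> s1 <= s2 -> s2 < nrm z -> m s1 = m s2.
  move=> s10 s12 s2z; apply: cmean_annulus => // w; rewrite subr0 => /andP[w1 w2].
  apply: dq; first by apply: contraTneq s2z => <-; rewrite -leNgt.
  by rewrite (lt_le_trans s10 w1) (le_trans w2)// ltW// (lt_trans s2z).
have mR s1 s2 : nrm z < s1 -> s1 <= s2 -> s2 <= r -> m s1 = m s2.
  move=> s1z s12 s2r; have s10 := lt_trans z0 s1z.
  apply: cmean_annulus => // w; rewrite subr0 => /andP[w1 w2].
  apply: dq; first by apply: contraTneq s1z => <-; rewrite -leNgt.
  by rewrite (lt_le_trans s10 w1) (le_trans w2).
have near (e : R) : 0 < e -> exists2 d : R, 0 < d & forall s : R, 0 < s <= r -> `|s - nrm z| < d -> nrm (m s - m (nrm z)) <= e.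
  move=> e0; have [|d d0 hd] := @cmean_near q (nrm z) e z0 _ e0.
    by move=> w wz; apply: cq; rewrite wz z0 ltW.
  by exists d => // s sr sd; apply: hd => //; [case/andP: sr => /ltW|exact: tq].
have m1 (s : R) : 0 < s -> s < nrm z -> m s = m (nrm z).
  move=> s0 sz; apply: nrm_eps_eq => e e0; have [d d0 hd] := near e e0.
  pose s' := Num.max s (nrm z - d / 2).
  have ss' : s <= s' by rewrite le_max lexx.
  have s'z : s' < nrm z by rewrite gt_max sz gtrBl divr_gt0.
  rewrite (mL s s')//; apply: hd.
    by rewrite (lt_le_trans s0 ss') ltW// (lt_trans s'z).
  rewrite ltr0_norm ?subr_lt0// opprB ltrBlDr -ltrBlDl lt_max; apply/orP; right.
  by rewrite ltrD2l ltrN2 ltr_pdivrMr// ltr_pMr// ltr1n.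
have m2 : m r = m (nrm z).
  apply: nrm_eps_eq => e e0; have [d d0 hd] := near e e0.
  pose s' := Num.min r (nrm z + d / 2).
  have s'r : s' <= r by rewrite ge_min lexx.
  have s'z : nrm z < s' by rewrite lt_min zr ltrDl divr_gt0.
  rewrite -(mR s' r)//; apply: hd; first by rewrite s'r (lt_trans z0).
  rewrite gtr0_norm ?subr_gt0// ltrBlDr gt_min; apply/orP; right.
  by rewrite addrC ltrD2r ltr_pdivrMr// ltr_pMr// ltr1n.
have m0 : m (nrm z) = 0.
  apply: nrm_eps_eq => e e0; rewrite subr0.
  (* A factor 2 from [cmean_nrm], another from |w - z| >= |z| / 2 on the small circle, and 1 for
     positivity. *)
  pose K := 4 * (`|M| + nrm (g z)) + 1.
  have K0 : 0 < K by rewrite ltr_wpDl// mulr_ge0// addr_ge0// nrm_ge0.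
  have [|s /andP[s0 sd] hs] := hM (Num.min (nrm z / 2) (e * nrm z / K)).
    by rewrite lt_min !divr_gt0// mulr_gt0.
  move: sd; rewrite lt_min => /andP[sd1 sd2].
  have sz : s < nrm z by apply: (lt_trans sd1); rewrite ltr_pdivrMr// ltr_pMr// ltr1n.
  have sr : 0 < s <= r by rewrite s0 ltW// (lt_trans sz).
  rewrite -(m1 s)//.
  have bnd : forall t, nrm (q (circ_pt 0 s t)) <= (`|M| + nrm (g z)) * (s * (2 / nrm z)).
    move=> t; have ws : nrm (circ_pt 0 s t) = s by rewrite circ0_nrm// ltW.
    move: (circ_pt 0 s t : R[i]) ws => w ws.
    have wz : z - w != 0 by apply: sub_nz; rewrite ws.
    rewrite qE; last by rewrite -subr_eq0 -opprB oppr_eq0.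
    rewrite nrmM nrmM nrmV ws; apply: ler_pM => //; rewrite ?nrm_ge0//.
    - by rewrite mulr_ge0 ?invr_ge0 ?nrm_ge0// ltW.
    - apply: (le_trans (nrmD _ _)); rewrite nrmN lerD2r; apply: le_trans (hs _ ws) _; exact: ler_norm.
    - apply: ler_wpM2l; first exact: ltW.
      rewrite -[2]invrK -invfM lef_pV2 ?posrE ?mulr_gt0 ?invr_gt0//; last by rewrite nrmBC nrm_gt0.
      have := nrmB_ge z w; rewrite ws nrmBC [_^-1 * _]mulrC; move: sd1; clear; lra.
  apply: (le_trans (cmean_nrm (tq s sr) bnd)).
  rewrite (_ : 2 * _ = (K - 1) * s / nrm z); last by rewrite /K; field; rewrite gt_eqF.
  rewrite ler_pdivrMr//; apply: (@le_trans _ _ (K * s)); first by rewrite ler_wpM2r ?(ltW s0)// gerBl.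
  by rewrite mulrC -ler_pdivlMr// ltW.
have tg : tccont (fun t => g (circ_pt 0 r t)).
  apply: tccont_circ; first exact: ltW.
  move=> w; rewrite subr0 => wr; have [|d] := hg w; first by rewrite wr r0 lexx.
  exact: cdf_ccont.
have tk := tccont_kernel zr.
have tgk : tccont (fun t => g (circ_pt 0 r t) * (circ_pt 0 r t / (circ_pt 0 r t - z))).
  apply: (@tccont_circ _ (fun w => g w * (w / (w - z))) 0 r (ltW r0)) => w; rewrite subr0 => wr.
  apply: ccontM; first by have [|d] := hg w; [rewrite wr r0 lexx|exact: cdf_ccont].
  by have [|d] := @cdf_kernel _ z w; [apply: sub_nz; rewrite wr|exact: cdf_ccont].
have : m r = 0 by rewrite m2.
have -> : m r = cmean (fun t => g (circ_pt 0 r t) * (circ_pt 0 r t / (circ_pt 0 r t - z)) - g z * (circ_pt 0 r t / (circ_pt 0 r t - z))).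
  congr (cmean _); apply/funext => t.
  rewrite qE ?mulrBl// -subr_eq0; apply: sub_nz.
  by rewrite circ0_nrm// ltW.
rewrite cmeanB//; last exact: tccontZ.
by rewrite cmeanZ// cmean_kernel// mulr1 => /subr0_eq.
Qed.

Lemma hol_disc_bounded0 g (r : R) : 0 < r -> hol_disc g 0 r -> bounded_near0 g.
Proof.
move=> r0 hg; have [|d hd] := hg 0; first by rewrite subrr nrm0 ltW.
have [s s0 hs] := cdf_ccont hd ltr01.
exists (1 + nrm (g 0)) => e e0; exists (Num.min s e / 2).
  rewrite divr_gt0 ?lt_min ?s0//= ltr_pdivrMr// (@le_lt_trans _ _ e)// ?ge_min ?lexx ?orbT//.
  by rewrite ltr_pMr// ltr1n.
move=> z zs; have h : nrm (z - 0) < s.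
  rewrite subr0 zs ltr_pdivrMr//; apply: (@le_lt_trans _ _ s); first by rewrite ge_min lexx.
  by rewrite ltr_pMr// ltr1n.
have := hs _ h; have := nrmB_ge (g z) (g 0); clear; lra.
Qed.

(** To Cauchy's formula one adds the mean of g (conj(k) - 1), k being the Cauchy kernel. On the
    circle this factor is holomorphic in the disc and vanishes at 0, so nothing is added, while k +
    conj(k) - 1 is the Poisson kernel. *)
Lemma poisson_formula g z (r : R) : nrm z < r -> hol_disc g 0 r ->
  Re (g z) = mean (fun t => Re (g (circ_pt 0 r t)) * poisson z (circ_pt 0 r t)).
Proof.
move=> zr hg; have r0 : 0 < r by apply: le_lt_trans zr; exact: nrm_ge0.
have r00 : 0 <= r <= r by rewrite lexx ltW.
have [->|z0] := eqVneq z 0.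
  rewrite -(mean_value r0 hg); apply: eq_mean => t.
  rewrite /poisson subr0 divff /=; first by ring.
  by rewrite -nrm_gt0 circ0_nrm// ltW.
have zr' : 0 < nrm z < r by rewrite nrm_gt0 z0.
have gE : g z = _ := cauchy_formula zr' _ (hol_disc_bounded0 r0 hg).
rewrite gE; last by move=> w /andP[_ wr]; apply: hg; rewrite subr0.
pose h w := g w * ((r ^+ 2)%:C / ((r ^+ 2)%:C - cj z * w)) + -1 * g w.
have hh : hol_disc h 0 r.
  move=> w wr; have [d1 hd1] := hg w wr; have [d2 hd2] := hol_disc_refl zr (r ^+ 2)%:C wr.
  by eexists; exact: cdfD (cdfM hd1 hd2) (cdfZ (-1) hd1).
have h0 : h 0 = 0.
  rewrite /h mulr0 subr0 mulN1r divff ?mulr1 ?subrr//.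
  by rewrite -nrm_gt0 nrmr normr_gt0 expf_neq0// gt_eqF.
have := mean_value r0 hh; rewrite h0 => mh.
have tg := hol_disc_tccont hg r00; have th := hol_disc_tccont hh r00.
have tk := tccont_kernel zr.
have tgk : tccont (fun t => g (circ_pt 0 r t) * (circ_pt 0 r t / (circ_pt 0 r t - z))).
  apply: (@tccont_circ _ (fun w => g w * (w / (w - z))) 0 r (ltW r0)) => w; rewrite subr0 => wr.
  apply: ccontM; first by have [|d] := hg w; [rewrite subr0 wr lexx|exact: cdf_ccont].
  by have [|d] := @cdf_kernel _ z w; [apply: sub_nz; rewrite wr|exact: cdf_ccont].
rewrite /= -[LHS]addr0 -[X in _ + X]mh -meanD; [|exact: tgk.1|exact: th.1].
apply: eq_mean => t /=.
have wr : nrm (circ_pt 0 r t) = r by rewrite circ0_nrm// ltW.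
move: (circ_pt 0 r t : R[i]) wr => w wr.
rewrite /h /poisson.
have -> : (r ^+ 2)%:C / ((r ^+ 2)%:C - cj z * w) = cj (w / (w - z)).
  by rewrite (kernel_cj r0 zr wr) conjcK.
case: (g w) => a b; case: (w / (w - z)) => c d /=; ring.
Qed.

(** At distance x <= r / 2 from the centre the Poisson kernel is at most (r + x) / (r - x) <= 3. *)
Lemma harnack g a z (r : R) : 0 < r -> hol_disc g a r -> (forall w, nrm (w - a) = r -> 0 <= Re (g w)) ->
  nrm (z - a) <= r / 2 -> Re (g z) <= 3 * Re (g a).
Proof.
move=> r0 hg g0 za.
pose f w := g (a + w).
have hf : hol_disc f 0 r.
  move=> w; rewrite subr0 => wr; have [|d hd] := hg (a + w); first by rewrite addrC addKr.
  exists (d * (0 + 1)); apply: cdf_comp (cdfD (cdf_cst a w) (cdf_id w)) hd.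
have r00 : 0 <= r <= r by rewrite lexx ltW.
have hr : r / 2 < r by rewrite ltr_pdivrMr// ltr_pMr// ltr1n.
have zr := le_lt_trans za hr.
have -> : g z = f (z - a) by rewrite /f addrC subrK.
have -> : g a = f 0 by rewrite /f addr0.
rewrite (poisson_formula zr hf) -(mean_value r0 hf).
have tf := (hol_disc_tccont hf r00).1.
rewrite -meanZ//; apply: mean_le; [exact: cont_onM tf (tcont_poisson zr)|exact: cont_onZ|].
move=> t; have wr : nrm (circ_pt 0 r t) = r by rewrite circ0_nrm// ltW.
move: (circ_pt 0 r t : R[i]) wr => w wr.
rewrite mulrC ler_wpM2r//.
  by apply: g0; rewrite addrC addKr.
have wz : w - (z - a) != 0 by apply: sub_nz; rewrite wr.
have n0 : 0 < nrm (w - (z - a)) ^+ 2 by rewrite exprn_gt0// nrm_gt0.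
rewrite -(ler_pM2r n0) (poissonE zr wr).
have h1 := nrmB_ge w (z - a); rewrite wr in h1.
have h2 : (r - nrm (z - a)) ^+ 2 <= nrm (w - (z - a)) ^+ 2.
  by rewrite ler_sqr ?nnegrE ?nrm_ge0// subr_ge0 ltW.
apply: (@le_trans _ _ (3 * (r - nrm (z - a)) ^+ 2)); last by rewrite ler_pM2l.
have := nrm_ge0 (z - a); move: (nrm (z - a)) za r0; clear => x xr r0 x0.
rewrite -subr_ge0 (_ : _ - _ = 2 * ((r - x) * (r - 2 * x))); last by ring.
by rewrite mulr_ge0// mulr_ge0//; lra.
Qed.

End CauchyFormula.

(** * Stability of upper semicontinuity *)

Section UpperSemicontinuity.
Context {R : realType}.
Implicit Types (x y : \bar R).

Lemma lte_EFin_dense x (r : R) : (x < r%:E)%E -> exists2 c : R, (x < c%:E)%E & c < r.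
Proof.
case: x => [s| |] //; last by move=> _; exists (r - 1); rewrite ?ltNyr// gtrBl.
by rewrite lte_fin => sr; exists ((s + r) / 2); rewrite ?lte_fin midf_lt.
Qed.

Lemma lteD_split x y (c : R) : (x < +oo)%E -> (y < +oo)%E -> (x + y < c%:E)%E ->
  exists c1 c2 : R, [/\ (x < c1%:E)%E, (y < c2%:E)%E & c1 + c2 = c].
Proof.
case: x => [a| |] //; case: y => [b| |] // _ _.
- rewrite -EFinD lte_fin => h; exists (a + (c - a - b) / 2), (b + (c - a - b) / 2).
  have h2 : 0 < (c - a - b) / 2 by rewrite divr_gt0// -addrA -opprD subr_gt0.
  by rewrite !lte_fin !ltrDl; split=> //; field.
- by move=> _; exists (a + 1), (c - a - 1); rewrite lte_fin ltrDl ltNyr; split=> //; ring.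
- by move=> _; exists (c - b - 1), (b + 1); rewrite lte_fin ltrDl ltNyr; split=> //; ring.
- by move=> _; exists 0, c; rewrite !ltNyr add0r.
Qed.

Lemma adde_ltoo x y : (x < +oo)%E -> (y < +oo)%E -> (x + y < +oo)%E.
Proof. by case: x => [a| |]//; case: y => [b| |]// _ _; rewrite ltry. Qed.

Variables (T : topologicalType).
Implicit Types (U : set T) (u v : T -> \bar R) (h : T -> R).

Lemma usc_sub U U' u : U `<=` U' -> usc_on U' u -> usc_on U u.
Proof. by move=> UU usc z /UU; exact: usc. Qed.

Lemma usc_add U u v : (forall z, U z -> (u z < +oo)%E) -> (forall z, U z -> (v z < +oo)%E) ->
  usc_on U u -> usc_on U v -> usc_on U (fun z => (u z + v z)%E).
Proof.
move=> uoo voo uu uv z Uz c /(lteD_split (uoo z Uz) (voo z Uz))[c1 [c2 [h1 h2 <-]]].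
near=> y; rewrite EFinD; apply: lteD; near: y; [exact: uu|exact: uv].
Unshelve. all: by end_near. Qed.

Lemma usc_cont U h : (forall z, U z -> {for z, continuous h}) -> usc_on U (fun z => (h z)%:E).
Proof.
move=> ch z Uz c; rewrite lte_fin => hc.
have /cvgrPdist_lt/(_ (c - h z)) := ch z Uz; rewrite subr_gt0 => /(_ hc).
apply: filterS => y; rewrite lte_fin distrC ltr_norml => /andP[_].
by rewrite ltrBlDr subrK.
Qed.

Lemma usc_maxr U u v : usc_on U u -> usc_on U v -> usc_on U (fun z => Order.max (u z) (v z)).
Proof.
move=> uu uv z Uz c; rewrite gt_max => /andP[h1 h2].
by near=> y; rewrite gt_max; apply/andP; split; near: y; [exact: uu|exact: uv].
Unshelve. all: by end_near. Qed.

Lemma usc_scale U u (k : R) : 0 < k -> usc_on U u -> usc_on U (fun z => (k%:E * u z)%E).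
Proof.
move=> k0 uu z Uz c; rewrite muleC -lte_pdivlMr// => h.
have := uu z Uz _ h; apply: filterS => y.
by rewrite muleC -lte_pdivlMr.
Qed.

Lemma usc_comp (S : topologicalType) (phi : S -> T) U u : continuous phi -> usc_on U u ->
  usc_on (phi @^-1` U) (u \o phi).
Proof. by move=> cphi uu z Uz c hc; exact: (cphi z _ (uu _ Uz c hc)). Qed.

Lemma usc_ext U u v : open U -> (forall z, U z -> u z = v z) -> usc_on U u -> usc_on U v.
Proof.
move=> oU uv uu z Uz c; rewrite -uv// => /(uu z Uz) hu.
have : nbhs z U by apply: open_nbhs_nbhs.
by apply: filterS2 hu => y + Uy; rewrite uv.
Qed.

End UpperSemicontinuity.

(** * Domination by harmonic functions and the maximum principle *)

Section HarmonicMajorants.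
Context {R : realType}.
Local Notation C := (Cplx R).
Local Notation "x %:C" := (real_complex _ x) (format "x %:C") : ring_scope.
Local Notation Re := (@complex.Re R).
Local Notation cj := (@conjc R).
Implicit Types (z w a : R[i]) (g h : R[i] -> R[i]) (u v : C -> \bar R).

(** Stands in for the inequality of u(a) with the mean of u over one circle, without any integral of
    an extended-valued function. Centre and radius are kept apart so that the property can be asked
    on small circles only. *)
Definition HMat u a (r : R) := forall g, hol_disc g a r ->
  (forall z, nrm (z - a) = r -> (u z <= (Re (g z))%:E)%E) -> (u a <= (Re (g a))%:E)%E.

Definition HM (U : set C) u := forall a (r : R), 0 < r -> (forall z, nrm (z - a) <= r -> U z) -> HMat u a r.

Lemma Re_le_center g h a (r : R) : 0 < r -> hol_disc g a r -> hol_disc h a r ->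
  (forall z, nrm (z - a) = r -> Re (g z) <= Re (h z)) -> Re (g a) <= Re (h a).
Proof.
move=> r0 hg hh gh; rewrite -(mean_value r0 hg) -(mean_value r0 hh).
have r00 : 0 <= r <= r by rewrite lexx ltW.
apply: mean_le; [exact: (hol_disc_tccont hg r00).1|exact: (hol_disc_tccont hh r00).1|].
by move=> t; apply: gh; rewrite nrm_circ ger0_norm// ltW.
Qed.

Lemma hol_discD g h a (r : R) : hol_disc g a r -> hol_disc h a r -> hol_disc (fun z => g z + h z) a r.
Proof. by move=> hg hh z zr; have [d1 h1] := hg z zr; have [d2 h2] := hh z zr; exists (d1 + d2); exact: cdfD. Qed.

Lemma hol_discM g h a (r : R) : hol_disc g a r -> hol_disc h a r -> hol_disc (fun z => g z * h z) a r.
Proof. by move=> hg hh z zr; have [d1 h1] := hg z zr; have [d2 h2] := hh z zr; eexists; exact: cdfM h1 h2. Qed.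

Lemma hol_disc_cst c a (r : R) : hol_disc (fun=> c) a r.
Proof. by move=> z _; exists 0; exact: cdf_cst. Qed.

Lemma hol_disc_id a (r : R) : hol_disc id a r.
Proof. by move=> z _; exists 1; exact: cdf_id. Qed.

Lemma hol_discZ c g a (r : R) : hol_disc g a r -> hol_disc (fun z => c * g z) a r.
Proof. by move=> hg; apply: hol_discM => //; exact: hol_disc_cst. Qed.

Lemma hol_discN g a (r : R) : hol_disc g a r -> hol_disc (fun z => - g z) a r.
Proof.
move=> /(hol_discZ (-1)); congr hol_disc; apply/funext => z; exact: mulN1r.
Qed.

Lemma hol_disc_cexp g a (r : R) : hol_disc g a r -> hol_disc (fun z => cexp (g z)) a r.
Proof. by move=> hg z zr; have [d h] := hg z zr; eexists; exact: cdf_comp h (cdf_cexp _). Qed.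

Lemma hol_disc_sub g a b (r s : R) : (forall z, nrm (z - b) <= s -> nrm (z - a) <= r) ->
  hol_disc g a r -> hol_disc g b s.
Proof. by move=> h hg z /h; exact: hg. Qed.

(** Multiplying [h] by the conjugate of h(a) makes its value at the centre the real number |h(a)|^2,
    so real parts can be compared. *)
Lemma nrm_le_center h g a (r : R) : 0 < r -> hol_disc h a r -> hol_disc g a r ->
  (forall z, nrm (z - a) = r -> nrm (h z) <= Re (g z)) -> nrm (h a) <= Re (g a).
Proof.
move=> r0 hh hg le.
have [h0|h0] := eqVneq (h a) 0.
  have h1 := @Re_le_center (fun=> 0) g a r r0 (@hol_disc_cst 0 a r) hg.
  by rewrite h0 nrm0; apply: h1 => z zr; apply: le_trans (le z zr); exact: nrm_ge0.
have n0 : 0 < nrm (h a) by rewrite nrm_gt0.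
have := @Re_le_center (fun z => cj (h a) * h z) (fun z => (nrm (h a))%:C * g z) a r r0
  (hol_discZ _ hh) (hol_discZ _ hg).
rewrite cReZ mulrC cj_mul expr2 /= ler_pM2l//; apply=> z zr.
rewrite cReZ; apply: (le_trans (ler_norm _)); apply: (le_trans (Re_nrm _)).
by rewrite nrmM nrm_cj ler_pM2l// le.
Qed.

Lemma max_modulus h a (r M : R) : 0 < r -> hol_disc h a r ->
  (forall z, nrm (z - a) = r -> nrm (h z) <= M) -> nrm (h a) <= M.
Proof. by move=> r0 hh le; apply: (@nrm_le_center _ (fun=> M%:C) a r) => //; exact: hol_disc_cst. Qed.

Lemma cdf_for_cont (g : C -> C) (d z : C) : cdf g d z -> {for z, continuous (fun y : C => Re (g y))}.
Proof.
move=> /cdf_ccont hg P /nbhs_ballP[e /= e0 hP]; have [s s0 hs] := hg _ e0.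
apply/nbhsCP; exists s => // y /hs h; apply: hP; rewrite /ball /= distrC; apply: le_lt_trans h.
by rewrite -cReN -cReD; exact: Re_nrm.
Qed.

Lemma nrm_sub_cont (a z : C) : {for z, continuous (fun y : C => nrm (y - a))}.
Proof.
move=> P /nbhs_ballP[e /= e0 hP].
apply/nbhsCP; exists e => // y yz; apply: hP; rewrite /ball /= distrC; apply: le_lt_trans yz.
have h1 := nrm_tri z y a; have h2 := nrm_tri y z a; rewrite (nrmBC z y) in h1.
by rewrite ler_norml; apply/andP; split; move: h1 h2; clear; lra.
Qed.

Lemma nrm_sqD z w : nrm (z + w) ^+ 2 = nrm z ^+ 2 + nrm w ^+ 2 + 2 * Re (w * cj z).
Proof.
rewrite !nrm_sqr cReM; case: z => a b; case: w => c d /=; ring.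
Qed.

(* At a maximum of u - Re g + e |z - a|^2 the term e |z - a|^2, whose mean on small circles
   exceeds its value at the centre, contradicts the harmonic majorant property. *)
Lemma max_principle u g a (r : R) : 0 < r ->
  (forall z, nrm (z - a) <= r -> (u z < +oo)%E) -> usc_on [set z : C | nrm (z - a) <= r] u ->
  hol_disc g a r ->
  (forall z, nrm (z - a) < r -> forall d : R, 0 < d -> exists2 s : R, 0 < s < d & HMat u z s) ->
  (forall z, nrm (z - a) = r -> (u z <= (Re (g z))%:E)%E) ->
  forall z, nrm (z - a) <= r -> (u z <= (Re (g z))%:E)%E.
Proof.
move=> r0 uoo uusc hg hloc bd z1 z1r; rewrite leNgt; apply/negP => z1g.
have u1E : u z1 = (fine (u z1))%:E.
  by rewrite fineK// fin_real// uoo// andbT (lt_trans _ z1g)// ltNyr.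
pose c := fine (u z1) - Re (g z1).
have c0 : 0 < c by rewrite subr_gt0 -lte_fin -u1E.
(* The perturbation is then at most c / 2 on the disc, so a maximum of value at least [c] cannot lie
   on the bounding circle. *)
pose e := c / (2 * r ^+ 2).
have r2 : 0 < r ^+ 2 by rewrite exprn_gt0.
have e0 : 0 < e by rewrite divr_gt0// mulr_gt0.
have er : e * r ^+ 2 = c / 2 by rewrite /e; field; rewrite gt_eqF.
pose hh (z : C) : R := e * nrm (z - a) ^+ 2 - Re (g z).
pose K := [set z : C | nrm (z - a) <= r].
have hcont : usc_on K (fun z => (hh z)%:E).
  apply: usc_cont => z zr; have [d hd] := hg z zr.
  have c1 := @nrm_sub_cont a z; have c2 := cdf_for_cont hd.
  have c3 := continuousM (continuousM (@cst_continuous C R e z : {for z, continuous (cst e : C -> R)}) c1) c1.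
  have -> : hh = (cst e \* (fun y : C => nrm (y - a)) \* (fun y : C => nrm (y - a))) \- (fun y : C => Re (g y)).
    by apply/funext => y; rewrite /hh /= expr2 mulrA.
  exact: continuousB c3 c2.
pose v (z : C) := (u z + (hh z)%:E)%E.
have voo z : K z -> (v z < +oo)%E by move=> Kz; apply: adde_ltoo; [exact: uoo|exact: ltry].
have vusc : usc_on K v by apply: usc_add => // z _; exact: ltry.
have [|zs Kzs hmax] := @usc_max R _ K v (@compact_cdisc R a r) _ voo vusc.
  by exists a; rewrite /K /= subrr nrm0 ltW.
have v1 : (c%:E <= v z1)%E.
  by rewrite /v u1E lee_fin /hh /c; have := mulr_ge0 (ltW e0) (sqr_ge0 (nrm (z1 - a))); clear; lra.
have vs := le_trans v1 (hmax _ z1r).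
have usE : u zs = (fine (u zs))%:E.
  rewrite fineK// fin_real// uoo// andbT.
  by move: vs; rewrite /v; case: (u zs) => [t _|//|]; rewrite ?ltNyr// addNye leeNy_eq.
pose V := fine (u zs) + hh zs.
have vsE : v zs = V%:E by rewrite /v usE.
have cV : c <= V by rewrite -lee_fin -vsE.
have zsr : nrm (zs - a) < r.
  rewrite lt_neqAle Kzs andbT; apply/eqP => zsr.
  have := bd _ zsr; rewrite usE lee_fin => hle.
  by move: cV; rewrite /V /hh zsr er; move: hle c0; clear; lra.
have [|s /andP[s0 sr] hs] := hloc zs zsr (r - nrm (zs - a)); first by rewrite subr_gt0.
have inK z : nrm (z - zs) <= s -> nrm (z - a) <= r.
  by have := nrm_tri z zs a; move: sr; clear; lra.
(* On |z - zs| = s the function V - e |z - a|^2 is the real part of an affine function of [z], which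
   is what is added to [g]. At [zs] the resulting inequality reads V <= V - e s^2. *)
pose g1 z := g z + ((V - e * (nrm (zs - a) ^+ 2 + s ^+ 2))%:C - (2 * e)%:C * ((z - zs) * cj (zs - a))).
have hg1 : hol_disc g1 zs s.
  apply: hol_discD; first exact: hol_disc_sub hg.
  apply: hol_discD; first exact: hol_disc_cst.
  apply: hol_discN; apply: hol_discZ; apply: hol_discM; last exact: hol_disc_cst.
  by apply: hol_discD; [exact: hol_disc_id|exact: hol_disc_cst].
have := hs g1 hg1; rewrite /g1 subrr mul0r mulr0 subr0 usE => /(_ _) hle0.
suff /hle0 hle1 : forall z, nrm (z - zs) = s -> (u z <= (Re (g z + ((V - e * (nrm (zs - a) ^+ 2 + s ^+ 2))%:C - (2 * e)%:C * ((z - zs) * cj (zs - a)))))%:E)%E.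
  move: hle1; rewrite lee_fin cReD /= => hle.
  have : 0 < e * s ^+ 2 by rewrite mulr_gt0// exprn_gt0.
  by move: hle; rewrite /V /hh; clear; lra.
move=> z zs_s; have Kz : nrm (z - a) <= r by apply: inK; rewrite zs_s.
have := hmax z Kz; rewrite vsE /v.
have e1 : nrm (z - a) ^+ 2 = nrm (zs - a) ^+ 2 + s ^+ 2 + 2 * Re ((z - zs) * cj (zs - a)).
  have -> : z - a = (zs - a) + (z - zs) by ring.
  by rewrite nrm_sqD zs_s.
have := uoo z Kz; case: (u z) => [t| |] //; last by move=> _ _; rewrite leNye.
rewrite -EFinD !lee_fin => _ hle.
rewrite cReD cReD cReN cReZ /=; move: hle; rewrite /hh e1; clear.
set X := Re (_ * _); lra.
Qed.

End HarmonicMajorants.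

(** * Approximation from above by Lipschitz functions *)

Section SupConvolution.
Context {R : realType}.
Local Notation C := (Cplx R).
Implicit Types (z w : R[i]).

(** The cut-off at -n makes the sup-convolution real-valued. The value at +oo is a mere default, as
    [u] stays below +oo wherever this is applied. *)
Definition trunc (x : \bar R) (n : nat) : R := if x is r%:E then Num.max r (- n%:R) else - n%:R.

Lemma trunc_ge x n : (x < +oo)%E -> (x <= (trunc x n)%:E)%E.
Proof. by case: x => [r| |] //= _; rewrite ?leNye// lee_fin le_max lexx. Qed.

Lemma truncS x n : trunc x n.+1 <= trunc x n.
Proof.
have h : - n.+1%:R <= - n%:R :> R by rewrite lerN2 ler_nat.
by case: x => [r| |] //=; rewrite ge_max !le_max lexx h orbT.
Qed.

Lemma trunc_le x n (c : R) : (x < c%:E)%E -> - n%:R <= c -> trunc x n <= c.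
Proof. by case: x => [r| |] //=; rewrite lte_fin => /ltW rc nc; rewrite ge_max rc. Qed.

(** The functions are sup over y in K of max(u y, -n) - n |z - y|. Raising [n] lowers the cut-off
    and raises the penalty, hence the decrease; upper semicontinuity gives the limit. *)
Lemma sup_convolution (K : set C) (u : C -> \bar R) : compact K -> K !=set0 ->
  (forall z, K z -> (u z < +oo)%E) -> usc_on K u ->
  exists phi : nat -> R[i] -> R, [/\ forall n, lipschitz n%:R (phi n),
    forall n z, K z -> (u z <= (phi n z)%:E)%E, forall n z, phi n.+1 z <= phi n z &
    forall z (c : R), K z -> (u z < c%:E)%E -> exists n, phi n z < c].
Proof.
move=> cK K0 uoo uusc.
have [M0 hM0] := usc_lt_bounded cK uoo uusc.
pose M := Num.max M0 0.
have hM z n : K z -> trunc (u z) n <= M.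
  move=> Kz; apply: trunc_le.
    by apply: lt_le_trans (hM0 z Kz) _; rewrite lee_fin le_max lexx.
  by apply: (@le_trans _ _ 0); rewrite ?oppr_le0// le_max lexx orbT.
pose E n z := [set trunc (u y) n - n%:R * nrm (z - y) | y in K].
have supE n z : has_sup (E n z).
  split; first by case: K0 => y Ky; exists (trunc (u y) n - n%:R * nrm (z - y)), y.
  exists M => _ [y Ky <-]; apply: le_trans (hM y n Ky).
  by rewrite gerBl mulr_ge0// nrm_ge0.
pose phi n z := sup (E n z).
have phi_ge n z y : K y -> trunc (u y) n - n%:R * nrm (z - y) <= phi n z.
  by move=> Ky; apply: sup_upper_bound => //; exists y.
have phi_le n z c : (forall y, K y -> trunc (u y) n - n%:R * nrm (z - y) <= c) -> phi n z <= c.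
  move=> h; apply: sup_le_ub => [|_ [y Ky <-]]; last exact: h.
  by case: (supE n z).
exists phi; split.
- have half n z w : phi n z - phi n w <= n%:R * nrm (z - w).
    rewrite lerBlDr; apply: phi_le => y Ky; have := phi_ge n w y Ky.
    have : n%:R * nrm (w - y) <= n%:R * (nrm (z - w) + nrm (z - y)).
      by rewrite ler_wpM2l// (nrmBC z w); exact: nrm_tri.
    by rewrite mulrDr; clear; lra.
  move=> n z w; rewrite ler_norml half andbT lerNl opprB nrmBC; exact: half.
- move=> n z Kz; apply: le_trans (trunc_ge n (uoo z Kz)) _; rewrite lee_fin.
  by have := phi_ge n z z Kz; rewrite subrr nrm0 mulr0 subr0.
- move=> n z; apply: phi_le => y Ky; apply: le_trans (phi_ge n z y Ky).
  apply: lerB; first exact: truncS.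
  by rewrite ler_wpM2r ?nrm_ge0// ler_nat.
- move=> z c Kz uc.
  have [c' uc' c'c] := lte_EFin_dense uc.
  have /nbhsCP[d d0 hd] := uusc z Kz _ uc'.
  (* The first bound puts the cut-off -n below [c']; the second makes the penalty n d at points
     farther than [d] bring even the upper bound [M] below [c']. *)
  pose n := (maxn (Num.bound `|c'|) (Num.bound (`|M - c'| / d))).
  have n1 : - n%:R <= c'.
    rewrite lerNl; apply: le_trans (ler_norm _) _; rewrite normrN.
    apply: le_trans (ltW (archi_boundP (normr_ge0 _))) _.
    by rewrite ler_nat leq_maxl.
  have n2 : M - n%:R * d <= c'.
    rewrite lerBlDr -lerBlDl; apply: le_trans (ler_norm _) _.
    rewrite -ler_pdivrMr//; apply: le_trans (ltW (archi_boundP _)) _; first by rewrite divr_ge0// ltW.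
    by rewrite ler_nat leq_maxr.
  exists n; apply: le_lt_trans c'c; apply: phi_le => y Ky.
  have [yz|yz] := ltP (nrm (y - z)) d.
    have h1 : trunc (u y) n <= c' by apply: trunc_le => //; exact: hd.
    by apply: le_trans h1; rewrite gerBl mulr_ge0// nrm_ge0.
  have h1 := hM y n Ky.
  have h2 : n%:R * d <= n%:R * nrm (z - y) by rewrite ler_wpM2l// nrmBC.
  by move: n2 h1 h2; clear; lra.
Qed.

End SupConvolution.

(** * Closure properties of the working notion of subharmonicity *)

Section Subharmonic.
Context {R : realType}.
Local Notation C := (Cplx R).
Local Notation "x %:C" := (real_complex _ x) (format "x %:C") : ring_scope.
Local Notation Re := (@complex.Re R).
Implicit Types (z w a : R[i]) (g h : R[i] -> R[i]) (u v : C -> \bar R) (U V : set C).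

Definition SH U u := [/\ open U, forall z, U z -> (u z < +oo)%E, usc_on U u & HM U u].

Lemma circle_pt a (r : R) : 0 <= r -> exists z, nrm (z - a) = r.
Proof. by move=> r0; exists (circ_pt a r 0); rewrite nrm_circ ger0_norm. Qed.

Lemma HMat_ext u v a (r : R) : 0 < r -> (forall z, nrm (z - a) <= r -> u z = v z) -> HMat u a r -> HMat v a r.
Proof.
move=> r0 uv hu g hg hv; rewrite -uv ?subrr ?nrm0 ?(ltW r0)//.
by apply: hu => // z zr; rewrite uv ?zr//; exact: hv.
Qed.

(** Serves functions obtained by raising [u] on a part of the plane, at the centres where nothing
    was raised. *)
Lemma HMat_incr u v a (r : R) : u a = v a -> (forall z, nrm (z - a) = r -> (u z <= v z)%E) ->
  HMat u a r -> HMat v a r.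
Proof.
by move=> ua uv hu g hg hv; rewrite -ua; apply: hu => // z zr; apply: le_trans (uv z zr) (hv z zr).
Qed.

Lemma HMat_maxr u v a (r : R) : HMat u a r -> HMat v a r -> HMat (fun z => Order.max (u z) (v z)) a r.
Proof.
move=> hu hv g hg hb; rewrite ge_max; apply/andP; split.
  by apply: hu => // z /hb; rewrite ge_max => /andP[].
by apply: hv => // z /hb; rewrite ge_max => /andP[].
Qed.

Lemma HMat_cst (c : \bar R) a (r : R) : 0 < r -> HMat (fun=> c) a r.
Proof.
move=> r0 g hg hb; case: c hb => [c| |] hb; last by rewrite leNye.
  rewrite lee_fin; have hc := @Re_le_center R (fun=> (c%:C)) g a r r0 (@hol_disc_cst _ _ _ _) hg.
  by apply: hc => z /hb; rewrite lee_fin.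
by have [z /hb] := circle_pt a (ltW r0).
Qed.

Lemma HMat_scale u (k : R) a (r : R) : 0 < k -> HMat u a r -> HMat (fun z => (k%:E * u z)%E) a r.
Proof.
move=> k0 hu g hg hb; rewrite muleC -lee_pdivlMr//.
have := hu (fun z => (k^-1)%:C * g z) (hol_discZ _ hg); rewrite cReZ mulrC; apply=> z /hb.
by rewrite cReZ mulrC muleC -lee_pdivlMr.
Qed.

Definition eln (x : R) : \bar R := if x <= 0 then -oo%E else (ln x)%:E.

Lemma eln_le x (c : R) : 0 <= x -> (eln x <= c%:E)%E = (x <= expR c).
Proof.
rewrite /eln le_eqVlt => /predU1P[<-|x0]; first by rewrite lexx leNye expR_ge0.
by rewrite (lt_geF x0) lee_fin -ler_expR lnK.
Qed.

Lemma eln_lt x (c : R) : 0 <= x -> (eln x < c%:E)%E = (x < expR c).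
Proof.
rewrite /eln le_eqVlt => /predU1P[<-|x0]; first by rewrite lexx ltNyr expR_gt0.
by rewrite (lt_geF x0) lte_fin -ltr_expR lnK.
Qed.

Lemma eln_ltoo x : (eln x < +oo)%E. Proof. by rewrite /eln; case: ifP => // _; exact: ltry. Qed.

(** A harmonic majorant Re g of log |h| on the circle means |h exp(-g)| <= 1 there, and the maximum
    modulus principle passes this to the centre. *)
Lemma HMat_eln h a (r : R) : 0 < r -> hol_disc h a r -> HMat (fun z => eln (nrm (h z))) a r.
Proof.
move=> r0 hh g hg hb; rewrite eln_le ?nrm_ge0//.
have hk := hol_discM hh (hol_disc_cexp (hol_discN hg)).
have hm : forall z, nrm (z - a) = r -> nrm (h z * cexp (- g z)) <= 1.
  move=> z /hb; rewrite eln_le ?nrm_ge0// => hz.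
  by rewrite nrmM nrm_cexp cReN expRN ler_pdivrMr ?expR_gt0// mul1r.
have := max_modulus r0 hk hm.
by rewrite nrmM nrm_cexp cReN expRN ler_pdivrMr ?expR_gt0// mul1r.
Qed.

Lemma HMat_nrm h a (r : R) : 0 < r -> hol_disc h a r -> HMat (fun z => (nrm (h z))%:E) a r.
Proof.
by move=> r0 hh g hg hb; rewrite lee_fin; apply: (nrm_le_center r0 hh hg) => z /hb; rewrite lee_fin.
Qed.

Lemma HMat_sup (I : Type) (us : I -> C -> \bar R) u a (r : R) :
  (forall i z, (us i z <= u z)%E) -> (forall c : \bar R, (forall i, (us i a <= c)%E) -> (u a <= c)%E) ->
  (forall i, HMat (us i) a r) -> HMat u a r.
Proof.
move=> h1 h2 hu g hg hb; apply: h2 => i; apply: hu => // z zr.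
exact: le_trans (h1 i z) (hb z zr).
Qed.

Lemma usc_subRe (K : set C) u g : (forall z, K z -> (u z < +oo)%E) -> usc_on K u ->
  (forall z, K z -> exists d, cdf g d z) -> usc_on K (fun z => (u z + (- Re (g z))%:E)%E).
Proof.
move=> uoo uusc hg; apply: usc_add => // [z _|]; first exact: ltry.
apply: usc_cont => z /hg[d hd].
exact: (@continuousN _ _ _ (fun y : C => Re (g y)) z (cdf_for_cont hd)).
Qed.

Lemma lte_subRe (x : \bar R) (p c : R) : ((x + (- p)%:E)%E < c%:E)%E = (x < (p + c)%:E)%E.
Proof. by case: x => [r| |]; rewrite -?EFinD ?lte_fin ?addNye ?ltNyr// ltrBlDl. Qed.

(* Dini's theorem makes the convergence uniform on the circle, up to a small constant. *)
Lemma HMat_lim (un : nat -> C -> \bar R) u a (r : R) :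
  0 < r -> (forall n z, nrm (z - a) = r -> (un n z < +oo)%E) ->
  (forall n, usc_on [set z : C | nrm (z - a) = r] (un n)) ->
  (forall n z, nrm (z - a) = r -> (un n.+1 z <= un n z)%E) ->
  (forall n, (u a <= un n a)%E) ->
  (forall z (c : R), nrm (z - a) = r -> (u z < c%:E)%E -> exists n, (un n z < c%:E)%E) ->
  (forall n, HMat (un n) a r) -> HMat u a r.
Proof.
move=> r0 unoo unusc undec ua ulim hun g hg hb; apply/lee_addgt0Pr => e e0.
have decr m n z : nrm (z - a) = r -> (m <= n)%N -> (un n z <= un m z)%E.
  move=> zr; elim: n => [|n IH]; first by rewrite leqn0 => /eqP ->.
  rewrite leq_eqVlt => /predU1P[->//|]; rewrite ltnS => /IH; apply: le_trans.
  exact: undec.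
have hgc z : nrm (z - a) = r -> exists d, cdf g d z by move=> zr; apply: hg; rewrite zr.
have [|z zr|n hn] := @compact_unif_nat _ [set z : C | nrm (z - a) = r]
    (fun n z => nrm (z - a) = r -> (un n z < (Re (g z) + e)%:E)%E) (@compact_circle R a r).
- by move=> m n z mn h zr; apply: le_lt_trans (decr _ _ _ zr mn) (h zr).
- have [|n hn] := ulim z (Re (g z) + e) zr.
    by apply: le_lt_trans (hb z zr) _; rewrite lte_fin ltrDl.
  exists n; have := @usc_subRe [set z : C | nrm (z - a) = r] (un n) g (unoo n) (unusc n) hgc z zr e.
  by rewrite lte_subRe => /(_ hn); apply: filterS => y; rewrite lte_subRe.
have := hun n (fun z => g z + e%:C) (hol_discD hg (@hol_disc_cst _ _ _ _)).
rewrite cReD /= -EFinD => h; apply: le_trans (ua n) _; apply: h => z zr.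
by rewrite cReD /= ltW// hn.
Qed.

(* u is approximated from above by Lipschitz functions, hence by harmonic ones,
   which splits a harmonic majorant of u + v into majorants of u and of v. *)
Lemma HMat_add u v a (r : R) : 0 < r ->
  (forall z, nrm (z - a) = r -> (u z < +oo)%E) -> (forall z, nrm (z - a) = r -> (v z < +oo)%E) ->
  usc_on [set z : C | nrm (z - a) = r] u -> usc_on [set z : C | nrm (z - a) = r] v ->
  HMat u a r -> HMat v a r -> HMat (fun z => (u z + v z)%E) a r.
Proof.
move=> r0 uoo voo uusc vusc hu hv g hg hb; apply/lee_addgt0Pr => e e0.
pose K := [set z : C | nrm (z - a) = r].
have cK : compact K := @compact_circle R a r.
have [|phi [lip phi_ge phi_dec phi_lim]] := sup_convolution cK _ uoo uusc.
  exact: circle_pt (ltW r0).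
have e3 : 0 < e / 3 by rewrite divr_gt0.
have phi_decr m n z : (m <= n)%N -> phi n z <= phi m z.
  elim: n => [|n IH]; first by rewrite leqn0 => /eqP ->.
  rewrite leq_eqVlt => /predU1P[->//|]; rewrite ltnS => /IH; apply: le_trans.
  exact: phi_dec.
have hgc z : K z -> exists d, cdf g d z by move=> zr; apply: hg; rewrite zr.
have phi_cont n : usc_on K (fun z => (phi n z)%:E).
  apply: usc_cont => z _ P /nbhs_ballP[d /= d0 hP]; apply/nbhsCP.
  exists (d / (1 + n%:R)); first by rewrite divr_gt0// ltr_pwDl.
  move=> y yz; apply: hP; rewrite /ball /= distrC; apply: le_lt_trans (lip n _ _) _.
  apply: (@le_lt_trans _ _ ((1 + n%:R) * nrm (y - z))); first by rewrite ler_wpM2r ?nrm_ge0// lerDr.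
  by rewrite mulrC -ltr_pdivlMr// ltr_pwDl.
have [|z Kz|n hn] := @compact_unif_nat _ K
    (fun n z => K z -> ((phi n z)%:E + v z < (Re (g z) + e / 3)%:E)%E) cK.
- move=> m n z mn h Kz; apply: le_lt_trans (h Kz); apply: leeD2r.
  by rewrite lee_fin phi_decr.
- have : (u z + v z < (Re (g z) + e / 3)%:E)%E.
    by apply: le_lt_trans (hb z Kz) _; rewrite lte_fin ltrDl.
  move=> /(lteD_split (uoo z Kz) (voo z Kz))[c1 [c2 [h1 h2 h12]]].
  have [n hn] := phi_lim z c1 Kz h1.
  exists n.
  have h3 : (((phi n z)%:E + v z) + (- Re (g z))%:E < (e / 3)%:E)%E.
    by rewrite lte_subRe -h12 EFinD; apply: lteD; rewrite // lte_fin.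
  have := @usc_subRe K (fun z => (phi n z)%:E + v z)%E g _ _ hgc z Kz (e / 3) h3.
  have h4 : forall z, K z -> ((phi n z)%:E + v z < +oo)%E by move=> y Ky; apply: adde_ltoo; [exact: ltry|exact: voo].
  have h5 : usc_on K (fun z => (phi n z)%:E + v z)%E.
    by apply: usc_add => // y _; exact: ltry.
  by move=> /(_ h4 h5); apply: filterS => y; rewrite lte_subRe.
(* On the circle phi n + v < Re g + e/3 and Re g1 is within e/3 of phi n. So u is majorised by Re g1
   + e/3 and v by Re (g - g1) + 2e/3. *)
have [g1 hg1 g1phi] := @harmonic_approx R (phi n) n%:R a r (e / 3) (ler0n R n) (lip n) r0 e3.
have ua : (u a <= (Re (g1 a) + e / 3)%:E)%E.
  have := hu (fun z => g1 z + (e / 3)%:C) (hol_discD hg1 (@hol_disc_cst _ _ _ _)).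
  rewrite cReD /=; apply=> z zr; apply: le_trans (phi_ge n z zr) _.
  by rewrite cReD /= lee_fin; have := g1phi z zr; rewrite ler_norml => /andP[+ _]; clear; lra.
have va : (v a <= (Re (g a) - Re (g1 a) + 2 * (e / 3))%:E)%E.
  have := hv (fun z => g z + - g1 z + (2 * (e / 3))%:C) (hol_discD (hol_discD hg (hol_discN hg1)) (@hol_disc_cst _ _ _ _)).
  rewrite !cReD cReN /=; apply=> z zr; rewrite !cReD cReN /=.
  have := hn z zr zr; have := g1phi z zr; rewrite ler_norml => /andP[_ +].
  case: (v z) (voo z zr) => [t _|//|_ _ _]; last by rewrite leNye.
  by rewrite -EFinD lte_fin lee_fin; clear; lra.
apply: le_trans (leeD ua va) _; rewrite -!EFinD lee_fin; have : e = 3 * (e / 3) by field.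
by clear; lra.
Qed.

(** The maximum principle only tests small circles at each point, and its conclusion covers every
    disc. Hence subharmonicity is local and functions can be glued. *)
Lemma SH_local U u : open U -> (forall z, U z -> (u z < +oo)%E) -> usc_on U u ->
  (forall z, U z -> forall d : R, 0 < d -> exists2 s : R, 0 < s < d & HMat u z s) -> SH U u.
Proof.
move=> oU uoo uusc hloc; split=> // a r r0 aU g hg hb.
have := @max_principle R u g a r r0 (fun z zr => uoo z (aU z zr)) _ hg _ hb a.
rewrite subrr nrm0 (ltW r0); apply => //.
  by apply: usc_sub uusc => z /aU.
by move=> z /ltW /aU; exact: hloc.
Qed.

Lemma SH_max_principle U u g a (r : R) : SH U u -> 0 < r -> (forall z, nrm (z - a) <= r -> U z) ->
  hol_disc g a r -> (forall z, nrm (z - a) = r -> (u z <= (Re (g z))%:E)%E) ->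
  forall z, nrm (z - a) <= r -> (u z <= (Re (g z))%:E)%E.
Proof.
move=> [oU uoo uusc hu] r0 aU hg hb; apply: max_principle => //.
- by move=> z /aU; exact: uoo.
- by apply: usc_sub uusc => z /aU.
move=> z zr d d0; exists (Num.min d (r - nrm (z - a)) / 2).
  rewrite divr_gt0 ?lt_min ?d0 ?subr_gt0//= ltr_pdivrMr//.
  apply: (@le_lt_trans _ _ d); first by rewrite ge_min lexx.
  by rewrite ltr_pMr// ltr1n.
apply: hu; first by rewrite divr_gt0 ?lt_min ?d0 ?subr_gt0.
move=> w wz; apply: aU; have := nrm_tri w z a.
have : Num.min d (r - nrm (z - a)) <= r - nrm (z - a) by rewrite ge_min lexx orbT.
have : 0 < Num.min d (r - nrm (z - a)) by rewrite lt_min d0 subr_gt0.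
by move: wz; move: (Num.min _ _) => m; clear; lra.
Qed.

Lemma SH_glue U u : open U -> (forall z, U z -> exists V v, [/\ V z, SH V v & forall y, V y -> u y = v y]) -> SH U u.
Proof.
move=> oU h; apply: SH_local => //.
- by move=> z /h[V [v [Vz [_ voo _ _] uv]]]; rewrite uv// voo.
- move=> z /h[V [v [Vz [oV voo vusc _] uv]]].
  by apply: (@usc_ext R _ V v u) => // y Vy; rewrite uv.
move=> z /h[V [v [Vz [oV voo vusc hv] uv]]] d d0.
have [e e0 he] := (openCP V).1 oV z Vz.
have m0 : 0 < Num.min d e by rewrite lt_min d0.
have inV w : nrm (w - z) <= Num.min d e / 2 -> V w.
  move=> wz; apply: he; apply: le_lt_trans wz _.
  rewrite ltr_pdivrMr//; apply: (@le_lt_trans _ _ e); first by rewrite ge_min lexx orbT.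
  by rewrite ltr_pMr// ltr1n.
exists (Num.min d e / 2).
  rewrite divr_gt0//= ltr_pdivrMr//; apply: (@le_lt_trans _ _ d); first by rewrite ge_min lexx.
  by rewrite ltr_pMr// ltr1n.
apply: (@HMat_ext v); rewrite ?divr_gt0//; first by move=> w /inV; move/uv.
by apply: hv; rewrite ?divr_gt0.
Qed.

Lemma SH_sub U V u : open V -> V `<=` U -> SH U u -> SH V u.
Proof.
move=> oV VU [oU uoo uusc hu]; split=> //; first by move=> z /VU; exact: uoo.
  exact: usc_sub uusc.
by move=> a r r0 aV; apply: hu => // z /aV /VU.
Qed.

Lemma SH_ext U u v : (forall z, U z -> u z = v z) -> SH U u -> SH U v.
Proof.
move=> uv su; have [oU _ _ _] := su; apply: SH_glue => // z Uz.
by exists U, u; split=> // y Uy; rewrite uv.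
Qed.

Lemma SH_maxr U u v : SH U u -> SH U v -> SH U (fun z => Order.max (u z) (v z)).
Proof.
move=> [oU uoo uusc hu] [_ voo vusc hv]; split=> //.
- by move=> z Uz; rewrite gt_max uoo// voo.
- exact: usc_maxr.
- by move=> a r r0 aU; apply: HMat_maxr; [exact: hu|exact: hv].
Qed.

Lemma SH_add U u v : SH U u -> SH U v -> SH U (fun z => u z + v z)%E.
Proof.
move=> [oU uoo uusc hu] [_ voo vusc hv]; split=> //.
- by move=> z Uz; apply: adde_ltoo; [exact: uoo|exact: voo].
- exact: usc_add.
- move=> a r r0 aU.
  have cU : [set z : C | nrm (z - a) = r] `<=` U by move=> z /= zr; apply: aU; rewrite zr.
  apply: HMat_add => //; try by move=> z /cU; [exact: uoo].
  + by move=> z /cU; exact: voo.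
  + exact: usc_sub uusc.
  + exact: usc_sub vusc.
  + exact: hu.
  + exact: hv.
Qed.

Lemma SH_cst U (c : \bar R) : open U -> (c < +oo)%E -> SH U (fun=> c).
Proof.
move=> oU coo; split=> //; first by move=> z Uz d cd; near=> y.
by move=> a r r0 _; exact: HMat_cst.
Unshelve. all: by end_near. Qed.

Lemma SH_scale U u (k : R) : 0 < k -> SH U u -> SH U (fun z => k%:E * u z)%E.
Proof.
move=> k0 [oU uoo uusc hu]; split=> //.
- move=> z /uoo; case: (u z) => [t _|//|_]; first exact: ltry.
  by rewrite gt0_muleNy ?lte_fin.
- exact: usc_scale.
- by move=> a r r0 aU; apply: HMat_scale => //; exact: hu.
Qed.

Lemma usc_eln (T : topologicalType) (U : set T) (f : T -> R) : (forall x, 0 <= f x) ->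
  (forall x, U x -> {for x, continuous f}) -> usc_on U (fun x => eln (f x)).
Proof.
move=> f0 cf z Uz c; rewrite eln_lt// => hc.
have := usc_cont cf Uz (c := expR c); rewrite lte_fin => /(_ hc).
by apply: filterS => y; rewrite lte_fin eln_lt.
Qed.

Lemma cdf_nrm_cont (h : C -> C) (d z : C) : cdf h d z -> {for z, continuous (fun y : C => nrm (h y))}.
Proof.
move=> /cdf_ccont hh P /nbhs_ballP[e /= e0 hP]; have [s s0 hs] := hh _ e0.
apply/nbhsCP; exists s => // y /hs hy; apply: hP; rewrite /ball /= distrC; apply: le_lt_trans hy.
have h1 := nrmB_ge (h y) (h z); have h2 := nrmB_ge (h z) (h y); rewrite nrmBC in h2.
by rewrite ler_norml; apply/andP; split; move: h1 h2; clear; lra.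
Qed.

Lemma SH_eln U h : open U -> (forall z, U z -> exists d, cdf h d z) -> SH U (fun z => eln (nrm (h z))).
Proof.
move=> oU hh; split=> //.
- by move=> z _; exact: eln_ltoo.
- by apply: usc_eln => [z|z /hh[d]]; [exact: nrm_ge0|exact: cdf_nrm_cont].
- by move=> a r r0 aU; apply: HMat_eln => // z /aU /hh.
Qed.

Lemma SH_nrm U h : open U -> (forall z, U z -> exists d, cdf h d z) -> SH U (fun z => (nrm (h z))%:E).
Proof.
move=> oU hh; split=> //.
- by move=> z _; exact: ltry.
- by apply: usc_cont => z /hh[d]; exact: cdf_nrm_cont.
- by move=> a r r0 aU; apply: HMat_nrm => // z /aU /hh.
Qed.

Lemma SH_lim U (un : nat -> C -> \bar R) u : open U -> (forall n, SH U (un n)) ->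
  (forall n z, U z -> (un n.+1 z <= un n z)%E) -> (forall n z, U z -> (u z <= un n z)%E) ->
  (forall z (c : R), U z -> (u z < c%:E)%E -> exists n, (un n z < c%:E)%E) -> SH U u.
Proof.
move=> oU hun dec ule ulim; split=> //.
- by move=> z Uz; apply: le_lt_trans (ule 0%N z Uz) _; have [_ + _ _] := hun 0%N; exact.
- move=> z Uz c /(ulim z c Uz)[n hn]; have [_ _ + _] := hun n => /(_ z Uz c hn).
  have : nbhs z U by apply: open_nbhs_nbhs.
  by apply: filterS2 => y Uy; apply: le_lt_trans; exact: ule.
- move=> a r r0 aU.
  have cU : [set z : C | nrm (z - a) = r] `<=` U by move=> z /= zr; apply: aU; rewrite zr.
  apply: (@HMat_lim un) => //.
  + by move=> n z /cU; have [_ + _ _] := hun n; exact.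
  + by move=> n; have [_ _ + _] := hun n; exact: usc_sub.
  + by move=> n z /cU; exact: dec.
  + by move=> n; apply: ule; apply: aU; rewrite subrr nrm0 ltW.
  + by move=> z c /cU; exact: ulim.
  + by move=> n; have [_ _ _] := hun n; exact.
Qed.

(** For b <> 0 the majorants are transported by z -> (z - a) / b; for b = 0 the function is
    constant. This handles functions of the first coordinate on complex lines. *)
Lemma HM_affine U u a b : HM U u -> HM [set l | U (a + l * b)] (fun l => u (a + l * b)).
Proof.
move=> hu c r r0 cU; have [->|b0] := eqVneq b 0.
  apply: (@HMat_ext (fun=> u a)) => //; first by move=> z _; rewrite mulr0 addr0.
  exact: HMat_cst.
have nb0 : 0 < nrm b by rewrite nrm_gt0.
move=> g hg hb.
have aff z : a + (z - a) / b * b = z by rewrite divfK// addrC subrK.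
have nrmaff z : nrm ((z - a) / b - c) = nrm (z - (a + c * b)) / nrm b.
  by rewrite -nrmV -nrmM; congr nrm; field.
have := hu (a + c * b) (r * nrm b) _ _ (fun z => g ((z - a) / b)).
rewrite (_ : (a + c * b - a) / b = c); last by field.
apply.
- by rewrite mulr_gt0.
- move=> z zr; have := cU ((z - a) / b); rewrite /= aff nrmaff; apply.
  by rewrite ler_pdivrMr.
- move=> z zr; have [|d hd] := hg ((z - a) / b).
    by rewrite nrmaff ler_pdivrMr.
  have h1 := cdfZ b^-1 (cdfD (cdf_id z) (cdf_cst (- a) z)).
  eexists; apply: (@cdf_ext _ (fun z => g (b^-1 * (z + - a))) _ _ z 1) => //.
    by move=> y _; rewrite mulrC.
  by apply: cdf_comp h1 _; rewrite mulrC; exact: hd.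
- move=> z zr; have := hb ((z - a) / b); rewrite aff; apply.
  by rewrite nrmaff zr mulfK// gt_eqF.
Qed.

End Subharmonic.

(** * Equivalence with the sub-mean value property *)

Section SubharmonicMeans.
Context {R : realType}.
Local Notation C := (Cplx R).
Local Notation "x %:C" := (real_complex _ x) (format "x %:C") : ring_scope.
Local Notation mu := (@lebesgue_measure R).
Implicit Types (z w a : R[i]) (u v : C -> \bar R) (U V : set C).

Lemma usc_measurable (F : R -> \bar R) : usc_on setT F -> measurable_fun setT F.
Proof.
move=> hF.
have -> : F = (fun t => - (- F t))%E by apply/funext => t; rewrite oppeK.
apply: measurableT_comp => //; apply: lower_semicontinuous_measurable => t c.
rewrite lteNr => h; have := hF t I (- c); rewrite EFinN => /(_ h) hn.
by exists [set y | (F y < - c%:E)%E] => // y /=; rewrite lteNr.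
Qed.

Lemma circ_continuous a (r : R) : continuous (circ_pt a r).
Proof.
move=> t P /nbhsCP[e e0 hP]; have [d d0 hd] := circ_cont a r t e0.
apply/nbhs_ballP; exists d => //= s; rewrite /ball /= distrC => /hd; exact: hP.
Qed.

Lemma circ_measurable U u a (r : R) : 0 <= r -> (forall z, nrm (z - a) = r -> U z) -> usc_on U u ->
  measurable_fun setT (fun t => u (circ_pt a r t)).
Proof.
move=> r0 cU uusc; apply: usc_measurable => t _ c hc.
have Ut : U (circ_pt a r t) by apply: cU; rewrite nrm_circ ger0_norm.
exact: (circ_continuous (uusc _ Ut c hc)).
Qed.

(** No integrability is at hand when [u] may have integral -oo; positive and negative parts are
    compared separately. *)
Lemma le_integral_meas (D : set R) (F G : R -> \bar R) : measurable D -> measurable_fun D F -> measurable_fun D G ->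
  (forall t, D t -> (F t <= G t)%E) -> (\int[mu]_(t in D) F t <= \int[mu]_(t in D) G t)%E.
Proof.
move=> mD mF mG FG; rewrite integralE [leRHS]integralE leeB//.
- apply: ge0_le_integral => //.
  + exact: measurable_funepos.
  + exact: measurable_funepos.
  + by move=> t /mem_set; apply: funepos_le => s /set_mem; exact: FG.
- apply: ge0_le_integral => //.
  + exact: measurable_funeneg.
  + exact: measurable_funeneg.
  + by move=> t /mem_set; apply: funeneg_le => s /set_mem; exact: FG.
Qed.

Lemma mean_integral (f : R -> R) : tcont f ->
  ((2 * pi)^-1%:E * \int[mu]_(t in `[0%R, (2 * pi)%R]) (f t)%:E)%E = (mean f)%:E.
Proof.
move=> cf; rewrite /mean EFinM /rint /Rintegral fineK//.
exact: integrable_fin_num (integrable_cont cf).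
Qed.

Lemma tcont_measurable (f : R -> R) : tcont f -> measurable_fun `[0%R, (2 * pi)%R] (EFin \o f).
Proof. by move=> /integrable_cont/integrableP[]. Qed.

Lemma subharmonic_SH U u : subharmonic U u -> SH U u.
Proof.
move=> [oU uoo uusc hu]; split=> // a r r0 aU g hg hb.
have cU : cdisc a r `<=` U by move=> z /cdiscE; exact: aU.
apply: le_trans (hu a r r0 cU) _.
have r00 : 0 <= r <= r by rewrite lexx ltW.
have [cg _] := hol_disc_tccont hg r00.
rewrite -(mean_value r0 hg) -mean_integral//.
apply: lee_wpmul2l; first by rewrite lee_fin invr_ge0 ltW// pi2_gt0.
apply: le_integral_meas => //.
- apply: measurable_funTS; apply: (circ_measurable (ltW r0) _ uusc) => z zr.
  by apply: aU; rewrite zr.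
- exact: tcont_measurable.
- by move=> t _; apply: hb; rewrite nrm_circ ger0_norm// ltW.
Qed.

Lemma HMat_mean u a (r : R) phi L : 0 < r -> 0 <= L -> lipschitz L phi ->
  (forall z, nrm (z - a) = r -> (u z <= (phi z)%:E)%E) -> HMat u a r ->
  (u a <= (mean (fun t => phi (circ_pt a r t)))%:E)%E.
Proof.
move=> r0 L0 lip uphi hu; apply/lee_addgt0Pr => e e0.
have e2 : 0 < e / 2 by rewrite divr_gt0.
have [g hg gphi] := @harmonic_approx R phi L a r (e / 2) L0 lip r0 e2.
have := hu (fun z => g z + (e / 2)%:C) (hol_discD hg (@hol_disc_cst _ _ _ _)).
rewrite cReD /= => h; apply: le_trans (h _) _.
  move=> z zr; apply: le_trans (uphi z zr) _; rewrite cReD /= lee_fin.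
  by have := gphi z zr; rewrite ler_norml => /andP[+ _]; clear; lra.
rewrite -EFinD lee_fin -(mean_value r0 hg) [e in leRHS]splitr addrA lerD2r.
have r00 : 0 <= r <= r by rewrite lexx ltW.
have [cg _] := hol_disc_tccont hg r00.
have cphi := @lipschitz_tcont R L phi a r L0 lip.
rewrite -[X in _ + X](mean_cst (e / 2)) -meanD//; last exact: cont_on_cst.
apply: mean_le => //; first by apply: cont_onD => //; exact: cont_on_cst.
move=> t; have := gphi (circ_pt a r t); rewrite nrm_circ (gtr0_norm r0) => /(_ erefl).
by rewrite ler_norml => /andP[_]; clear; lra.
Qed.

(** By [HMat_mean], u(a) is at most the mean of each Lipschitz majorant phi n. Monotone convergence
    for the increasing functions M - phi n >= 0 passes this to [u], and a finite u(a) makes M - u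
    integrable on the circle. *)
Lemma SH_subharmonic U u : SH U u -> subharmonic U u.
Proof.
move=> [oU uoo uusc hu]; split=> // a r r0 cU.
have aU z : nrm (z - a) <= r -> U z by move=> zr; apply: cU; apply/cdiscE.
pose K := [set z : C | nrm (z - a) = r].
have KU : K `<=` U by move=> z /= zr; apply: aU; rewrite zr.
have Ua : U a by apply: aU; rewrite subrr nrm0 ltW.
have cK : compact K := @compact_circle R a r.
have [|||phi [lip phi_ge phi_dec phi_lim]] := @sup_convolution R K u cK.
- exact: circle_pt (ltW r0).
- by move=> z /KU; exact: uoo.
- exact: usc_sub uusc.
have Kt t : K (circ_pt a r t) by rewrite /K /= nrm_circ ger0_norm// ltW.
have uam n : (u a <= (mean (fun t => phi n (circ_pt a r t)))%:E)%E.
  by apply: (HMat_mean r0 (ler0n R n) (lip n)) => // z zr; [exact: phi_ge|exact: hu].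
have cphi n : tcont (fun t => phi n (circ_pt a r t)) := @lipschitz_tcont R n%:R (phi n) a r (ler0n R n) (lip n).
case uaE : (u a) (uoo a Ua) => [x| |] // _; last by rewrite leNye.
(* [phi 0] is Lipschitz with constant 0, hence constant, so its value bounds every [phi n]. *)
pose M := phi 0%N a + r * 0.
have phi_decr m n z : (m <= n)%N -> phi n z <= phi m z.
  elim: n => [|n IH]; first by rewrite leqn0 => /eqP ->.
  rewrite leq_eqVlt => /predU1P[->//|]; rewrite ltnS => /IH; apply: le_trans.
  exact: phi_dec.
have phiM n t : phi n (circ_pt a r t) <= M.
  apply: le_trans (phi_decr 0%N n _ (leq0n n)) _; rewrite /M mulr0 addr0.
  have := lip 0%N (circ_pt a r t) a; rewrite mul0r normr_le0 subr_eq0 => /eqP ->.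
  exact: lexx.
pose D := `[0%R, (2 * pi)%R]%classic : set R.
have mD : measurable D by exact: measurable_itv.
have muD : mu D = (2 * pi)%:E.
  by rewrite /D lebesgue_measure_itv /= lte_fin pi2_gt0 -EFinB subr0.
pose f t := (M%:E - u (circ_pt a r t))%E.
pose fn n t := (M - phi n (circ_pt a r t))%:E.
have mu_ : measurable_fun D (fun t => u (circ_pt a r t)).
  by apply: measurable_funTS; apply: (circ_measurable (ltW r0) KU uusc).
have mf : measurable_fun D f by apply: emeasurable_funB => //; exact: measurable_cst.
have cfn n : tcont (fun t => M - phi n (circ_pt a r t)).
  by apply: cont_onB; [exact: cont_on_cst|exact: cphi].
have fn0 n t : D t -> (0 <= fn n t)%E by move=> _; rewrite lee_fin subr_ge0.
have mfn n : measurable_fun D (fn n) := tcont_measurable (cfn n).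
have fn_nd t : D t -> {homo fn^~ t : m n / (m <= n)%N >-> (m <= n)%E}.
  by move=> _ m n mn; rewrite lee_fin lerB// phi_decr.
have f0 t : (0 <= f t)%E.
  have := phi_ge 0%N _ (Kt t); rewrite /f; case: (u _) => [y| |]//.
    by rewrite -EFinB !lee_fin subr_ge0 => h; apply: le_trans h (phiM 0%N t).
  by move=> _; rewrite addeC /= leey.
have I_fn n : (\int[mu]_(t in D) fn n t <= ((M - x) * (2 * pi))%:E)%E.
  have := mean_integral (cfn n); rewrite meanB//; last exact: cont_on_cst.
  rewrite mean_cst => h.
  have fin : (\int[mu]_(t in D) fn n t)%E \is a fin_num by apply: integrable_fin_num => //; exact: (integrable_cont (cfn n)).
  rewrite -(fineK fin) lee_fin -ler_pdivrMr ?pi2_gt0// mulrC.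
  have <- : M - mean (fun t => phi n (circ_pt a r t)) = (2 * pi)^-1 * fine (\int[mu]_(t in D) fn n t)%E.
    by apply: EFin_inj; rewrite EFinM fineK.
  by rewrite lerB// -lee_fin -uaE.
have I_f : (\int[mu]_(t in D) f t <= ((M - x) * (2 * pi))%:E)%E.
  apply: (@le_trans _ _ (\int[mu]_(t in D) limn (fn^~ t))%E).
    apply: le_integral_meas => //.
      apply: (emeasurable_fun_cvg fn) => // t Dt.
      exact: ereal_nondecreasing_is_cvgn (fn_nd t Dt).
    move=> t Dt; have := ereal_nondecreasing_cvgn (fn_nd t Dt) => /cvg_lim -> //.
    rewrite leNgt; apply/negP => hlt.
    have s0 : (0 <= ereal_sup (range (fn^~ t)))%E.
      by apply: le_trans (fn0 0%N t Dt) _; apply: ereal_sup_ubound; exists 0%N.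
    case sE : (ereal_sup (range (fn^~ t))) s0 hlt => [s| |] // _ hlt; last by move: hlt; rewrite ltNge leey.
    have hu1 : (u (circ_pt a r t) < (M - s)%:E)%E.
      move: hlt; rewrite /f; case: (u _) => [y| |]//.
      by rewrite -EFinB !lte_fin ltrBrDl ltrBrDr addrC.
      by rewrite ltNyr.
    have [n hn] := phi_lim _ _ (Kt t) hu1.
    have : (fn n t <= s%:E)%E by rewrite -sE; apply: ereal_sup_ubound; exists n.
    by rewrite lee_fin; move: hn; clear; lra.
  rewrite monotone_convergence//; apply: lime_le.
    by apply: ereal_nondecreasing_is_cvgn => m n mn; apply: (le_integral_meas mD (mfn m) (mfn n)) => t Dt; exact: (fn_nd t Dt m n mn).
  by near=> n; exact: I_fn.
have f_int : mu.-integrable D f.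
  apply/integrableP; split=> //.
  under eq_integral do rewrite gee0_abs//.
  by apply: le_lt_trans I_f _; rewrite ltry.
have cst_int : mu.-integrable D (fun=> M%:E) by exact: (integrable_cont (@cont_on_cst _ _ _ M)).
have -> : (\int[mu]_(t in `[0%R, (2 * pi)%R]) u (circ_pt a r t) = \int[mu]_(t in D) (M%:E - f t))%E.
  apply: eq_integral => t _; rewrite /f.
  by have := uoo _ (KU _ (Kt t)); case: (u _) => [y _|//|_ //]; rewrite -!EFinB; congr EFin; ring.
have e2 : (\int[mu]_(t in D) M%:E)%E = (M * (2 * pi))%:E by rewrite integral_cst// EFinM -muD.
rewrite (integralB _ cst_int f_int)// e2.
have fI : (\int[mu]_(t in D) f t)%E \is a fin_num by apply: integrable_fin_num.
rewrite -(fineK fI) -EFinB -EFinM lee_fin.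
have hI : fine (\int[mu]_(t in D) f t)%E <= (M - x) * (2 * pi) by rewrite -lee_fin fineK.
rewrite mulrC ler_pdivlMr ?pi2_gt0//; move: hI; move: (2 * pi : R) (fine _) => p I; clear.
by rewrite mulrBl; lra.
Unshelve. all: by end_near. Qed.

End SubharmonicMeans.

(** * Finiteness on a dense set and Poisson modification *)

Section PoissonModification.
Context {R : realType}.
Local Notation C := (Cplx R).
Local Notation "x %:C" := (real_complex _ x) (format "x %:C") : ring_scope.
Local Notation Re := (@complex.Re R).
Implicit Types (z w a : R[i]) (g h : R[i] -> R[i]) (u v : C -> \bar R) (U V : set C).

Lemma HMat_Re g a (r : R) : 0 < r -> hol_disc g a r -> HMat (fun z => (Re (g z))%:E) a r.
Proof.
by move=> r0 hg h hh hb; rewrite lee_fin; apply: (Re_le_center r0 hg hh) => z /hb; rewrite lee_fin.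
Qed.

Lemma SH_Re U g : open U -> (forall z, U z -> exists d, cdf g d z) -> SH U (fun z => (Re (g z))%:E).
Proof.
move=> oU hg; split=> //.
- by move=> z _; exact: ltry.
- by apply: usc_cont => z /hg[d]; exact: cdf_for_cont.
- by move=> a r r0 aU; apply: HMat_Re => // z /aU /hg.
Qed.

Lemma Re_le_disc g h a (r : R) : 0 < r -> hol_disc g a r -> hol_disc h a r ->
  (forall z, nrm (z - a) = r -> Re (g z) <= Re (h z)) ->
  forall z, nrm (z - a) <= r -> Re (g z) <= Re (h z).
Proof.
move=> r0 hg hh gh z zr; rewrite -lee_fin.
apply: (@max_principle R (fun z => (Re (g z))%:E) h a r r0) => //.
- by move=> w _; exact: ltry.
- by apply: (@usc_cont R C [set x : C | nrm (x - a) <= r] (fun x : C => Re (g x))) => w wr; have [d] := hg w wr; exact: cdf_for_cont.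
- move=> w wr d d0; exists (Num.min d (r - nrm (w - a)) / 2).
    rewrite divr_gt0 ?lt_min ?d0 ?subr_gt0//= ltr_pdivrMr//.
    apply: (@le_lt_trans _ _ d); first by rewrite ge_min lexx.
    by rewrite ltr_pMr// ltr1n.
  apply: HMat_Re; first by rewrite divr_gt0 ?lt_min ?d0 ?subr_gt0.
  apply: hol_disc_sub hg => x xw; have := nrm_tri x w a.
  have : Num.min d (r - nrm (w - a)) <= r - nrm (w - a) by rewrite ge_min lexx orbT.
  have : 0 < Num.min d (r - nrm (w - a)) by rewrite lt_min d0 subr_gt0.
  by move: xw; move: (Num.min _ _) => m; clear; lra.
Qed.

(* If u were -oo near z0, adding a large multiple of 1/2 minus a Poisson kernel concentrated
   near z0 to a bound of u would give harmonic majorants tending to -oo at z1. *)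
Lemma SH_finite_dense u z1 : SH setT u -> (-oo < u z1)%E ->
  forall z0 (e : R), 0 < e -> exists2 z, nrm (z - z0) < e & (-oo < u z)%E.
Proof.
move=> [_ uoo uusc hu] u1 z0 e e0; apply: contrapT => hn.
have uN z : nrm (z - z0) < e -> u z = -oo%E.
  by move=> ze; apply/eqP; rewrite -leeNy_eq leNgt; apply/negP => uz; apply: hn; exists z.
have d10 : z0 - z1 != 0.
  apply/negP => /eqP/subr0_eq z01; apply: hn; exists z1 => //.
  by rewrite z01 subrr nrm0.
pose r := nrm (z0 - z1); have r0 : 0 < r by rewrite nrm_gt0.
pose K := [set z : C | nrm (z - z1) = r].
have [M hM] := @usc_lt_bounded R _ K u (@compact_circle R z1 r) (fun z _ => uoo z I) (usc_sub (@subsetT _ K) uusc).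
pose e' := e / r; have e'0 : 0 < e' by rewrite divr_gt0.
(* Away from [z0] the kernel satisfies P (e'/2)^2 <= 1 - rho^2 <= 2 t <= e'^2 / 8, that is P <=
   1/2. *)
pose t := Num.min 1 (e' ^+ 2 / 16); have t0 : 0 < t by rewrite lt_min ltr01 divr_gt0// exprn_gt0.
have t1 : t <= 1 by rewrite ge_min lexx.
have te : t <= e' ^+ 2 / 16 by rewrite ge_min lexx orbT.
pose rho := 1 - t.
have rho0 : 0 <= rho by rewrite subr_ge0.
have rho1 : rho < 1 by rewrite gtrBl.
pose zt z := (z - z1) / (z0 - z1).
have ztn z : nrm (z - z1) <= r -> nrm (rho%:C * zt z) < 1.
  move=> zr; rewrite nrmM nrmr (ger0_norm rho0) nrmM nrmV -/r.
  apply: (@le_lt_trans _ _ rho) => //; rewrite ler_piMr// ler_pdivrMr// mul1r//.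
(* Its real part is the Poisson kernel of the point rho zt(z) against 1: it equals 1 at [z1] and is
   concentrated near [z0], where zt = 1. *)
pose P z := 2%:C * (1 - rho%:C * zt z)^-1 - 1.
have hP : hol_disc P z1 r.
  move=> z zr.
  have nz : 1 - rho%:C * zt z != 0 by apply: sub_nz; rewrite nrm1; exact: ztn.
  have h1 := cdfD (cdf_cst 1 z) (cdfZ (-1) (cdfZ rho%:C (cdfM (cdfD (cdf_id z) (cdf_cst (- z1) z)) (cdf_cst (z0 - z1)^-1 z)))).
  have nz' : 1 + -1 * (rho%:C * ((z + - z1) * (z0 - z1)^-1)) != 0 by rewrite mulN1r.
  have h2 := cdfD (cdfZ 2%:C (cdf_comp h1 (cdf_inv nz'))) (cdf_cst (-1) z).
  eexists; rewrite /P; have -> : (fun z => 2%:C * (1 - rho%:C * zt z)^-1 - 1) =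
    (fun x => 2%:C * (1 + -1 * (rho%:C * ((x + - z1) * (z0 - z1)^-1)))^-1 + -1).
    by apply/funext => x; rewrite mulN1r.
  exact: h2.
have PE z : Re (P z) = poisson (rho%:C * zt z) 1.
  by rewrite /P /poisson cReD cReZ mul1r cReN.
have Pc : Re (P z1) = 1.
  by rewrite PE /poisson /zt subrr mul0r mulr0 subr0 divr1 /=; ring.
have Psmall z : K z -> e <= nrm (z - z0) -> Re (P z) <= 2^-1.
  move=> Kz ze; have zr : nrm (z - z1) <= r by rewrite Kz.
  have y1 := ztn z zr; rewrite PE.
  have zt1 : nrm (zt z) = 1 by rewrite nrmM nrmV Kz divff// gt_eqF.
  have yn : nrm (rho%:C * zt z) = rho by rewrite nrmM zt1 mulr1 nrmr ger0_norm.
  have ze' : e' <= nrm (1 - zt z).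
    have -> : 1 - zt z = (z0 - z) / (z0 - z1) by rewrite /zt; field.
    by rewrite nrmM nrmV -/r ler_pM2r ?invr_gt0// nrmBC.
  have h1 := nrm_tri 1 (rho%:C * zt z) (zt z).
  have h2 : nrm (rho%:C * zt z - zt z) = t.
    have -> : rho%:C * zt z - zt z = (- t)%:C * zt z by rewrite /rho rmorphB rmorphN /=; ring.
    by rewrite nrmM zt1 mulr1 nrmr normrN gtr0_norm.
  have h3 := nrmB_ge 1 (rho%:C * zt z); rewrite nrm1 yn /rho in h3.
  have h4 : e' / 2 <= nrm (1 - rho%:C * zt z) by move: h1 h2 h3 ze'; clear; lra.
  have P0 := poisson_ge0 y1 (@nrm1 R).
  have := poissonE y1 (@nrm1 R); rewrite yn expr1n => PEq.
  have h5 : poisson (rho%:C * zt z) 1 * (e' / 2) ^+ 2 <= 1 - rho ^+ 2.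
    rewrite -PEq ler_wpM2l// ler_sqr ?nnegrE ?nrm_ge0//.
    by rewrite divr_ge0// ltW.
  have h6 : 1 - rho ^+ 2 <= 2 * t.
    have -> : 1 - rho ^+ 2 = 2 * t - t ^+ 2 by rewrite /rho; ring.
    by rewrite gerBl sqr_ge0.
  have e2 : 0 < (e' / 2) ^+ 2 by rewrite exprn_gt0// divr_gt0.
  rewrite -(ler_pM2r e2); apply: le_trans h5 _; apply: le_trans h6 _.
  rewrite (_ : 2^-1 * (e' / 2) ^+ 2 = 2 * (e' ^+ 2 / 16)); last by field.
  by rewrite ler_pM2l.
have ub (n : nat) : (u z1 <= (M - n%:R / 2)%:E)%E.
  have hg : hol_disc (fun z => M%:C + (n%:R)%:C * (2^-1%:C - P z)) z1 r.
    apply: hol_discD; first exact: hol_disc_cst.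
    apply: hol_discZ; apply: hol_discD; first exact: hol_disc_cst.
    exact: hol_discN.
  have := hu z1 r r0 (fun z _ => I) _ hg; rewrite cReD cReZ cReD cReN Pc /=.
  have -> : M + n%:R * (2^-1 - 1) = M - n%:R / 2 by field.
  apply=> z zr; have [ze|ze] := ltP (nrm (z - z0)) e; first by rewrite uN// leNye.
  apply: le_trans (ltW (hM z zr)) _; rewrite cReD cReZ cReD cReN /= lee_fin lerDl.
  by rewrite mulr_ge0// subr_ge0 Psmall.
case u1E : (u z1) u1 (uoo z1 I) => [x| |] // _ _.
have := ub (Num.bound `|2 * (M - x)|); rewrite u1E lee_fin leNgt => /negP; apply.
have := archi_boundP (normr_ge0 (2 * (M - x))); have := ler_norm (2 * (M - x)).
by move: (Num.bound _)%:R => b; clear; lra.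
Qed.

(** Inside the disc [u] is replaced by the infimum of decreasing harmonic functions whose boundary
    values decrease to [u], which stands for its Poisson integral. Finiteness at the centre then
    spreads to half the disc by Harnack's inequality. *)
Lemma poisson_modification u c (r : R) : SH setT u -> (-oo < u c)%E -> 0 < r ->
  exists u', [/\ SH setT u', forall z, (u z <= u' z)%E, forall z, r <= nrm (z - c) -> u' z = u z &
    exists m : R, forall z, nrm (z - c) <= r / 2 -> ((- m)%:E <= u' z)%E].
Proof.
move=> su uc r0; have [_ uoo uusc hu] := su.
pose K := [set z : C | nrm (z - c) = r].
have cK : compact K := @compact_circle R c r.
have [|||phi [lip phi_ge phi_dec phi_lim]] := @sup_convolution R K u cK.
- exact: circle_pt (ltW r0).
- by move=> z _; exact: uoo.
- exact: usc_sub uusc.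
have phi_decr m n z : (m <= n)%N -> phi n z <= phi m z.
  elim: n => [|n IH]; first by rewrite leqn0 => /eqP ->.
  rewrite leq_eqVlt => /predU1P[->//|]; rewrite ltnS => /IH; apply: le_trans.
  exact: phi_dec.
(* Powers of 1/3 make consecutive margins fit: on the circle Re (g (n+1)) <= phi (n+1) + 3 ep (n+1)
   = phi (n+1) + ep n <= Re (g n). *)
pose ep n : R := 3^-1 ^+ n.
have ep0 n : 0 < ep n by rewrite exprn_gt0// invr_gt0.
have epS n : 3 * ep n.+1 = ep n by rewrite /ep exprS mulrA divff ?mul1r// gt_eqF.
have ex n : exists g, [/\ hol_disc g c r, forall z, K z -> phi n z + ep n <= Re (g z) &
     forall z, K z -> Re (g z) <= phi n z + 3 * ep n].
  have [g hg gphi] := @harmonic_approx R (phi n) n%:R c r (ep n) (ler0n R n) (lip n) r0 (ep0 n).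
  exists (fun z => g z + (2 * ep n)%:C); split.
  - exact: hol_discD hg (@hol_disc_cst _ _ _ _).
  - by move=> z zr; have := gphi z zr; rewrite cReD /= ler_norml => /andP[+ _]; clear; lra.
  - by move=> z zr; have := gphi z zr; rewrite cReD /= ler_norml => /andP[_]; clear; lra.
pose g n := sval (cid (ex n)).
have hg n : hol_disc (g n) c r by rewrite /g; case: cid => ? /= [].
have g1 n z : K z -> phi n z + ep n <= Re (g n z) by rewrite /g; case: cid => ? /= [] _ + _; exact.
have g2 n z : K z -> Re (g n z) <= phi n z + 3 * ep n by rewrite /g; case: cid => ? /= [] _ _; exact.
have gdec n z : nrm (z - c) <= r -> Re (g n.+1 z) <= Re (g n z).
  apply: (Re_le_disc r0 (hg _) (hg _)) => w wr.
  apply: le_trans (g2 n.+1 w wr) _; rewrite epS; apply: le_trans (g1 n w wr).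
  by rewrite lerD2r.
have ug n z : nrm (z - c) <= r -> (u z <= (Re (g n z))%:E)%E.
  apply: (SH_max_principle su r0 _ (hg n)) => // w wr.
  apply: le_trans (phi_ge n w wr) _; rewrite lee_fin; apply: le_trans (g1 n w wr).
  by rewrite lerDl ltW.
pose iu z := ereal_inf (range (fun n => (Re (g n z))%:E)).
have iu_le n z : (iu z <= (Re (g n z))%:E)%E by apply: ereal_inf_lbound; exists n.
have iu_lt z (x : R) : (iu z < x%:E)%E -> exists n, Re (g n z) < x.
  move=> h; apply: contrapT => hn; move: h; rewrite ltNge => /negP; apply.
  apply: le_ereal_inf_tmp => _ [n _ <-]; rewrite lee_fin leNgt; apply/negP => hx; apply: hn.
  by exists n.
have u_iu z : nrm (z - c) <= r -> (u z <= iu z)%E.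
  by move=> zr; apply: le_ereal_inf_tmp => _ [n _ <-]; exact: ug.
pose u' (z : C) := if nrm (z - c) < r then iu z else u z.
have uu' z : (u z <= u' z)%E by rewrite /u'; case: ifPn => // /ltW; exact: u_iu.
have u'oo z : (u' z < +oo)%E.
  by rewrite /u'; case: ifPn => _; [apply: le_lt_trans (iu_le 0%N z) _; rewrite ltry|exact: uoo].
have oB : open [set z : C | nrm (z - c) < r] by exact: open_disc.
have sB : SH [set z : C | nrm (z - c) < r] iu.
  apply: (@SH_lim _ _ (fun n z => (Re (g n z))%:E)) => //.
  - by move=> n; apply: SH_Re => // z /ltW; exact: hg.
  - by move=> n z /ltW zr; rewrite lee_fin gdec.
  - by move=> z x _ /iu_lt[n hn]; exists n; rewrite lte_fin.
have u'usc : usc_on setT u'.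
  move=> z _ x; have [zr|zr|zr] := ltgtP (nrm (z - c)) r.
  - have [_ _ busc _] := sB; rewrite {1}/u' zr => /(busc z zr).
    have : nbhs z [set z : C | nrm (z - c) < r] by apply: open_nbhs_nbhs.
    by apply: filterS2 => y /= yr; rewrite /u' yr.
  - rewrite {1}/u' (lt_gtF zr) => /(uusc z I).
    have : nbhs z [set z : C | r < nrm (z - c)].
      apply/nbhsCP; exists (nrm (z - c) - r); first by rewrite subr_gt0.
      by move=> y; have := nrm_tri z y c; rewrite (nrmBC z y) /=; clear; lra.
    by apply: filterS2 => y /= yr; rewrite /u' (lt_gtF yr).
  - rewrite {1}/u' zr ltxx => uz.
    (* At a point of the bounding circle one Re (g n) already lies below [x]; by continuity it does
       so nearby, and inside the disc it dominates the modified function. *)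
    have [x' ux' x'x] := lte_EFin_dense uz.
    have [m hm] := phi_lim z x' zr ux'.
    have [n1 hn1] := ex_lt_pow2 (3 / (x - x')).
    pose n := maxn m n1.
    have gn : Re (g n z) < x.
      apply: le_lt_trans (g2 n z zr) _.
      have h1 := phi_decr m n z (leq_maxl _ _).
      have h2 : 3 * ep n < x - x'.
        have h3 : ep n <= (2 ^+ n1)^-1.
          rewrite /ep exprVn lef_pV2 ?posrE ?exprn_gt0//.
          apply: (@le_trans _ _ (2 ^+ n)); first by rewrite ler_eXn2l ?leq_maxr// ltr1n.
          by rewrite lerXn2r ?nnegrE// ler_nat.
        apply: (@le_lt_trans _ _ (3 * (2 ^+ n1)^-1)); first by rewrite ler_pM2l.
        rewrite ltr_pdivrMr ?exprn_gt0// mulrC -ltr_pdivrMr// subr_gt0//.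
      by move: h1 h2 hm; clear; lra.
    have [|d hd] := hg n z; first by rewrite zr.
    have := @usc_cont R _ [set z] (fun y : C => Re (g n y)) _ z erefl x.
    rewrite lte_fin => /(_ _ gn) hnear.
    have {}hnear : \forall y \near z, ((Re (g n y))%:E < x%:E)%E.
      by apply: hnear => _ ->; exact: cdf_for_cont hd.
    have := uusc z I x uz; apply: filterS2 hnear => y h1 h2.
    by rewrite /u'; case: ifPn => // _; apply: le_lt_trans (iu_le n y) h1.
exists u'; split=> //.
- apply: SH_local => //; first exact: openT.
  move=> z _ d d0; have [zr|zr] := ltP (nrm (z - c)) r; last first.
    exists (d / 2); first by rewrite divr_gt0//= ltr_pdivrMr// ltr_pMr// ltr1n.
    apply: (@HMat_incr _ u); first by rewrite /u' ltNge zr.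
      by move=> w _; exact: uu'.
    by apply: hu; rewrite ?divr_gt0.
  have m0 : 0 < Num.min d (r - nrm (z - c)) by rewrite lt_min d0 subr_gt0.
  exists (Num.min d (r - nrm (z - c)) / 2).
    rewrite divr_gt0//= ltr_pdivrMr//; apply: (@le_lt_trans _ _ d); first by rewrite ge_min lexx.
    by rewrite ltr_pMr// ltr1n.
  have inB w : nrm (w - z) <= Num.min d (r - nrm (z - c)) / 2 -> nrm (w - c) < r.
    have := nrm_tri w z c; have : Num.min d (r - nrm (z - c)) <= r - nrm (z - c) by rewrite ge_min lexx orbT.
    by move: m0; move: (Num.min _ _) => m; clear; lra.
  apply: (@HMat_ext _ iu); first by rewrite divr_gt0.
    by move=> w /inB; rewrite /u' => ->.
  by have [_ _ _] := sB; apply; rewrite ?divr_gt0.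
- by move=> z zr; rewrite /u' ltNge zr.
have ucE : u c = (fine (u c))%:E by rewrite fineK// fin_real// uc uoo.
have [m0 hm0] := @usc_lt_bounded R _ [set z : C | nrm (z - c) <= r] (fun z => (- Re (g 0%N z))%:E) (@compact_cdisc R c r)
  (fun z _ => ltry _) (fun z zr => @usc_cont R _ [set z : C | nrm (z - c) <= r] (fun z => - Re (g 0%N z))
    (fun z zr => let: ex_intro d hd := hg 0%N z zr in @continuousN _ _ _ (fun y : C => Re (g 0%N y)) z (cdf_for_cont hd)) z zr).
(* Harnack is applied to Re (g 0 - g n) >= 0, whose value at [c] is at most Re (g 0 c) - u c for
   every [n]; [m0] bounds -Re (g 0) on the disc. *)
exists (m0 + 3 * (Re (g 0%N c) - fine (u c))) => z zr.
have hr : r / 2 < r by rewrite ltr_pdivrMr// ltr_pMr// ltr1n.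
rewrite /u' (le_lt_trans zr hr); apply: le_ereal_inf_tmp => _ [n _ <-].
have gd0 w : nrm (w - c) <= r -> Re (g n w) <= Re (g 0%N w).
  by move=> wr; elim: n => [//|n IH]; apply: le_trans (gdec n w wr) IH.
have := @harnack R (fun z => g 0%N z + - g n z) c z r r0 (hol_discD (hg 0%N) (hol_discN (hg n))) _ zr.
rewrite !cReD !cReN => /(_ _) h.
have {}h : Re (g 0%N z) - Re (g n z) <= 3 * (Re (g 0%N c) - Re (g n c)).
  by apply: h => w wr; rewrite cReD cReN subr_ge0 gd0// wr.
have h2 : fine (u c) <= Re (g n c) by rewrite -lee_fin -ucE ug// subrr nrm0 ltW.
have h3 := hm0 z (le_trans zr (ltW hr)); rewrite lte_fin in h3.
by rewrite lee_fin; move: h h2 h3; clear; lra.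
Qed.

End PoissonModification.

(** * Plurisubharmonic functions of two variables *)

Section Plurisubharmonic.
Context {R : realType}.
Local Notation C := (Cplx R).
Local Notation CC := (C * C)%type.
Implicit Types (p v q : CC) (W : set CC) (u : CC -> \bar R) (U : set C).

Lemma nbhsCCP q (P : set CC) : nbhs q P <->
  exists2 e : R, 0 < e & forall y : CC, nrm (y.1 - q.1) < e -> nrm (y.2 - q.2) < e -> P y.
Proof.
split=> [[[A B] /= [/nbhsCP[d d0 hA] /nbhsCP[e e0 hB]] hP]|[e e0 h]].
  exists (Num.min d e); first by rewrite lt_min d0.
  move=> y; rewrite !lt_min => /andP[y1 _] /andP[_ y2].
  by apply: hP; split; [exact: hA|exact: hB].
exists ([set z : C | nrm (z - q.1) < e], [set z : C | nrm (z - q.2) < e]).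
  by split; apply/nbhsCP; exists e.
by move=> y [] /= *; exact: h.
Qed.

Lemma cline_continuous p v : continuous (cline p v).
Proof.
move=> l P /nbhsCCP[e e0 hP]; apply/nbhsCP.
have [d1 d10 h1] := cdf_ccont (cdfD (cdf_cst p.1 l) (cdfM (cdf_id l) (cdf_cst v.1 l))) e0.
have [d2 d20 h2] := cdf_ccont (cdfD (cdf_cst p.2 l) (cdfM (cdf_id l) (cdf_cst v.2 l))) e0.
exists (Num.min d1 d2); first by rewrite lt_min d10.
by move=> y; rewrite lt_min => /andP[/h1 y1 /h2 y2]; apply: hP.
Qed.

(** Restrictions to complex lines are tested by [HM], so the closure properties of [SH] transfer
    line by line; [psh_plurisubharmonic] returns to the notion of the statement. *)
Definition psh W u := [/\ open W, forall q, W q -> (u q < +oo)%E, usc_on W u &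
  forall p v, HM [set l | W (cline p v l)] (fun l => u (cline p v l))].

Lemma psh_SH W u p v : psh W u -> SH [set l | W (cline p v l)] (fun l => u (cline p v l)).
Proof.
move=> [oW uoo uusc hu]; split=> //.
- by apply: open_comp => // l _; exact: cline_continuous.
- by move=> l; exact: uoo.
- exact: usc_comp (@cline_continuous p v) uusc.
Qed.

Lemma psh_plurisubharmonic W u : psh W u -> plurisubharmonic W u.
Proof.
by move=> hu; have [? ? ? _] := hu; split=> // p v; apply: SH_subharmonic; exact: psh_SH.
Qed.

Lemma psh_intro W u : open W -> (forall q, W q -> (u q < +oo)%E) -> usc_on W u ->
  (forall p v, SH [set l | W (cline p v l)] (fun l => u (cline p v l))) -> psh W u.
Proof. by move=> oW uoo uusc hu; split=> // p v; have [] := hu p v. Qed.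

Lemma psh_glue W u : open W -> (forall q, W q -> exists V u', [/\ V q, psh V u' & forall y, V y -> u y = u' y]) ->
  psh W u.
Proof.
move=> oW h; apply: psh_intro => //.
- by move=> q /h[V [u' [Vq [_ uoo _ _] uu]]]; rewrite uu// uoo.
- move=> q /h[V [u' [Vq [oV _ uusc _] uu]]].
  by apply: (@usc_ext R _ V u' u) => // y Vy; rewrite uu.
- move=> p v; apply: SH_glue; first by apply: open_comp => // l _; exact: cline_continuous.
  move=> l /h[V [u' [Vq hu' uu]]].
  exists [set l | V (cline p v l)], (fun l => u' (cline p v l)); split=> //; first exact: psh_SH.
  by move=> y; exact: uu.
Qed.

Lemma psh_sub V W u : open V -> V `<=` W -> psh W u -> psh V u.
Proof.
move=> oV VW hu; have [oW uoo uusc _] := hu; apply: psh_intro => //.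
- by move=> q /VW; exact: uoo.
- exact: usc_sub uusc.
- move=> p v; apply: SH_sub (psh_SH p v hu); last by move=> l; exact: VW.
  by apply: open_comp => // l _; exact: cline_continuous.
Qed.

Lemma psh_ext W u u' : (forall q, W q -> u q = u' q) -> psh W u -> psh W u'.
Proof.
move=> uu hu; have [oW _ _ _] := hu; apply: psh_glue => // q Wq.
by exists W, u; split=> // y Wy; rewrite uu.
Qed.

Lemma psh_maxr W u u' : psh W u -> psh W u' -> psh W (fun q => Order.max (u q) (u' q)).
Proof.
move=> hu hu'; have [oW uoo uusc _] := hu; have [_ uoo' uusc' _] := hu'; apply: psh_intro => //.
- by move=> q Wq; rewrite gt_max uoo// uoo'.
- exact: usc_maxr.
- by move=> p v; exact: SH_maxr (psh_SH p v hu) (psh_SH p v hu').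
Qed.

Lemma psh_add W u u' : psh W u -> psh W u' -> psh W (fun q => u q + u' q)%E.
Proof.
move=> hu hu'; have [oW uoo uusc _] := hu; have [_ uoo' uusc' _] := hu'; apply: psh_intro => //.
- by move=> q Wq; apply: adde_ltoo; [exact: uoo|exact: uoo'].
- exact: usc_add.
- by move=> p v; exact: SH_add (psh_SH p v hu) (psh_SH p v hu').
Qed.

Lemma psh_cst W (c : \bar R) : open W -> (c < +oo)%E -> psh W (fun=> c).
Proof.
move=> oW coo; apply: psh_intro => //.
  by move=> z Wz d cd; near=> y.
by move=> p v; apply: SH_cst => //; apply: open_comp => // l _; exact: cline_continuous.
Unshelve. all: by end_near. Qed.

Lemma psh_scale W u (k : R) : 0 < k -> psh W u -> psh W (fun q => k%:E * u q)%E.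
Proof.
move=> k0 hu; have [oW uoo uusc _] := hu; apply: psh_intro => //.
- move=> q /uoo; case: (u q) => [t _|//|_]; first exact: ltry.
  by rewrite gt0_muleNy ?lte_fin.
- exact: usc_scale.
- by move=> p v; apply: SH_scale => //; exact: psh_SH.
Qed.

Lemma psh_lim W (un : nat -> CC -> \bar R) u : open W -> (forall n, psh W (un n)) ->
  (forall n q, W q -> (un n.+1 q <= un n q)%E) -> (forall n q, W q -> (u q <= un n q)%E) ->
  (forall q (c : R), W q -> (u q < c%:E)%E -> exists n, (un n q < c%:E)%E) -> psh W u.
Proof.
move=> oW hun dec ule ulim; apply: psh_intro => //.
- by move=> q Wq; apply: le_lt_trans (ule 0%N q Wq) _; have [_ + _ _] := hun 0%N; exact.
- move=> q Wq c /(ulim q c Wq)[n hn]; have [_ _ + _] := hun n => /(_ q Wq c hn).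
  have : nbhs q W by apply: open_nbhs_nbhs.
  by apply: filterS2 => y Wy; apply: le_lt_trans; exact: ule.
- move=> p v; apply: (@SH_lim _ _ (fun n l => un n (cline p v l))).
  + by apply: open_comp => // l _; exact: cline_continuous.
  + by move=> n; exact: psh_SH.
  + by move=> n l; exact: dec.
  + by move=> n l; exact: ule.
  + by move=> l c; exact: ulim.
Qed.

Lemma open_fst U : open U -> open (U `*` [set: C]).
Proof.
move=> oU; rewrite (_ : _ `*` _ = fst @^-1` U); last by apply/seteqP; split=> q //= [].
by apply: open_comp => // q _; exact: cvg_fst.
Qed.

Lemma psh_fst U (h : C -> \bar R) : SH U h -> psh (U `*` [set: C]) (fun q => h q.1).
Proof.
move=> [oU hoo husc hh]; split=> //.
- exact: open_fst.
- by move=> q [/hoo].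
- move=> q [Uq _] c hc; exact: (cvg_fst (husc _ Uq c hc)).
- move=> p v; have := @HM_affine R U h p.1 v.1 hh; congr HM.
  by apply/seteqP; split=> l //= [].
Qed.

Section Holomorphic.
Variables (W : set CC) (F : CC -> C).
Hypotheses (oW : open W) (cF : forall q, W q -> {for q, continuous (fun y => nrm (F y))})
  (hF : forall p v l, W (cline p v l) -> exists d, cdf (fun l => F (cline p v l)) d l).

Lemma psh_eln : psh W (fun q => eln (nrm (F q))).
Proof.
apply: psh_intro => //.
- by move=> q _; exact: eln_ltoo.
- by apply: usc_eln => // q; exact: nrm_ge0.
- move=> p v; apply: SH_eln; first by apply: open_comp => // l _; exact: cline_continuous.
  by move=> l; exact: hF.
Qed.

Lemma psh_nrm : psh W (fun q => (nrm (F q))%:E).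
Proof.
apply: psh_intro => //.
- by move=> q _; exact: ltry.
- exact: usc_cont.
- move=> p v; apply: SH_nrm; first by apply: open_comp => // l _; exact: cline_continuous.
  by move=> l; exact: hF.
Qed.

End Holomorphic.

Lemma nrm_eps_continuous (F : CC -> C) q :
  (forall e : R, 0 < e -> exists2 d : R, 0 < d &
    forall y : CC, nrm (y.1 - q.1) < d -> nrm (y.2 - q.2) < d -> nrm (F y - F q) < e) ->
  {for q, continuous (fun y => nrm (F y))}.
Proof.
move=> h P /nbhs_ballP[e /= e0 hP]; have [d d0 hd] := h _ e0.
apply/nbhsCCP; exists d => // y y1 y2; apply: hP; rewrite /ball /= distrC; apply: le_lt_trans (hd y y1 y2).
have h1 := nrmB_ge (F y) (F q); have h2 := nrmB_ge (F q) (F y); rewrite nrmBC in h2.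
by rewrite ler_norml; apply/andP; split; move: h1 h2; clear; lra.
Qed.

Lemma psh_eln_graph U (f : C -> C) : open U -> (forall z, U z -> exists d, cdf f d z) ->
  psh (U `*` [set: C]) (fun q => eln (nrm (q.2 - f q.1))).
Proof.
move=> oU hf; apply: psh_eln; first exact: open_fst.
- move=> q [Uq _]; apply: nrm_eps_continuous => e e0.
  have [d /cdf_ccont hd] := hf _ Uq.
  have e2 : 0 < e / 2 by rewrite divr_gt0.
  have [r r0 hr] := hd _ e2; exists (Num.min r (e / 2)); first by rewrite lt_min r0.
  move=> y; rewrite !lt_min => /andP[/hr y1 _] /andP[_ y2].
  have -> : y.2 - f y.1 - (q.2 - f q.1) = (y.2 - q.2) - (f y.1 - f q.1) by ring.
  apply: le_lt_trans (nrmD _ _) _; rewrite nrmN.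
  by move: y1 y2; clear; lra.
- move=> p v l [/= Ul _]; have [d hd] := hf _ Ul.
  have h1 := cdf_comp (cdfD (cdf_cst p.1 l) (cdfM (cdf_id l) (cdf_cst v.1 l))) hd.
  have h2 := cdfD (cdfD (cdf_cst p.2 l) (cdfM (cdf_id l) (cdf_cst v.2 l))) (cdfZ (-1) h1).
  eexists; apply: cdf_ext ltr01 _ h2 => y _ /=.
  by rewrite mulN1r.
Qed.

Lemma psh_nrm_fst W : open W -> psh W (fun q => (nrm q.1)%:E).
Proof.
move=> oW; apply: psh_nrm => //.
- by move=> q _; apply: nrm_eps_continuous => e e0; exists e.
- move=> p v l _; eexists; exact: cdfD (cdf_cst p.1 l) (cdfM (cdf_id l) (cdf_cst v.1 l)).
Qed.

Lemma psh_nrm_snd W : open W -> psh W (fun q => (nrm q.2)%:E).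
Proof.
move=> oW; apply: psh_nrm => //.
- by move=> q _; apply: nrm_eps_continuous => e e0; exists e.
- move=> p v l _; eexists; exact: cdfD (cdf_cst p.2 l) (cdfM (cdf_id l) (cdf_cst v.2 l)).
Qed.

End Plurisubharmonic.

(** * A plurisubharmonic exhaustion of the product and truncation along it *)

Section Exhaustion.
Context {R : realType}.
Local Notation C := (Cplx R).
Local Notation CC := (C * C)%type.
Implicit Types (q : CC) (s v : CC -> R) (D : set C) (z w : R[i]).

(** Openness of {s > k} adds lower semicontinuity to the upper one inside [psh]. The last clause
    gives the compact sets over which constants are chosen. *)
Definition exhaustion D s := [/\ psh (D `*` [set: C]) (fun q => (s q)%:E),
  forall k : R, open [set q | (D `*` [set: C]) q /\ k < s q] &
  forall k : R, exists K : set C, [/\ compact K, K `<=` D &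
    forall q, D q.1 -> s q < k -> K q.1 /\ nrm q.2 < k]].

Lemma closed_eps (K : set C) :
  (forall z, (forall e : R, 0 < e -> exists2 y, K y & nrm (y - z) < e) -> K z) -> closed K.
Proof.
move=> h z clz; apply: h => e e0.
have [|y [Ky yz]] := clz [set y : C | nrm (y - z) < e]; first by apply/nbhsCP; exists e.
by exists y.
Qed.

Lemma openCCP (W : set CC) : (forall q, W q -> exists2 e : R, 0 < e &
  forall y : CC, nrm (y.1 - q.1) < e -> nrm (y.2 - q.2) < e -> W y) -> open W.
Proof. by move=> h; rewrite openE => q /h hq; apply/nbhsCCP. Qed.

(** The reciprocal of the distance to the complement of [D] is the supremum of |1 / (z - b)| over b
    outside [D], hence subharmonic; [s] is its maximum with |z| and |w|. *)
Lemma exists_exhaustion D : open D -> exists s, exhaustion D s.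
Proof.
(* The index [None], with value 0, keeps the family nonempty when [D] is the whole plane. *)
move=> oD; pose I := option {b : C | ~ D b}.
pose us (i : I) z : R := if i is Some b then nrm ((z - sval b)^-1) else 0.
pose S (z : C) := ereal_sup (range (fun i => (us i z)%:E)).
have Sge i z : ((us i z)%:E <= S z)%E by apply: ereal_sup_ubound; exists i.
have Sle z (c : \bar R) : (forall i, ((us i z)%:E <= c)%E) -> (S z <= c)%E.
  by move=> h; apply: ge_ereal_sup => _ [i _ <-]; exact: h.
have S0 z : (0 <= S z)%E by exact: (Sge None).
have Db z (b : {b : C | ~ D b}) : D z -> z - sval b != 0.
  by move=> Dz; apply/negP => /eqP/subr0_eq zb; apply: (svalP b); rewrite -zb.
have Soo z : D z -> (S z < +oo)%E.
  move=> Dz; have [e e0 he] := (openCP D).1 oD z Dz.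
  apply: (@le_lt_trans _ _ (e^-1)%:E); last exact: ltry.
  apply: Sle => -[b|] /=; last by rewrite lee_fin invr_ge0 ltW.
  rewrite lee_fin nrmV lef_pV2 ?posrE//; last by rewrite nrm_gt0 Db.
  by rewrite leNgt nrmBC; apply/negP => /he; exact: (svalP b).
have SE z : D z -> S z = (fine (S z))%:E.
  by move=> Dz; rewrite fineK// ge0_fin_numE// Soo.
have hol b z : D z -> exists d, cdf (fun y => (y - sval (b : {b : C | ~ D b}))^-1) d z.
  move=> Dz; eexists; apply: (cdf_comp (cdfD (cdf_id z) (cdf_cst (- sval b) z))).
  by apply: cdf_inv; exact: Db.
have sS : SH D S.
  split=> //.
  - move=> z Dz c zc; have [c2 zc2 c2c] := lte_EFin_dense zc; have [c1 zc1 c12] := lte_EFin_dense zc2.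
    have c10 : 0 < c1 by rewrite -lte_fin; exact: le_lt_trans zc1.
    have c20 := lt_trans c10 c12.
    apply/nbhsCP; exists (c1^-1 - c2^-1); first by rewrite subr_gt0 ltf_pV2.
    move=> y yz; apply: (@le_lt_trans _ _ c2%:E); last by rewrite lte_fin.
    apply: Sle => -[b|] /=; last by rewrite lee_fin ltW.
    have := le_lt_trans (Sge (Some b) z) zc1; rewrite lte_fin /us nrmV => h.
    have n0 : 0 < nrm (z - sval b) by rewrite nrm_gt0 Db.
    have h1 : c1^-1 < nrm (z - sval b) by rewrite -[X in _ < X]invrK ltf_pV2 ?posrE ?invr_gt0.
    have h2 := nrm_tri z y (sval b); rewrite (nrmBC z y) in h2.
    have h3 : c2^-1 < nrm (y - sval b) by move: h1 h2 yz; clear; lra.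
    rewrite lee_fin nrmV -[X in _ <= X]invrK lef_pV2 ?posrE ?invr_gt0//; first exact: ltW.
    by apply: lt_trans h3; rewrite invr_gt0.
  - move=> a r r0 aD; apply: (@HMat_sup _ _ (fun i z => (us i z)%:E)) => //.
      by move=> c; exact: Sle.
    move=> [b|]; last exact: (@HMat_cst R 0%:E a r r0).
    by apply: HMat_nrm => // z /aD; exact: hol.
pose sg z := fine (S z).
pose s q := Num.max (sg q.1) (Num.max (nrm q.1) (nrm q.2)).
have oW := open_fst oD.
exists s; split.
- apply: psh_ext (psh_maxr (psh_fst sS) (psh_maxr (psh_nrm_fst oW) (psh_nrm_snd oW))).
  by move=> q [Dq _]; rewrite SE// -!EFin_max.
- move=> k; apply: openCCP => q [[Dq _]]; rewrite /s !lt_max => hq.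
  have [e e0 he] := (openCP D).1 oD _ Dq.
  suff [d d0 hd] : exists2 d : R, 0 < d & forall y : CC, D y.1 -> nrm (y.1 - q.1) < d -> nrm (y.2 - q.2) < d ->
      [|| k < sg y.1, k < nrm y.1 | k < nrm y.2].
    exists (Num.min e d); first by rewrite lt_min e0.
    move=> y; rewrite !lt_min => /andP[/he Dy y1] /andP[_ y2].
    by split=> //=; rewrite !lt_max; exact: hd.
  case/or3P: hq => [|h|h].
  + rewrite -lte_fin -SE// => kS.
    have [i hi] : exists i, k < us i q.1.
      apply: contrapT => hn; move: kS; rewrite ltNge => /negP; apply; apply: Sle => i.
      by rewrite lee_fin leNgt; apply/negP => hi; apply: hn; exists i.
    have sgi y : D y -> us i y <= sg y by move=> Dy; rewrite -lee_fin -SE.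
    case: i hi sgi => [b|] /= hi sgi; last first.
      by exists 1 => // y Dy _ _; rewrite (lt_le_trans hi)// sgi.
    have [d /cdf_ccont hd] := hol b _ Dq.
    have [|r r0 hr] := hd (nrm (q.1 - sval b)^-1 - k); first by rewrite subr_gt0.
    exists r => // y Dy /hr y1 _; rewrite (lt_le_trans _ (sgi _ Dy))//.
    by have := nrmB_ge (q.1 - sval b)^-1 (y.1 - sval b)^-1; rewrite nrmBC; move: y1; clear; lra.
  + exists (nrm q.1 - k); rewrite ?subr_gt0// => y _ y1 _; apply/or3P; constructor 2.
    by have := nrmB_ge q.1 y.1; rewrite nrmBC /=; move: y1; clear; lra.
  + exists (nrm q.2 - k); rewrite ?subr_gt0// => y _ _ y2; apply/or3P; constructor 3.
    by have := nrmB_ge q.2 y.2; rewrite nrmBC /=; move: y2; clear; lra.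
- move=> k; exists [set z : C | nrm z <= k /\ forall b, ~ D b -> 1 <= k * nrm (z - b)]; split.
  + apply: (@closed_bounded_compact R _ k); last by move=> z [].
    apply: closed_eps => z hz; split.
      by apply/ler_addgt0Pr => e /hz[y [yk _]]; have := nrmB_ge z y; rewrite nrmBC; move: yk; clear; lra.
    move=> b Db'; apply/ler_addgt0Pr => e e0.
    have k1 : 0 < 1 + `|k| by rewrite ltr_pwDl.
    have [|y [_ /(_ b Db') yb] yz] := hz (e / (1 + `|k|)); first by rewrite divr_gt0.
    have h1 : k * (nrm (y - b) - nrm (z - b)) <= e.
      apply: le_trans (ler_norm _) _; rewrite normrM.
      apply: (@le_trans _ _ ((1 + `|k|) * nrm (y - z))).
        apply: ler_pM => //; first by rewrite lerDr.
        have h2 := nrm_tri y z b; have h3 := nrm_tri z y b; rewrite (nrmBC z y) in h3.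
        by rewrite ler_norml; apply/andP; split; move: h2 h3; clear; lra.
      by rewrite mulrC -ler_pdivlMr// ltW.
    by move: h1 yb; rewrite mulrBr; clear; lra.
  + move=> z [_ zb]; apply: contrapT => /zb.
    by rewrite subrr nrm0 mulr0 ler10.
  + move=> q Dq; rewrite !gt_max => /and3P[h1 h2 h3]; split=> //; split; first exact: ltW.
    move=> b Db'; have nz := Db q.1 (exist _ b Db') Dq.
    have n0 : 0 < nrm (q.1 - b) by rewrite nrm_gt0.
    rewrite -ler_pdivrMr// mul1r -nrmV -lee_fin; apply: le_trans (Sge (Some (exist _ b Db')) q.1) _.
    by rewrite SE// lee_fin ltW.
Qed.

Lemma psh_lt D s (k : R) : open D -> exhaustion D s -> open [set q | (D `*` [set: C]) q /\ s q < k].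
Proof.
move=> oD [[oW _ susc _] _ _]; rewrite openE => q [Wq sk].
have := susc q Wq k; rewrite lte_fin => /(_ sk).
have : nbhs q (D `*` [set: C]) by apply: open_nbhs_nbhs.
by rewrite /interior; apply: filterS2 => y Wy; rewrite lte_fin.
Qed.

(** A bounded function on {s < k} becomes global through a maximum with a steep affine function of
    [s], at the price of two units of [s]. *)
Lemma psh_truncation D s v (k M : R) : open D -> exhaustion D s ->
  psh [set q | (D `*` [set: C]) q /\ s q < k] (fun q => (v q)%:E) ->
  (forall q, D q.1 -> s q < k -> `|v q| <= M) ->
  exists v', psh (D `*` [set: C]) (fun q => (v' q)%:E) /\ forall q, D q.1 -> s q < k - 2 -> v' q = v q.
Proof.
move=> oD hs hv vM; have [ps os _] := hs.
(* The function B (s + 1 - k) exceeds B/2 > |M| for s > k - 1/2, so it takes over before the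
   boundary; for s < k - 2 it is below -B < -|M|. *)
pose B := 2 * `|M| + 1.
have B0 : 0 < B by rewrite ltr_wpDl// mulr_ge0.
pose w q := B * s q + B * (1 - k).
have pw : psh (D `*` [set: C]) (fun q => (w q)%:E).
  have oW := open_fst oD.
  exact: psh_ext (psh_add (psh_scale B0 ps) (psh_cst oW (ltry (B * (1 - k))))).
pose v' q := if s q < k then Num.max (v q) (w q) else w q.
exists v'; split; last first.
  move=> q Dq sk; rewrite /v' (lt_trans sk); last by rewrite gtrBl.
  apply/max_idPl; have := vM q Dq; rewrite (lt_trans sk) ?gtrBl// => /(_ isT).
  rewrite ler_norml => /andP[+ _].
  have : B * (s q + 1 - k) <= B * (-1) by rewrite ler_pM2l//; move: sk; clear; lra.
  by rewrite /w /B; have := ler_norm M; have := normr_ge0 M; move: (`|M|) => m; clear; lra.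
apply: psh_glue => [|q Wq]; first exact: open_fst.
have [sk|sk] := ltP (s q) k.
  exists [set q | (D `*` [set: C]) q /\ s q < k], (fun q => Order.max (v q)%:E (w q)%:E); split=> //.
    by apply: psh_maxr => //; apply: psh_sub pw; [exact: psh_lt|move=> y []].
  by move=> y [_ yk]; rewrite /v' yk EFin_max.
exists [set q | (D `*` [set: C]) q /\ k - 2^-1 < s q], (fun q => (w q)%:E); split.
- by split=> //; apply: lt_le_trans sk; rewrite gtrBl.
- by apply: psh_sub pw => // y [].
- move=> y [[Dy _] yk]; rewrite /v'; case: ifPn => // yk'; congr EFin; apply/max_idPr.
  have := vM y Dy yk'; rewrite ler_norml => /andP[_].
  have : B * 2^-1 <= B * (s y + 1 - k) by rewrite ler_pM2l//; move: yk; clear; lra.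
  by rewrite /w /B; have := ler_norm M; have := normr_ge0 M; move: (`|M|) => m; clear; lra.
Qed.

End Exhaustion.

(** * From local functions to one plurisubharmonic series *)

Section Peeling.
Context {R : realType}.
Local Notation C := (Cplx R).
Local Notation CC := (C * C)%type.
Implicit Types (q : CC) (E : set CC).
Variables (D : set C) (s : CC -> R).
Hypotheses (oD : open D) (hs : exhaustion D s).
Local Notation W := (D `*` [set: C]).

(* The partial sums plus 2^(1 - n) decrease on {s < m} from n = m on. *)
Lemma complete_pluripolar_series E (V : nat -> CC -> R) : E `<=` W ->
  (forall k, psh W (fun q => (V k q)%:E)) ->
  (forall k q, W q -> s q < k%:R -> V k q <= 2^-1 ^+ k) ->
  (forall q, E q -> exists K, forall k, (K <= k)%N -> V k q <= -1) ->
  (forall q, W q -> ~ E q -> exists K (c : R), forall k, (K <= k)%N -> - c * 2^-1 ^+ k <= V k q) ->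
  complete_pluripolar W E.
Proof.
move=> EW hV V1 V2 V3; split=> //; have oW := open_fst oD.
pose T n q := \sum_(k < n) V k q + 2 * 2^-1 ^+ n.
have TS n q : T n.+1 q = T n q + (V n q - 2^-1 ^+ n).
  by rewrite /T big_ord_recr exprS /=; field.
have hT n : psh W (fun q => (T n q)%:E).
  have h : psh W (fun q => (\sum_(k < n) V k q)%:E).
    elim: n => [|n IH]; first by apply: psh_ext (psh_cst oW (ltry 0)) => q _; rewrite big_ord0.
    by apply: psh_ext (psh_add IH (hV n)) => q _; rewrite big_ord_recr.
  exact: psh_ext (psh_add h (psh_cst oW (ltry (2 * 2^-1 ^+ n)))).
(* Only indices with s q < n enter, since [T] is known to decrease at [q] only from there; on {s <
   m} this is the decreasing limit of T (m + n). *)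
pose u q := ereal_inf [set (T n q)%:E | n in [set n | s q < n%:R]].
have ule n q : s q < n%:R -> (u q <= (T n q)%:E)%E by move=> sn; apply: ereal_inf_lbound; exists n.
have ex_n q (K : nat) : exists2 n, (K <= n)%N & s q < n%:R.
  exists (K + Num.bound `|s q|)%N; first exact: leq_addr.
  rewrite natrD ltr_wpDl//; apply: le_lt_trans (ler_norm _) _; exact: archi_boundP.
have hu : psh W u.
  apply: psh_glue => // q Wq; have [m _ sm] := ex_n q 0%N.
  exists [set q | W q /\ s q < m%:R], u; split=> //.
  have oV := @psh_lt R D s m%:R oD hs.
  apply: (@psh_lim R _ (fun n q => (T (m + n)%N q)%:E)) => //.
  - by move=> n; apply: psh_sub (hT (m + n)%N) => // y [].
  - move=> n y [Wy sy]; rewrite addnS TS lee_fin gerDl subr_le0; apply: V1 => //.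
    by apply: lt_le_trans sy _; rewrite ler_nat leq_addr.
  - by move=> n y [_ sy]; apply: ule; apply: lt_le_trans sy _; rewrite ler_nat leq_addr.
  - move=> y c [Wy sy] uc; apply: contrapT => hn; move: uc; rewrite ltNge => /negP; apply.
    apply: le_ereal_inf_tmp => _ [n sn <-]; rewrite lee_fin leNgt; apply/negP => hc; apply: hn.
    exists n; rewrite lte_fin; apply: le_lt_trans hc.
    rewrite addnC; elim: m {sm sy oV} => [|j IHj]; first by rewrite addn0.
    apply: le_trans IHj; rewrite addnS TS gerDl subr_le0 V1//.
    by apply: lt_le_trans sn _; rewrite ler_nat leq_addr.
exists u; split; first exact: psh_plurisubharmonic.
move=> q Wq; split=> [uq|Eq].
  apply: contrapT => nE; have [K [c hc]] := V3 q Wq nE.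
  pose c' := `|c| + 1; have c'0 : 0 <= c' by rewrite addr_ge0.
  (* The geometric tail still to be lost is subtracted in advance, so [L] increases from K on and
     bounds [T] below; the 1 in [c'] pays for the shrinking summand of [T]. *)
  pose L n := T n q - 2 * c' * 2^-1 ^+ n.
  have LS n : (K <= n)%N -> L n <= L n.+1.
    move=> Kn; rewrite /L TS exprS.
    have p0 : 0 <= 2^-1 ^+ n :> R by rewrite exprn_ge0// invr_ge0.
    have h1 := hc n Kn; have h2 : - c' * 2^-1 ^+ n <= V n q - 2^-1 ^+ n.
      rewrite lerBrDr; apply: le_trans h1.
      rewrite -[X in _ + X]mul1r -mulrDl ler_wpM2r// /c'; have := ler_norm c; clear -oD hs; lra.
    have -> : 2 * c' * (2^-1 * 2^-1 ^+ n) = c' * 2^-1 ^+ n by field.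
    by move: h2; rewrite mulNr; move: (2^-1 ^+ n) (V n q) => x y; clear -oD hs; lra.
  have LK n : (K <= n)%N -> L K <= L n.
    elim: n => [|n IH]; first by rewrite leqn0 => /eqP ->.
    rewrite leq_eqVlt => /predU1P[->//|]; rewrite ltnS => Kn.
    by apply: le_trans (IH Kn) _; exact: LS.
  have TL n : (K <= n)%N -> L K <= T n q.
    by move=> /LK /le_trans; apply; rewrite gerBl !mulr_ge0// exprn_ge0// invr_ge0.
  have TL' n : (n < K)%N -> - (\sum_(i < K) `|T i q|) <= T n q.
    move=> nK; rewrite lerNl; apply: le_trans (ler_norm _) _; rewrite normrN.
    by rewrite (bigD1 (Ordinal nK))//= lerDl sumr_ge0.
  have : ((Num.min (L K) (- (\sum_(i < K) `|T i q|)))%:E <= u q)%E.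
    apply: le_ereal_inf_tmp => _ [n _ <-]; rewrite lee_fin ge_min.
    by have [/TL ->|/TL' ->] := leqP K n; rewrite ?orbT.
  by rewrite uq leNgt ltNyr.
have [K hK] := V2 q Eq.
have TK n : T (K + n)%N q <= T K q - n%:R.
  elim: n => [|n IH]; first by rewrite addn0 subr0.
  rewrite addnS TS -natr1; have := hK (K + n)%N (leq_addr _ _).
  have : 0 <= 2^-1 ^+ (K + n) :> R by rewrite exprn_ge0// invr_ge0.
  by move: IH; clear -oD hs; lra.
apply/eqP; rewrite -leeNy_eq leNgt; apply/negP => uq.
have [n0 _ sn0] := ex_n q 0%N.
have uqE : u q = (fine (u q))%:E.
  by rewrite fineK// fin_real// uq; apply: le_lt_trans (ule n0 q sn0) (ltry _).
pose x := T K q - fine (u q).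
have [n nx sn] := ex_n q (K + Num.bound `|x|)%N.
have := ule n q sn; rewrite uqE lee_fin leNgt => /negP; apply.
rewrite -(subnKC (leq_trans (leq_addr _ _) nx : (K <= n)%N)); apply: le_lt_trans (TK _) _.
have : (Num.bound `|x|)%:R <= (n - K)%:R :> R by rewrite ler_nat leq_subRL// (leq_trans (leq_addr _ _) nx).
have h1 := archi_boundP (normr_ge0 x); have h2 := ler_norm x => h3.
by rewrite ltrBlDr addrC -ltrBlDr -/x; apply: le_lt_trans h2 (lt_le_trans h1 h3).
Qed.

Lemma psh_maximum (v : nat -> CC -> R) n : (forall j, psh W (fun q => (v j q)%:E)) ->
  exists V, psh W (fun q => (V q)%:E) /\ forall q,
    (forall j, (j <= n)%N -> v j q <= V q) /\ exists2 j, (j <= n)%N & V q = v j q.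
Proof.
move=> hv; elim: n => [|n [V [hV VE]]].
  by exists (v 0%N); split=> // q; split; [move=> j; rewrite leqn0 => /eqP ->|exists 0%N].
exists (fun q => Num.max (V q) (v n.+1 q)); split.
  by apply: psh_ext (psh_maxr hV (hv n.+1)) => q _; rewrite -EFin_max.
move=> q; have [h1 [j jn Vj]] := VE q; split.
  move=> i; rewrite leq_eqVlt => /predU1P[->|]; first by rewrite le_max lexx orbT.
  by rewrite ltnS => /h1 h; rewrite le_max h.
by case: leP => _; [exists n.+1|exists j; rewrite // ltnW].
Qed.

(** At step k the functions for j <= k, taken with one large [c], are joined by a maximum and
    scaled. A maximum keeps the bound -c on [Ek k], while a point of [G j] inherits the lower bound
    of its own j. It is essential that [M] is chosen before [c] and [L] before [k] and [c]. *)
Lemma complete_pluripolar_peeling E (Ek G : nat -> set CC) : E `<=` W ->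
  (forall q, E q -> exists K, forall k, (K <= k)%N -> Ek k q) ->
  (forall q, W q -> ~ E q -> exists j, G j q) ->
  (forall j, exists (M : nat -> R) (L : CC -> R), forall (k : nat) (c : R), 0 < c -> exists v : CC -> R,
    [/\ psh W (fun q => (v q)%:E), forall q, W q -> s q < k%:R -> v q <= M k,
        forall q, W q -> s q < k%:R -> Ek k q -> v q <= - c &
        forall q, W q -> s q < k%:R -> G j q -> - L q <= v q]) ->
  complete_pluripolar W E.
Proof.
move=> EW hEk hG H.
pose M j := sval (cid (H j)); pose L j := sval (cid (svalP (cid (H j)))).
have H' j k (c : R) : 0 < c -> exists v : CC -> R,
    [/\ psh W (fun q => (v q)%:E), forall q, W q -> s q < k%:R -> v q <= M j k,
        forall q, W q -> s q < k%:R -> Ek k q -> v q <= - c &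
        forall q, W q -> s q < k%:R -> G j q -> - L j q <= v q].
  exact: (svalP (cid (svalP (cid (H j))))).
pose M' k := \sum_(j < k.+1) `|M j k|.
have M'0 k : 0 <= M' k by apply: sumr_ge0.
(* The denominator makes each scaled term at most 2^-k, and c = 1 / al k turns -c into -1. *)
pose al k : R := 2^-1 ^+ k / (1 + M' k).
have al0 k : 0 < al k by rewrite divr_gt0 ?exprn_gt0 ?invr_gt0// ltr_pwDl.
have ale k : al k <= 2^-1 ^+ k.
  rewrite ler_pdivrMr ?ltr_pwDl// ler_peMr ?lerDl// exprn_ge0// invr_ge0//.
have ic k : 0 < (al k)^-1 by rewrite invr_gt0.
pose v k j := sval (cid (H' j k _ (ic k))).
have hv k j := svalP (cid (H' j k _ (ic k))).
have ex k := @psh_maximum (v k) k (fun j => let: And4 h _ _ _ := hv k j in h).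
pose V k := sval (cid (ex k)).
have hV k := svalP (cid (ex k)).
have ex_n q : exists n, s q < n%:R.
  by exists (Num.bound `|s q|); apply: le_lt_trans (ler_norm _) _; exact: archi_boundP.
have lt_s q n k : s q < n%:R -> (n <= k)%N -> s q < k%:R by move=> h nk; apply: lt_le_trans h _; rewrite ler_nat.
apply: (@complete_pluripolar_series E (fun k q => al k * V k q)) => //.
- by move=> k; have [h _] := hV k; exact: psh_ext (psh_scale (al0 k) h).
- move=> k q Wq sq; have [_ /(_ q)[_ [j jk Vj]]] := hV k.
  rewrite -/(V k) in Vj; rewrite Vj; have [_ /(_ q Wq sq) h _ _] := hv k j.
  apply: (@le_trans _ _ (al k * M' k)).
    rewrite ler_pM2l//; apply: le_trans h _; apply: le_trans (ler_norm _) _.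
    by rewrite /M' (bigD1 (Ordinal (jk : (j < k.+1)%N)))//= lerDl sumr_ge0.
  rewrite /al mulrAC -mulrA ler_piMr ?exprn_ge0 ?invr_ge0//.
  by rewrite ler_pdivrMr ?ltr_pwDl// mul1r lerDr.
- move=> q Eq; have [K hK] := hEk q Eq; have [n hn] := ex_n q.
  exists (maxn K n) => k; rewrite geq_max => /andP[/hK Ekq /(lt_s _ _ _ hn) sq].
  have [_ /(_ q)[_ [j jk Vj]]] := hV k; rewrite -/(V k) in Vj; rewrite Vj.
  have [_ _ /(_ q (EW q Eq) sq Ekq) h _] := hv k j.
  by rewrite -(mulfV (lt0r_neq0 (al0 k))) -mulrN ler_pM2l.
- move=> q Wq nE; have [j Gj] := hG q Wq nE; have [n hn] := ex_n q.
  exists (maxn j n), `|L j q| => k; rewrite geq_max => /andP[jk /(lt_s _ _ _ hn) sq].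
  have [_ /(_ q)[/(_ j jk) h _]] := hV k; rewrite -/(V k) in h.
  have [_ _ _ /(_ q Wq sq Gj) h2] := hv k j.
  apply: (@le_trans _ _ (al k * (- `|L j q|))).
    by rewrite mulNr mulrN lerN2 mulrC ler_wpM2l.
  rewrite ler_pM2l//; apply: le_trans h; apply: le_trans h2; rewrite lerN2; exact: ler_norm.
Qed.

End Peeling.

(** * Functions very negative on the graph and bounded below elsewhere *)

Section GraphApproximation.
Context {R : realType}.
Local Notation C := (Cplx R).
Local Notation CC := (C * C)%type.
Implicit Types (q : CC).

(** The bound is free of [e], so the coefficient of a logarithm can be chosen last without spoiling
    lower bounds. *)
Lemma mule_01_ge (e : R) (x : \bar R) : 0 < e <= 1 -> (Order.min 0 x <= e%:E * x)%E.
Proof.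
move=> /andP[e0 e1]; case: x => [x| |]; last first.
- by rewrite gt0_muleNy ?lte_fin// minC minNye.
- by rewrite gt0_muley ?lte_fin// leey.
- rewrite -EFin_min -EFinM lee_fin ge_min; have [x0|x0] := leP 0 x.
    by rewrite mulr_ge0// ltW.
  by apply/orP; right; rewrite ler_niMl// ltW.
Qed.

(* Near A, where H is very negative, use Psi, and elsewhere max (H + e log|w - f z|, Psi): for small e
   the two definitions agree near the boundary of {H < Psi - 1}.  Where Psi is not subharmonic, |f| is so
   large that the logarithm is positive and the maximum is its first argument. *)
Lemma graph_approximation (D A : set C) (f : C -> C) (s : CC -> R) (H : C -> \bar R) (Psi : C -> R) (k : R) :
  open D -> exhaustion D s -> open (D `\` A) ->
  (forall z, (D `\` A) z -> exists d, cdf f d z) -> SH D H -> (forall z, D z -> {for z, continuous Psi}) ->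
  (forall z, D z -> A z -> (H z < (Psi z - 1)%:E)%E) ->
  (forall z, D z -> (exists U, U z /\ SH U (fun z => (Psi z)%:E)) \/
    exists U, [/\ open U, U z & forall y, U y -> [/\ ~ A y, k + 3 < nrm (f y) & ((Psi y)%:E < H y)%E]]) ->
  exists v : CC -> R, psh (D `*` [set: C]) (fun q => (v q)%:E) /\
  forall q, D q.1 -> s q < k ->
  [/\ Psi q.1 <= v q, (A q.1 \/ q.2 = f q.1) -> v q = Psi q.1,
      ~ A q.1 -> (H q.1 + Order.min 0 (eln (nrm (q.2 - f q.1)%R)) <= (v q)%:E)%E &
      ((v q)%:E <= Order.max (Psi q.1)%:E (H q.1 + 1%:E))%E].
Proof.
move=> oD hs oDA hf sH cPsi HA hPsi.
pose O z := (H z < (Psi z - 1)%:E)%E; pose W := D `*` [set: C].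
(* The construction is done on {s < k + 2}, because [psh_truncation] preserves it only on {s <
   k}. *)
have [_ Hoo Husc _] := sH; have [_ _ /(_ (k + 2))[K [cK KD sK]]] := hs.
have oW := open_fst oD.
have Onear z : D z -> O z -> \forall y \near z, O y.
  move=> Dz Oz.
  have h : usc_on D (fun z => (H z + (- Psi z)%:E)%E).
    apply: usc_add => //; first by move=> y _; exact: ltry.
    apply: (@usc_cont R C D (fun y => - Psi y)) => y Dy.
    exact: (@continuousN _ _ _ Psi y (cPsi y Dy)).
  have := h z Dz (-1); rewrite lte_subRe => /(_ Oz).
  by apply: filterS => y; rewrite lte_subRe.
have fnear z : D z -> ~ A z -> \forall y \near z, ~ A y /\ nrm (f y) < nrm (f z) + 1.
  move=> Dz nA; have [d hd] := hf z (conj Dz nA).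
  have [r r0 hr] := cdf_ccont hd ltr01.
  have : nbhs z (D `\` A) by apply: open_nbhs_nbhs.
  have : nbhs z [set y : C | nrm (y - z) < r] by apply/nbhsCP; exists r.
  apply: filterS2 => y /= /hr yr [_ nAy]; split=> //.
  by have := nrmB_ge (f y) (f z); move: yr; clear; lra.
have OA z : D z -> ~ O z -> ~ A z by move=> Dz nO Az; apply: nO; exact: HA.
have [|z Kz|N hN] := @compact_unif_nat _ K (fun n z => O z \/ nrm (f z) < n%:R) cK.
- by move=> m n z mn [|h]; [left|right; apply: lt_le_trans h _; rewrite ler_nat].
- have Dz := KD _ Kz; have [Oz|nO] := boolP (H z < (Psi z - 1)%:E)%E.
    by exists 0%N; apply: filterS (Onear z Dz Oz) => y Oy; left.
  exists (Num.bound (nrm (f z) + 1)); apply: filterS (fnear z Dz (OA z Dz (negP nO))) => y [_ fy]; right.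
  by apply: lt_trans fy _; apply: archi_boundP; rewrite addr_ge0// nrm_ge0.
(* An upper bound of |w - f z| when s < k + 2 and |f z| < N + 1; so e log |w - f z| <= 1, just the
   gap between H and Psi on [O]. *)
pose X := `|k + 2| + N%:R + 1.
have X1 : 1 <= X by rewrite lerDr addr_ge0.
have lX : 0 <= ln X by rewrite ln_ge0.
pose e := (1 + ln X)^-1.
have e0 : 0 < e by rewrite invr_gt0 ltr_pwDl.
have e1 : e <= 1 by rewrite invf_le1 ?lerDl// ltr_pwDl.
have eX : e * ln X <= 1 by rewrite mulrC ler_pdivrMr ?mul1r ?lerDr// ltr_pwDl.
have eln_small z w : D z -> nrm w < k + 2 -> nrm (f z) < N%:R + 1 -> (e%:E * eln (nrm (w - f z)%R) <= 1%:E)%E.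
  move=> Dz wk fz; apply: (@le_trans _ _ (e%:E * (ln X)%:E)%E); last by rewrite -EFinM lee_fin.
  apply: lee_wpmul2l; first by rewrite lee_fin ltW.
  rewrite eln_le ?nrm_ge0// lnK ?posrE ?(lt_le_trans ltr01)//.
  apply: le_trans (nrmD _ _) _; rewrite nrmN /X; have := ler_norm (k + 2).
  by move: (`|k + 2|) wk fz => t; clear; lra.
pose G q := (H q.1 + e%:E * eln (nrm (q.2 - f q.1)%R))%E.
have pG : psh ((D `\` A) `*` [set: C]) G.
  apply: psh_add; last by apply: psh_scale => //; exact: psh_eln_graph.
  by apply: psh_fst; apply: SH_sub sH => // z [].
have G1 q : D q.1 -> nrm q.2 < k + 2 -> nrm (f q.1) < N%:R + 1 -> (G q <= H q.1 + 1%:E)%E.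
  by move=> Dq qk fq; apply: leeD2l; exact: eln_small.
have Goo q : D q.1 -> (G q < +oo)%E.
  move=> Dq; apply: adde_ltoo; first exact: Hoo.
  case: (eln _) (eln_ltoo (nrm (q.2 - f q.1)%R)) => [t _|//|_]; first by rewrite ltry.
  by rewrite gt0_muleNy ?lte_fin.
pose v0 q := if O q.1 then (Psi q.1)%:E else Order.max (G q) (Psi q.1)%:E.
have v0E q : D q.1 -> v0 q = (fine (v0 q))%:E.
  move=> Dq; rewrite fineK// /v0; case: ifPn => // _.
  by rewrite fin_real// lt_max ltNyr orbT gt_max Goo// ltry.
have v0max q : D q.1 -> nrm q.2 < k + 2 -> nrm (f q.1) < N%:R + 1 -> v0 q = Order.max (G q) (Psi q.1)%:E.
  move=> Dq qk fq; rewrite /v0; case: ifPn => // Oq; rewrite max_r//.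
  apply: le_trans (G1 q Dq qk fq) _; rewrite -leeBrDr// -EFinB.
  exact: ltW.
have pv0 : psh [set q | W q /\ s q < k + 2] (fun q => (fine (v0 q))%:E).
  have oV := @psh_lt R D s (k + 2) oD hs.
  apply: (@psh_ext R _ v0); first by move=> q [[Dq _] _]; exact: v0E.
  apply: psh_glue => // q [[Dq _] sq].
  have [Oq|nO] := boolP (H q.1 < (Psi q.1 - 1)%:E)%E.
    case: (hPsi _ Dq) => [[U [Uq sU]]|[U [_ Uq /(_ _ Uq)[_ _]]]]; last first.
      by move=> /lt_trans/(_ Oq); rewrite lte_fin ltNge gerBl ler01.
    have [oU _ _ _] := sU.
    exists ((U `&` (O : set C)°) `*` [set: C]), (fun q => (Psi q.1)%:E); split.
    + by split=> //; split=> //; exact: Onear.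
    + apply: (@psh_fst R _ (fun z => (Psi z)%:E)); apply: SH_sub sU; last by move=> z [].
      by apply: openI => //; exact: open_interior.
    + by move=> y [[_ /interior_subset Oy] _]; rewrite /v0 Oy.
  have nA := OA _ Dq (negP nO).
  have [Kq qk] := sK q Dq sq.
  have fN : nrm (f q.1) < N%:R by case: (hN _ Kq) => // /(negP nO).
  case: (hPsi _ Dq) => [[U [Uq sU]]|[U [oU Uq hU]]].
    have [oU _ _ _] := sU.
    (* Keeps |f| below N + 1 near the point, so that the maximum formula also describes [v0] at
       nearby points of [O]. *)
    pose B := [set z | ~ A z /\ nrm (f z) < nrm (f q.1) + 1]°.
    pose V := U `&` (D `\` A) `&` B.
    have oVV : open V by apply: openI; [exact: openI|exact: open_interior].
    exists ((V `*` [set: C]) `&` [set q | W q /\ s q < k + 2]), (fun q => Order.max (G q) (Psi q.1)%:E); split.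
    + by split; [split=> //; split; [|exact: fnear]|].
    + have oI : open ((V `*` [set: C]) `&` [set q | W q /\ s q < k + 2]) by apply: openI => //; exact: open_fst.
      apply: psh_maxr.
        by apply: psh_sub pG => // y [[[[_ Dy] _] _] _].
      by apply: psh_sub (psh_fst sU) => // y [[[[Uy _] _] _] _].
    + move=> y [[[_ /interior_subset[_ fy]] _] [[Dy _] sy]]; apply: v0max => //; first exact: (sK y Dy sy).2.
      by apply: lt_trans fy _; rewrite ltrD2r.
  exists (((U `&` (D `\` A)) `*` [set: C]) `&` [set q | W q /\ s q < k + 2]), G; split.
  + by split.
  + apply: psh_sub pG; last by move=> y [[[_ Dy] _] _].
    by apply: openI => //; apply: open_fst; exact: openI.
  + move=> y [[[Uy _] _] [[Dy _] sy]]; have [nAy fy hy] := hU _ Uy; rewrite /v0; case: ifPn => [Oy|_].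
      by have := lt_trans hy Oy; rewrite lte_fin ltNge gerBl ler01.
    apply: max_l; apply: le_trans (ltW hy) _; rewrite -[leLHS]adde0; apply: leeD2l.
    apply: mule_ge0; first by rewrite lee_fin ltW.
    (* The origin of k + 3: with |w| < k + 2 it leaves |w - f| >= 1. *)
    have [_ yk] := sK y Dy sy; have h := nrmB_ge (f y.1) y.2; rewrite nrmBC in h.
    have h1 : 1 <= nrm (y.2 - f y.1) by move: h yk fy; clear; lra.
    by rewrite /eln (lt_geF (lt_le_trans ltr01 h1)) lee_fin ln_ge0.
have v0_ge q : ((Psi q.1)%:E <= v0 q)%E by rewrite /v0; case: ifP => // _; rewrite le_max lexx orbT.
have v0_le q : D q.1 -> s q < k + 2 -> (v0 q <= Order.max (Psi q.1)%:E (H q.1 + 1%:E))%E.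
  move=> Dq sq; rewrite /v0; case: ifPn => [_|nO]; first by rewrite le_max lexx.
  have [Kq qk] := sK q Dq sq; rewrite ge_max !le_max lexx/= andbT G1 ?orbT//.
  by case: (hN _ Kq) => [/(negP nO)//|h]; apply: lt_trans h _; rewrite ltrDl.
have [M1 hM1] : exists M, forall z, K z -> ((Psi z)%:E < M%:E)%E.
  apply: usc_lt_bounded => //; first by move=> z _; exact: ltry.
  by apply: (@usc_cont R C K Psi) => z /KD; exact: cPsi.
have [M2 hM2] : exists M, forall z, K z -> ((- Psi z)%:E < M%:E)%E.
  apply: usc_lt_bounded => //; first by move=> z _; exact: ltry.
  apply: (@usc_cont R C K (fun y => - Psi y)) => y /KD Dy.
  exact: (@continuousN _ _ _ Psi y (cPsi y Dy)).
have [M3 hM3] : exists M : R, forall z, K z -> (H z < M%:E)%E.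
  by apply: usc_lt_bounded => //; [move=> z /KD; exact: Hoo|exact: usc_sub Husc].
have vM q : D q.1 -> s q < k + 2 -> `|fine (v0 q)| <= `|M1| + `|M2| + `|M3| + 1.
  move=> Dq sq; have [Kq _] := sK q Dq sq.
  have h1 := v0_ge q; rewrite v0E// lee_fin in h1.
  have h2 : fine (v0 q) <= Num.max M1 (M3 + 1).
    rewrite -lee_fin -v0E// EFin_max; apply: le_trans (v0_le q Dq sq) _.
    by apply: le_max2; [exact: ltW (hM1 _ Kq)|rewrite EFinD; apply: leeD2r; exact: ltW (hM3 _ Kq)].
  have h3 := hM2 _ Kq; rewrite lte_fin in h3.
  have := normr_ge0 M1; have := normr_ge0 M2; have := normr_ge0 M3.
  have := ler_norm M1; have := ler_norm M2; have := ler_norm M3.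
  rewrite le_max in h2; case/orP: h2 => h2; rewrite ler_norml; move: h1 h2 h3;
    move: (fine _) (Psi _) (`|M1|) (`|M2|) (`|M3|) => x1 x2 x3 x4 x5; clear => *; apply/andP; split; lra.
have [v [pv vv0]] := @psh_truncation R D s (fun q => fine (v0 q)) (k + 2) _ oD hs pv0 vM.
exists v; split=> // q Dq sk.
have sk2 : s q < k + 2 - 2 by rewrite addrK.
have sk' : s q < k + 2 by apply: lt_trans sk _; rewrite ltrDl.
rewrite vv0// -lee_fin -v0E//; split.
- exact: v0_ge.
- move=> h; apply: EFin_inj; rewrite -v0E// /v0; case: ifPn => // nO.
  case: h => [/(OA _ Dq (negP nO))//|h]; apply: max_r.
  rewrite /G h subrr nrm0 /eln lexx gt0_muleNy ?lte_fin// addeNy leNye//.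
- move=> nA; rewrite /v0; case: ifPn => [Oq|_].
    apply: (@le_trans _ _ (H q.1)); first by rewrite -[leRHS]adde0; apply: leeD2l; rewrite ge_min lexx.
    by apply: le_trans (ltW Oq) _; rewrite lee_fin gerBl.
  rewrite le_max; apply/orP; left; apply: leeD2l; apply: mule_01_ge.
  by rewrite e0.
- exact: v0_le.
Qed.

End GraphApproximation.

(** * Removable singularities and large values on small circles *)

Section RemovableSingularity.
Context {R : realType}.
Local Notation C := (Cplx R).
Local Notation "x %:C" := (real_complex _ x) (format "x %:C") : ring_scope.
Local Notation Re := (@complex.Re R).
Local Notation Im := (@complex.Im R).
Implicit Types (z w a : R[i]) (f g : R[i] -> R[i]).

(** Off 0 Cauchy's formula holds in spite of the puncture, and its right-hand side is holomorphic
    across 0. Real and imaginary parts of the boundary values are treated apart, after scaling to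
    the unit circle. *)
Lemma removable_singularity0 g (r : R) : 0 < r ->
  (forall w, 0 < nrm w <= r -> exists d, cdf g d w) -> bounded_near0 g ->
  exists F, (forall w, nrm w < r -> exists d, cdf F d w) /\ forall w, 0 < nrm w < r -> F w = g w.
Proof.
move=> r0 hg g0.
have gr w : nrm (w - 0) = r -> exists d, cdf g d w.
  by rewrite subr0 => wr; apply: hg; rewrite wr r0 lexx.
have [c1 c2] : tccont (fun t => g (circ_pt 0 r t)).
  by apply: tccont_circ; [exact: ltW|move=> z /gr[d]; exact: cdf_ccont].
have [M hM] : exists M : R, forall z : C, nrm (z - 0) = r -> ((nrm (g z))%:E < M%:E)%E.
  apply: (@usc_lt_bounded R C [set z : C | nrm (z - 0) = r]); first exact: (@compact_circle R 0 r).
    by move=> z _; exact: ltry.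
  apply: (@usc_cont R C [set z : C | nrm (z - 0) = r] (fun y => nrm (g y))) => z /gr[d].
  exact: cdf_nrm_cont.
have gM t : nrm (g (circ_pt 0 r t)) <= M.
  by apply/ltW; rewrite -lte_fin; apply: hM; rewrite nrm_circ ger0_norm// ltW.
pose p1 t := Re (g (circ_pt 0 r t)); pose p2 t := Im (g (circ_pt 0 r t)).
have hp1 t : `|p1 t| <= M by apply: le_trans (gM t); exact: Re_nrm.
have hp2 t : `|p2 t| <= M by apply: le_trans (gM t); exact: Im_nrm.
pose G (p : R -> R) x := cmean (fun t => (p t)%:C * (circ_pt 0 1 t / (circ_pt 0 1 t - x))).
pose I : R[i] := (0 +i* 1)%C.
exists (fun z => G p1 (r^-1%:C * z) + I * G p2 (r^-1%:C * z)).
have zr1 z : nrm z < r -> nrm (r^-1%:C * z) < 1.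
  by move=> zr; rewrite nrmM nrmr gtr0_norm ?invr_gt0// mulrC ltr_pdivrMr// mul1r.
split=> z zr.
  have z1 := zr1 z zr.
  have [d1 h1] := cauchy_integral_cdf c1 hp1 z1; have [d2 h2] := cauchy_integral_cdf c2 hp2 z1.
  have hz := cdfZ r^-1%:C (cdf_id z).
  eexists; apply: cdfD (cdf_comp hz h1) (cdfZ I (cdf_comp hz h2)).
have z1 := zr1 z (andP zr).2.
rewrite (cauchy_formula zr hg g0) /G.
have t1 := tccontM_real c1 (tccont_kernel z1); have t2 := tccontM_real c2 (tccont_kernel z1).
rewrite -(cmeanZ _ t2) -(cmeanD t1 (tccontZ I t2)); congr cmean; apply/funext => t.
rewrite mulrA -mulrDl; congr (_ * _).
  by rewrite /=; case: (g _) => x y; apply: complex_eq; rewrite /I /=; ring.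
have rC : r%:C != 0 by rewrite -nrm_gt0 nrmr normr_gt0 gt_eqF.
have w1 : circ_pt 0 1 t - r^-1%:C * z != 0 by apply: sub_nz; rewrite circ0_nrm.
have -> : circ_pt 0 r t = r%:C * circ_pt 0 1 t by rewrite [LHS]circ_scale add0r.
have rI : r^-1%:C = (r%:C)^-1 by rewrite fmorphV.
rewrite rI in w1 *; move: (circ_pt 0 1 t : R[i]) w1 => w w1.
have -> : r%:C * w - z = r%:C * (w - r%:C^-1 * z) by rewrite mulrBr mulVKf.
by rewrite invfM mulrACA mulfV// mul1r.
Qed.

(** Otherwise |f| <= M on arbitrarily small circles, and the singularity would be removable. *)
Lemma large_near_singularity f a (r : R) : 0 < r -> (forall z, 0 < nrm (z - a) <= r -> exists d, cdf f d z) ->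
  (forall F, (forall z, nrm (z - a) < r -> exists d, cdf F d z) ->
    ~ forall z, 0 < nrm (z - a) < r -> F z = f z) ->
  forall M : R, exists2 t0 : R, 0 < t0 &
    forall t : R, 0 < t < t0 -> exists2 e, nrm (e - a) = t & M < nrm (f e).
Proof.
move=> r0 hf hF M; apply: contrapT => hn.
have tr z d c : cdf f d (z + c) -> cdf (fun w => f (w + c)) (d * (1 + 0)) z.
  by move=> h; apply: cdf_comp (cdfD (cdf_id z) (cdf_cst c z)) h.
have [w wr||F [h1 h2]] := @removable_singularity0 (fun w => f (w + a)) r r0.
- have [|d hd] := hf (w + a); first by rewrite addrK.
  by exists (d * (1 + 0)); exact: tr.
- exists M => d d0; apply: contrapT => hd; apply: hn; exists d => // t td.
  apply: contrapT => he; apply: hd; exists t => // z zt; rewrite leNgt; apply/negP => hz.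
  by apply: he; exists (z + a); rewrite ?addrK.
apply: (hF (fun z => F (z - a))) => z zr; last by rewrite h2// subrK.
have [d hd] := h1 _ zr; eexists.
by apply: cdf_comp (cdfD (cdf_id z) (cdf_cst (- a) z)) hd.
Qed.

End RemovableSingularity.

(** * A uniform bound for sums of logarithms at equally spaced points *)

Section LogarithmicSum.
Context {R : realType}.
Implicit Types (x y u t : R).

Lemma oppr_ln_le y : 0 < y -> - ln y <= 2 / Num.sqrt y.
Proof.
move=> y0; have s0 : 0 < Num.sqrt y by rewrite sqrtr_gt0.
have lny : ln y = 2 * ln (Num.sqrt y).
  by rewrite -{1}(sqr_sqrtr (ltW y0)) lnXn// mulr_natl.
have : ln (Num.sqrt y)^-1 < (Num.sqrt y)^-1 by apply: ln_sublinear; rewrite invr_gt0.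
by rewrite lnV ?posrE// lny; clear; lra.
Qed.

(** The odd square root: one of the two terms vanishes, as [Num.sqrt] is 0 on negative numbers. It
    is a primitive of 1 / (2 sqrt |u|), so sums of 1 / sqrt |u| telescope against it. *)
Definition ssqrt u := Num.sqrt u - Num.sqrt (- u).

Lemma ssqrt_ge0 u : 0 <= u -> ssqrt u = Num.sqrt u.
Proof. by move=> u0; rewrite /ssqrt (@ler0_sqrtr _ (- u)) ?subr0// oppr_le0. Qed.

Lemma ssqrt_le0 u : u <= 0 -> ssqrt u = - Num.sqrt (- u).
Proof. by move=> u0; rewrite /ssqrt (ler0_sqrtr u0) sub0r. Qed.

Lemma ssqrt_add u t : 0 <= t -> ssqrt (u + t) - ssqrt u <= 2 * Num.sqrt t.
Proof.
move=> t0; have sD a : 0 <= a -> Num.sqrt (a + t) - Num.sqrt a <= Num.sqrt t.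
  move=> a0; rewrite lerBlDr -ler_sqr ?nnegrE ?addr_ge0 ?sqrtr_ge0//.
  rewrite sqrrD !sqr_sqrtr ?addr_ge0// addrAC addrC [t + a]addrC lerDr mulrn_wge0// mulr_ge0// sqrtr_ge0.
have st := sqrtr_ge0 t.
have [u0|u0] := leP 0 u.
  rewrite !ssqrt_ge0 ?addr_ge0//; apply: le_trans (sD u u0) _; move: st; clear; lra.
have [ut|ut] := leP 0 (u + t).
  rewrite (ssqrt_ge0 ut) (ssqrt_le0 (ltW u0)) opprK.
  have h1 : Num.sqrt (u + t) <= Num.sqrt t by rewrite ler_sqrt// gerDr ltW.
  have h2 : Num.sqrt (- u) <= Num.sqrt t by rewrite ler_sqrt//; move: ut; clear; lra.
  by move: h1 h2; clear; lra.
rewrite (ssqrt_le0 (ltW ut)) (ssqrt_le0 (ltW u0)).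
have := sD (- (u + t)); rewrite oppr_ge0 ltW// => /(_ isT).
by rewrite opprD subrK; move: st; clear; lra.
Qed.

(** With m = max(|u|, 1), the increment is 1 / (sqrt a + sqrt b) with sqrt a <= 2 sqrt m and sqrt b
    <= sqrt m, if 0 is not crossed; otherwise it is at least 1. *)
Lemma ssqrt_step u : (3 * Num.sqrt (Num.max `|u| 1))^-1 <= ssqrt (u + 1) - ssqrt u.
Proof.
set m := Num.max _ _.
have m1 : 1 <= m by rewrite le_max lexx orbT.
have um : `|u| <= m by rewrite le_max lexx.
have m0 : 0 <= m by apply: le_trans m1.
have sm : 1 <= Num.sqrt m by rewrite -sqrtr1 ler_sqrt.
have key a b : 0 <= b -> a = b + 1 -> a <= 4 * m -> b <= m ->
    (3 * Num.sqrt m)^-1 <= Num.sqrt a - Num.sqrt b.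
  move=> b0 ab am bm; have a0 : 0 <= a by rewrite ab addr_ge0.
  have sa : Num.sqrt a <= 2 * Num.sqrt m.
    by rewrite -[2]ger0_norm// -sqrtr_sqr -sqrtrM ?sqr_ge0// ler_sqrt ?mulr_ge0// expr2 -natrM.
  have sb : Num.sqrt b <= Num.sqrt m by rewrite ler_sqrt.
  have sab : Num.sqrt b < Num.sqrt a by rewrite ltr_sqrt ab ?ltrDl// ltr_wpDl.
  have d : (Num.sqrt a - Num.sqrt b) * (Num.sqrt a + Num.sqrt b) = 1.
    by rewrite -subr_sqr !sqr_sqrtr// ab addrC addKr.
  rewrite -[leLHS]mul1r ler_pdivrMr; last by rewrite mulr_gt0// (lt_le_trans ltr01).
  apply: (@le_trans _ _ ((Num.sqrt a - Num.sqrt b) * (Num.sqrt a + Num.sqrt b))); first by rewrite d.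
  rewrite ler_pM2l ?subr_gt0//; by move: sa sb; clear; lra.
have [u0|u0] := leP 0 u.
  rewrite !ssqrt_ge0 ?addr_ge0//; rewrite ger0_norm// in um.
  by apply: key => //; move: um m1; clear; lra.
have [u1|u1] := leP (u + 1) 0.
  rewrite !ssqrt_le0 ?(ltW u0)// opprK addrC; rewrite ltr0_norm// in um.
  apply: key => //; rewrite ?oppr_ge0//; first by ring.
    by move: um m0; clear; lra.
  by move: um; clear; lra.
rewrite (ssqrt_ge0 (ltW u1)) (ssqrt_le0 (ltW u0)) opprK.
apply: (@le_trans _ _ 1).
  rewrite invf_le1; first by move: sm; clear; lra.
  by rewrite mulr_gt0// (lt_le_trans ltr01).
have h1 := sqrtr_ge0 (u + 1); have h2 := sqrtr_ge0 (- u).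
rewrite -ler_sqr ?nnegrE ?addr_ge0// expr1n sqrrD (sqr_sqrtr (ltW u1)) sqr_sqrtr ?oppr_ge0 ?(ltW u0)//.
have := mulr_ge0 h1 h2; rewrite -mulr_natl; move: (_ * _) => p; clear; lra.
Qed.

(* Up to the factor 6 sqrt n each term is an increment of the signed square root at i - x. *)
Lemma log_sum_bound (n : nat) t x (y : nat -> R) : (0 < n)%N -> 0 < t -> - ln t <= Num.sqrt n%:R ->
  (forall i, (i < n)%N -> `|i%:R - x| <= n%:R * y i) ->
  \sum_(i < n) - ln (Num.max (y i) t) <= 12 * n%:R.
Proof.
move=> n0 t0 tn hy; have n0' : 0 < n%:R :> R by rewrite ltr0n.
set q := Num.sqrt n%:R in tn *; have q0 : 0 < q by rewrite sqrtr_gt0.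
have term i : (i < n)%N -> - ln (Num.max (y i) t) <= 6 * q * (ssqrt (i.+1%:R - x) - ssqrt (i%:R - x)).
  move=> iltn; set u := i%:R - x.
  have -> : i.+1%:R - x = u + 1 by rewrite -natr1 /u; ring.
  have m0 : 0 < Num.max (y i) t by rewrite lt_max t0 orbT.
  apply: (@le_trans _ _ (6 * q * (3 * Num.sqrt (Num.max `|u| 1))^-1)); last first.
    by rewrite ler_pM2l ?mulr_gt0//; exact: ssqrt_step.
  have -> : 6 * q * (3 * Num.sqrt (Num.max `|u| 1))^-1 = 2 * q / Num.sqrt (Num.max `|u| 1).
    have : 0 < Num.sqrt (Num.max `|u| 1) by rewrite sqrtr_gt0 lt_max ltr01 orbT.
    by move=> s0; field; rewrite gt_eqF.
  (* Indices within distance 1 of [x] rely on the cap: there -ln t <= sqrt n. For the others -ln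
     (|u| / n) <= 2 sqrt (n / |u|). *)
  have [u1|u1] := leP 1 `|u|; last first.
    rewrite sqrtr1 divr1; apply: (@le_trans _ _ (- ln t)).
      by rewrite lerN2 ler_ln ?posrE// le_max lexx orbT.
    by apply: le_trans tn _; rewrite ler_peMl ?ltW// ltr1n.
  have u0 : 0 < `|u| by apply: lt_le_trans u1.
  have un0 : 0 < `|u| / n%:R by rewrite divr_gt0.
  apply: (@le_trans _ _ (- ln (`|u| / n%:R))).
    rewrite lerN2 ler_ln ?posrE// le_max; apply/orP; left.
    by rewrite ler_pdivrMr// mulrC hy.
  apply: le_trans (oppr_ln_le un0) _.
  have s1 : 0 < Num.sqrt `|u| by rewrite sqrtr_gt0.
  rewrite sqrtrM// sqrtrV; last exact: ltW.
  rewrite -/q (_ : 2 / (Num.sqrt `|u| / q) = 2 * q / Num.sqrt `|u|)//.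
  by field; rewrite !gt_eqF.
apply: (@le_trans _ _ (\sum_(i < n) 6 * q * (ssqrt (i.+1%:R - x) - ssqrt (i%:R - x)))).
  by apply: ler_sum => i _; exact: term.
rewrite -mulr_sumr -(big_mkord xpredT (fun i => ssqrt (i.+1%:R - x) - ssqrt (i%:R - x))).
rewrite (@telescope_sumr _ _ _ (fun i => ssqrt (i%:R - x)))// sub0r.
have -> : n%:R - x = - x + n%:R by rewrite addrC.
apply: (@le_trans _ _ (6 * q * (2 * q))).
  by rewrite ler_pM2l ?mulr_gt0//; apply: ssqrt_add; rewrite ltW.
have qq : q * q = n%:R by rewrite -expr2 sqr_sqrtr// ltW.
by rewrite -qq (_ : 6 * q * (2 * q) = 12 * (q * q))//; ring.
Qed.

End LogarithmicSum.

(** * The barrier at an isolated singularity *)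

Section Barrier.
Context {R : realType}.
Local Notation C := (Cplx R).
Local Notation "x %:C" := (real_complex _ x) (format "x %:C") : ring_scope.
Implicit Types (z a e : R[i]) (f : R[i] -> R[i]) (u v : C -> R).

Definition locally_SH u (z : C) := exists U, U z /\ SH U (fun y => (u y)%:E).

Lemma locally_SH_cst (c : R) z : locally_SH (fun=> c) z.
Proof. by exists setT; split=> //; apply: SH_cst; [exact: openT|exact: ltry]. Qed.

Lemma locally_SH_add u v z : locally_SH u z -> locally_SH v z -> locally_SH (fun y => u y + v y) z.
Proof.
move=> [U [Uz su]] [V [Vz sv]]; have [oU _ _ _] := su; have [oV _ _ _] := sv.
exists (U `&` V); split=> //; have oI := openI oU oV.
by apply: SH_ext (SH_add (SH_sub oI _ su) (SH_sub oI _ sv)) => [y _ //|y []|y []].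
Qed.

Lemma locally_SH_sum (n : nat) (us : nat -> C -> R) z :
  (forall i, (i < n)%N -> locally_SH (us i) z) -> locally_SH (fun y => \sum_(i < n) us i y) z.
Proof.
elim: n => [|n IH] h.
  have [U [Uz sU]] := locally_SH_cst 0 z; exists U; split=> //.
  by apply: SH_ext sU => y _; rewrite big_ord0.
have [U [Uz sU]] := locally_SH_add (IH (fun i il => h i (ltnW il))) (h n (ltnSn n)).
by exists U; split=> //; apply: SH_ext sU => y _; rewrite big_ord_recr.
Qed.

Lemma locally_SH_scale u z (k : R) : 0 < k -> locally_SH u z -> locally_SH (fun y => k * u y) z.
Proof.
move=> k0 [U [Uz su]]; exists U; split=> //.
by apply: SH_ext (SH_scale k0 su) => y _; rewrite EFinM.
Qed.

Lemma locally_SH_maxr u v z : locally_SH u z -> locally_SH v z -> locally_SH (fun y => Num.max (u y) (v y)) z.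
Proof.
move=> [U [Uz su]] [V [Vz sv]]; have [oU _ _ _] := su; have [oV _ _ _] := sv.
exists (U `&` V); split=> //; have oI := openI oU oV.
by apply: SH_ext (SH_maxr (SH_sub oI _ su) (SH_sub oI _ sv)) => [y _|y []|y []] //; rewrite EFin_max.
Qed.

(** Minus the logarithm of the distance to [e] in units of [s], capped at -ln t. It is harmonic for
    |z - e| > t s, so subharmonicity can only fail on the small closed disc around [e]. *)
Definition cap_log (s t : R) e (z : C) : R := - ln (Num.max (nrm (z - e) / s) t).

Lemma cap_log_continuous (s t : R) e : 0 < t -> continuous (cap_log s t e).
Proof.
move=> t0 z; have m0 : 0 < Num.max (nrm (z - e) / s) t by rewrite lt_max t0 orbT.
apply: (@continuousN _ _ _ (fun y : C => ln (Num.max (nrm (y - e) / s) t)) z).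
apply: (@continuous_comp _ _ _ (fun y : C => Num.max (nrm (y - e) / s) t) (@ln R)); last exact: continuous_ln.
apply: (@continuous_max R C (fun y : C => nrm (y - e) / s) (fun=> t)); last exact: cst_continuous.
apply: (@continuousM _ _ (fun y : C => nrm (y - e)) (fun=> s^-1)); last exact: cst_continuous.
exact: cdf_nrm_cont (cdfD (cdf_id z) (cdf_cst (- e) z)).
Qed.

Lemma cap_log_SH (s t : R) e z : 0 < s -> 0 < t -> t * s < nrm (z - e) -> locally_SH (cap_log s t e) z.
Proof.
move=> s0 t0 ze; have oU : open [set y : C | t * s < nrm (y - e)].
  apply/openCP => y /= ye; exists (nrm (y - e) - t * s); first by rewrite subr_gt0.
  by move=> x; have := nrm_tri y x e; rewrite (nrmBC y x); move: (t * s) => ts; clear; lra.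
exists [set y : C | t * s < nrm (y - e)]; split=> //.
have ne y : t * s < nrm (y - e) -> y - e != 0.
  by move=> ye; rewrite -nrm_gt0 (lt_trans _ ye)// mulr_gt0.
apply: SH_ext (SH_eln (h := fun y => s%:C * (y - e)^-1) oU _).
- move=> y /= ye; have n0 : 0 < nrm (y - e) by rewrite nrm_gt0 ne.
  rewrite nrmM nrmr nrmV gtr0_norm// /eln lt_geF ?divr_gt0//; congr EFin.
  rewrite /cap_log max_l; last by rewrite ler_pdivlMr// ltW.
  by rewrite -lnV ?posrE ?divr_gt0// invf_div.
- move=> y ye; eexists; apply: cdfZ; apply: (cdf_comp (cdfD (cdf_id y) (cdf_cst (- e) y))).
  exact: cdf_inv (ne y ye).
Qed.

(* The equilibrium measure of {|f| > M} near a is replaced by n equal masses at points e_i with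
   |e_i - a| = s (1 + i/n), where |f| is large.  Projecting the e_i to an interval bounds the
   potential from above uniformly in n, and it is bounded below at a, while far from a it is
   very negative after subtracting - log s. *)
Lemma barrier f a (r dl M c : R) : 0 < r -> (forall z, 0 < nrm (z - a) <= r -> exists d, cdf f d z) ->
  (exists2 t0 : R, 0 < t0 & forall t : R, 0 < t < t0 -> exists2 e, nrm (e - a) = t & M + 1 < nrm (f e)) ->
  0 < dl -> 0 < c ->
  exists (Q : C -> R) (rho : R), [/\ 0 < rho, continuous Q,
    (forall z, Q z <= 0) /\ -1 <= Q a,
    (forall z, dl <= nrm (z - a) -> Q z <= - c) &
    (forall z, [\/ nrm (z - a) < rho, dl <= nrm (z - a) | nrm (f z) <= M] -> locally_SH Q z)].
Proof.
move=> r0 hf [t0 t00 ht] d0 c0.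
(* The mean potential must be at most -13 c far from [a], since [Q] divides it by 13; [2 s <= dl X]
   will achieve this. *)
pose X := expR (- (13 * c)); have X0 : 0 < X by exact: expR_gt0.
have [s [s0 st sr sd sX]] : exists s : R, [/\ 0 < s, 2 * s < t0, 2 * s <= r, 4 * s <= dl & 2 * s <= dl * X].
  exists (Num.min (t0 / 4) (Num.min (r / 2) (Num.min (dl / 4) (dl * X / 2)))).
  set m1 := Num.min (dl / 4) _; set m2 := Num.min (r / 2) _; set m3 := Num.min _ _.
  have a1 : 0 < m1 by rewrite lt_min !divr_gt0// mulr_gt0.
  have a2 : 0 < m2 by rewrite lt_min a1 divr_gt0.
  have a3 : 0 < m3 by rewrite lt_min a2 divr_gt0.
  have b1 : m1 <= dl / 4 by rewrite ge_min lexx.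
  have b2 : m1 <= dl * X / 2 by rewrite ge_min lexx orbT.
  have b3 : m2 <= r / 2 by rewrite ge_min lexx.
  have b4 : m2 <= m1 by rewrite ge_min lexx orbT.
  have b5 : m3 <= t0 / 4 by rewrite ge_min lexx.
  have b6 : m3 <= m2 by rewrite ge_min lexx orbT.
  clearbody m3; clearbody m2; clearbody m1.
  by split=> //; move: t00 a3 b1 b2 b3 b4 b5 b6; clear; lra.
pose K := [set z : C | s <= nrm (z - a) <= 2 * s].
have cK : compact K.
  apply: (@closed_bounded_compact R _ (nrm a + 2 * s)).
    apply: closed_eps => z hz; apply/andP; split; apply/ler_addgt0Pr => e /hz[y /andP[y1 y2] yz].
      by apply: le_trans y1 _; have := nrm_tri y z a; move: yz; clear; lra.
    apply: le_trans (nrm_tri z y a) _; rewrite (nrmBC z y); move: y2 yz; clear; lra.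
  by move=> z /andP[_ za]; have := nrmB_ge z a; move: za; clear; lra.
have [|dd dd0 hdd] := @ccont_unif R K f cK _ 1 ltr01.
  move=> z /andP[z1 z2]; have [|d hd] := hf z; last exact: cdf_ccont hd.
  by rewrite (lt_le_trans s0 z1) (le_trans z2 sr).
(* The discs |z - e i| <= t s must stay at distance at least s/2 from [a], whence 1/2, and inside
   {|f| > M}, whence the modulus of continuity [dd]. Only afterwards is [n] chosen, with -ln t <=
   sqrt n. *)
pose t := Num.min 2^-1 (dd / (2 * s)).
have tt0 : 0 < t by rewrite lt_min invr_gt0 ltr0n divr_gt0// mulr_gt0.
have t12 : t <= 2^-1 by rewrite ge_min lexx.
have tdd : t * s < dd.
  apply: (@le_lt_trans _ _ (dd / (2 * s) * s)); first by rewrite ler_pM2r// ge_min lexx orbT.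
  by rewrite (_ : dd / (2 * s) * s = dd / 2) ?ltr_pdivrMr ?ltr_pMr ?ltr1n//; field; rewrite gt_eqF.
pose n := (Num.bound ((ln t) ^+ 2)).+1.
have n0' : 0 < n%:R :> R by rewrite ltr0n.
have tn : - ln t <= Num.sqrt n%:R.
  apply: (le_trans (ler_norm _)); rewrite normrN -sqrtr_sqr ler_sqrt ?(ltW n0')//.
  apply: ltW; apply: lt_trans (archi_boundP (sqr_ge0 _)) _.
  by rewrite ltr_nat.
pose ti (i : nat) : R := s * (1 + i%:R / n%:R).
have ti1 i : s <= ti i by rewrite /ti ler_peMr ?(ltW s0)// lerDl divr_ge0.
have ti2 i : (i < n)%N -> ti i <= 2 * s.
  move=> il; rewrite /ti mulrC ler_pM2r// (_ : 2 = 1 + 1 :> R)// lerD2l ler_pdivrMr// mul1r ler_nat.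
  exact: ltnW.
have exe i : exists e, (i < n)%N -> nrm (e - a) = ti i /\ M + 1 < nrm (f e).
  have [il|il] := ltnP i n; last by exists 0.
  have [|e e1 e2] := ht (ti i); last by exists e.
  by rewrite (lt_le_trans s0 (ti1 i)) (le_lt_trans (ti2 i il) st).
pose e i := sval (cid (exe i)).
have he i : (i < n)%N -> nrm (e i - a) = ti i /\ M + 1 < nrm (f (e i)).
  exact: svalP (cid (exe i)).
pose P z := \sum_(i < n) cap_log s t (e i) z.
(* P / n is at most 12 everywhere and at least -1 at [a], so Q <= 0 and Q a >= -13 / 13. *)
pose Q z := 13^-1 * (n%:R^-1 * P z + (- 12)).
have Pub z : P z <= 12 * n%:R.
  (* In the coordinate n (|z - a| / s - 1) the point [e i] has position i, and |z - e i| dominates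
     the difference of the distances to [a]. *)
  apply: (@log_sum_bound R n t (n%:R * (nrm (z - a) / s - 1)) (fun i => nrm (z - e i) / s)) => // i il.
  have [ei _] := he i il.
  have -> : i%:R - n%:R * (nrm (z - a) / s - 1) = n%:R / s * (ti i - nrm (z - a)).
    by rewrite /ti; field; rewrite !gt_eqF.
  have ns : 0 < n%:R / s by rewrite divr_gt0.
  rewrite (_ : n%:R * (nrm (z - e i) / s) = n%:R / s * nrm (z - e i)); last by ring.
  rewrite normrM (gtr0_norm ns) ler_pM2l// -ei ler_norml.
  have h1 := nrm_tri (e i) z a; have h2 := nrm_tri z (e i) a; rewrite (nrmBC (e i) z) in h1.
  by apply/andP; split; move: h1 h2; clear; lra.
have Pbound z (k : R) : (forall i, (i < n)%N -> cap_log s t (e i) z <= k) -> P z <= k * n%:R.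
  move=> h; apply: (@le_trans _ _ (\sum_(i < n) k)); first by apply: ler_sum => i _; exact: h.
  by rewrite sumr_const card_ord mulr_natr.
exists Q, (s / 2).
have QE (k : R) z : P z <= k * n%:R -> Q z <= 13^-1 * (k - 12).
  by move=> h; rewrite /Q ler_pM2l ?invr_gt0// lerD2r mulrC ler_pdivrMr.
have lnX : ln X = - (13 * c) by rewrite /X expRK.
split.
- by rewrite divr_gt0.
- move=> z.
  apply: (@continuousM R C (fun=> 13^-1) (fun y : C => n%:R^-1 * P y + (- 12)) z); first exact: cst_continuous.
  apply: (@continuousD _ _ _ (fun y : C => n%:R^-1 * P y) (fun=> - 12) z); last exact: cst_continuous.
  apply: (@continuousM R C (fun=> n%:R^-1) (P : C -> R) z); first exact: cst_continuous.
  rewrite /P; elim: (n) => [|m IH].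
    by rewrite (_ : (fun y => _) = fun=> 0); [exact: cst_continuous|apply/funext => y; rewrite big_ord0].
  rewrite (_ : (fun y => _) = fun y => \sum_(i < m) cap_log s t (e i) y + cap_log s t (e m) y); last first.
    by apply/funext => y; rewrite big_ord_recr.
  apply: (@continuousD _ _ _ (fun y : C => \sum_(i < m) cap_log s t (e i) y) (cap_log s t (e m)) z) => //.
  exact: cap_log_continuous.
- split=> [z|].
    by apply: le_trans (QE 12 z (Pub z)) _; rewrite subrr mulr0.
  have : - 1 * n%:R <= P a.
    rewrite -[n in X in X <= _](card_ord n) mulr_natr -sumr_const; apply: ler_sum => i _.
    have [ei _] := he i (ltn_ord i).
    have m0 : 0 < Num.max (nrm (a - e i) / s) t by rewrite lt_max tt0 orbT.
    rewrite lerN2; apply: (@le_trans _ _ (Num.max (nrm (a - e i) / s) t - 1)).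
      by have := @le_ln1Dx R (Num.max (nrm (a - e i) / s) t - 1); rewrite (addrC 1) subrK; apply; rewrite ltrBrDl subrr.
    rewrite lerBlDr ge_max; apply/andP; split; last by apply: le_trans t12 _; clear; lra.
    by rewrite nrmBC ei ler_pdivrMr// ti2.
  rewrite /Q -ler_pdivlMr// mulrC => h; move: h; move: (n%:R^-1 * _) => x; clear; lra.
- move=> z zd; apply: le_trans (QE (- (13 * c)) z _) _; last by move: c0; clear; lra.
  apply: Pbound => i il; have [ei _] := he i il.
  rewrite -lnX lerNl -lnV ?posrE// ler_ln ?posrE ?invr_gt0 ?lt_max ?tt0 ?orbT// le_max; apply/orP; left.
  rewrite ler_pdivlMr// mulrC ler_pdivrMr//.
  have h1 := nrm_tri z (e i) a; rewrite ei in h1; have h2 := ti2 i il.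
  apply: (@le_trans _ _ (dl * X / 2)); first by move: sX; clear; lra.
  rewrite mulrAC ler_pM2r//; move: h1 h2 sd zd; clear; lra.
- move=> z hz; apply: locally_SH_scale; first by rewrite invr_gt0.
  apply: locally_SH_add; last exact: locally_SH_cst.
  apply: locally_SH_scale; first by rewrite invr_gt0.
  apply: (@locally_SH_sum n (fun i => cap_log s t (e i)) z) => i il; apply: cap_log_SH => //.
  have [ei fi] := he i il; have h1 := ti1 i; have h2 := ti2 i il.
  have h3 := nrm_tri (e i) z a; have h4 := nrm_tri z (e i) a; rewrite (nrmBC (e i) z) ei in h3 h4.
  have ts : t * s <= s / 2 by rewrite mulrC ler_pM2l.
  case: hz => [z1|z1|z1].
  + by move: h1 h3 z1 ts; move: (t * s) => x; clear; lra.
  + by move: s0 h2 h4 z1 sd ts; move: (t * s) => x; clear; lra.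
  + rewrite ltNge; apply/negP => ze.
    have Ke : K (e i) by rewrite /K /= ei h1 h2.
    have := hdd _ Ke z (le_lt_trans ze tdd); have := nrmB_ge (f (e i)) (f z).
    by rewrite (nrmBC (f (e i))); move: fi z1; clear; lra.
Qed.

End Barrier.

(** * The functions attached to a disc containing at most one point of A *)

Section GoodDisc.
Context {R : realType}.
Local Notation C := (Cplx R).
Local Notation CC := (C * C)%type.
Implicit Types (q : CC) (z a b : R[i]) (D A : set C) (f : R[i] -> R[i]) (s : CC -> R).

Definition graph_set D A (A2 : set C) f : set CC := graph_over D A f `|` (A2 `*` [set: C]).

(** The part of the set on which -c can be attained at step k: graph points too close to [A] are
    postponed to later steps. *)
Definition far_graph D A (A2 : set C) f (k : nat) q :=
  graph_set D A A2 f q /\ (A2 q.1 \/ forall a, A a -> 2^-1 ^+ k <= nrm (q.1 - a)).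

(** The point [a] may lie outside [A], and then the large disc misses [A]. Why 7: the modification
    takes place on a disc of radius 6 r whose centre is within r of [b], and its half, of radius 3
    r, covers the disc of radius 2 r about [b]. *)
Definition good_disc D A (A2 : set C) b (r : R) := 0 < r /\ exists2 a, nrm (a - b) < r &
  forall z, nrm (z - b) < 7 * r -> D z /\ (A z -> z = a /\ ~ A2 a).

Definition not_extendable D A (A2 : set C) f := forall a (r : R) F, A a -> ~ A2 a -> 0 < r ->
  (forall z, nrm (z - a) < r -> D z /\ (A z -> z = a)) ->
  (forall z, nrm (z - a) < r -> exists d, cdf F d z) ->
  ~ forall z, 0 < nrm (z - a) < r -> F z = f z.

Lemma eln_min_ge (y : R) : 0 < y -> ((- `|ln y|)%:E <= Order.min 0 (eln y))%E.
Proof.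
move=> y0; rewrite /eln (lt_geF y0) le_min !lee_fin oppr_le0 normr_ge0 /=.
by rewrite lerNl; have := ler_norm (- ln y); rewrite normrN.
Qed.

(** An upper bound free of [k]: the level bounds can be fixed before the coefficient of log |z -
    a|. *)
Lemma scale_eln_le (k y : R) : 0 < k <= 1 -> 0 <= y -> (k%:E * eln y <= y%:E)%E.
Proof.
move=> /andP[k0 k1]; rewrite le_eqVlt => /predU1P[<-|y0].
  by rewrite /eln lexx gt0_muleNy ?lte_fin// leNye.
rewrite /eln (lt_geF y0) -EFinM lee_fin.
have [l0|l0] := leP (ln y) 0; first by apply: le_trans (ltW y0); rewrite mulr_ge0_le0// ltW.
by apply: (@le_trans _ _ (ln y)); [rewrite ler_piMl// ltW|exact/ltW/ln_sublinear].
Qed.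

Lemma SH_exhaustion_bound D s (H : C -> \bar R) : exhaustion D s -> SH D H ->
  exists M : nat -> R, forall k q, D q.1 -> s q < k%:R -> (H q.1 <= (M k)%:E)%E.
Proof.
move=> [_ _ sK] [_ Hoo Husc _].
suff h k : exists M : R, forall q, D q.1 -> s q < k%:R -> (H q.1 <= M%:E)%E.
  by exists (fun k => sval (cid (h k))) => k; exact: (svalP (cid (h k))).
have [K [cK KD hK]] := sK k%:R.
have [M hM] := usc_lt_bounded cK (fun z Kz => Hoo z (KD z Kz)) (usc_sub KD Husc).
by exists M => q Dq sq; apply/ltW/hM; have [] := hK q Dq sq.
Qed.

Lemma good_disc_potential D A (A2 : set C) (u : C -> \bar R) (z1 b : C) (r : R) : open D ->
  SH setT u -> (-oo < u z1)%E -> (forall z, A z -> u z = -oo%E) -> good_disc D A A2 b r ->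
  exists (H : C -> \bar R) (m : R), [/\ SH D H, 0 <= m,
    forall z, A z -> 7 * r <= nrm (z - b) -> H z = -oo%E &
    forall z, nrm (z - b) < 2 * r -> ((- m)%:E <= H z)%E].
Proof.
move=> oD su uz1 uA [r0 _].
have [c0 c0b uc0] := SH_finite_dense su uz1 b r0.
have r6 : 0 < 6 * r by rewrite mulr_gt0.
have [u' [su' uu' u'u [m hm]]] := poisson_modification su uc0 r6.
exists u', `|m|; split=> //; first exact: SH_sub su'.
- move=> z Az z7; rewrite u'u ?uA//.
  by have := nrm_tri z c0 b; move: z7 c0b; clear; lra.
- move=> z zb; apply: (@le_trans _ _ (- m)%:E); first by rewrite lee_fin lerN2 ler_norm.
  by apply: hm; have := nrm_tri z b c0; rewrite (nrmBC b); move: zb c0b; clear; lra.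
Qed.

Lemma good_disc_peel D A (A2 : set C) f s (u : C -> \bar R) (z1 b : C) (r : R) :
  open D -> exhaustion D s -> open (D `\` A) ->
  (forall z, (D `\` A) z -> exists d, cdf f d z) -> A2 `<=` A -> A `<=` D ->
  SH setT u -> (-oo < u z1)%E -> (forall z, A z -> u z = -oo%E) ->
  not_extendable D A A2 f -> good_disc D A A2 b r ->
  exists (M : nat -> R) (L : CC -> R), forall (k : nat) (c : R), 0 < c -> exists v : CC -> R,
    [/\ psh (D `*` [set: C]) (fun q => (v q)%:E),
        forall q, (D `*` [set: C]) q -> s q < k%:R -> v q <= M k,
        forall q, (D `*` [set: C]) q -> s q < k%:R -> far_graph D A A2 f k q -> v q <= - c &
        forall q, (D `*` [set: C]) q -> s q < k%:R -> nrm (q.1 - b) < r /\ ~ graph_set D A A2 f q -> - L q <= v q].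
Proof.
move=> oD hs oDA hf A2A AD su uz1 uA hne hgood.
have [H [m [sH m0 HA Hm]]] := good_disc_potential oD su uz1 uA hgood.
have [r0 [a ab hab]] := hgood.
have r7 : r <= 7 * r by rewrite ler_peMl ?(ltW r0)// ler1n.
have br z : nrm (z - b) < r -> nrm (z - b) < 7 * r by move=> h; apply: lt_le_trans h r7.
have az z : nrm (z - a) <= r -> nrm (z - b) < 2 * r.
  by have := nrm_tri z a b; move: ab; clear; lra.
have r27 : 2 * r < 7 * r by rewrite ltr_pM2r// ltr_nat.
have A7 z : A z -> z <> a -> 7 * r <= nrm (z - b).
  by move=> Az za; rewrite leNgt; apply/negP => /hab[_ /(_ Az)[]].
have nE q : D q.1 -> ~ A q.1 -> ~ graph_set D A A2 f q -> 0 < nrm (q.2 - f q.1).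
  move=> Dq nA hq; rewrite nrm_gt0; apply/negP => /eqP/subr0_eq h; apply: hq; left; split=> //; split=> //.
have graphE q : graph_set D A A2 f q -> A q.1 \/ q.2 = f q.1.
  by move=> [[_ ?]|[/A2A ? _]]; [right|left].
(* If [a] is not in [A], the disc of radius 7 r misses [A], and the constant -c serves as
   barrier. *)
have [Aa|nAa] := pselect (A a); last first.
  have [M hM] := SH_exhaustion_bound hs sH.
  exists (fun k => `|M k| + 1), (fun q => m + `|ln (nrm (q.2 - f q.1))|) => k c c0.
  have [|z Dz Az|z Dz|v [pv hv]] := @graph_approximation R D A f s H (fun=> - c) k%:R oD hs oDA hf sH.
  - by move=> z _; exact: cst_continuous.
  - by rewrite HA ?ltNyr// A7// => za; apply: nAa; rewrite -za.
  - left; exact: locally_SH_cst.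
  exists v; split=> // q [Dq _] sq; have [v1 v2 v3 v4] := hv q Dq sq.
  - rewrite -lee_fin; apply: le_trans v4 _; rewrite ge_max; apply/andP; split.
      by rewrite lee_fin; have := normr_ge0 (M k); move: c0; clear; lra.
    rewrite EFinD; apply: leeD2r; apply: le_trans (hM k q Dq sq) _; rewrite lee_fin ler_norm//.
  - by move=> [/graphE hE _]; rewrite v2.
  - move=> [qb hq]; have nA : ~ A q.1.
      by move=> Aq; have [_ /(_ Aq)[qa _]] := hab _ (br _ qb); apply: nAa; rewrite -qa.
    rewrite -lee_fin; apply: le_trans (v3 nA); rewrite opprD EFinD; apply: leeD.
      by apply: Hm; move: qb r0; clear; lra.
    by apply: eln_min_ge; exact: nE.
have [_ /(_ Aa)[_ nA2a]] := hab a (br a ab).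
have inDA z : 0 < nrm (z - a) -> nrm (z - a) <= r -> (D `\` A) z.
  move=> za zr; have [|Dz Az] := hab z; first exact: lt_trans (az z zr) r27.
  by split=> // /Az[zE _]; move: za; rewrite zE subrr nrm0 ltxx.
have large := @large_near_singularity R f a r r0 (fun z h => hf z (inDA z (andP h).1 (andP h).2)) _.
have {}large : forall M : R, exists2 t0 : R, 0 < t0 &
    forall t : R, 0 < t < t0 -> exists2 e, nrm (e - a) = t & M < nrm (f e).
  apply: large => F hF; apply: (hne a r F) => // z zr.
  have [|Dz Az] := hab z; first by apply: lt_trans r27; apply: az; exact: ltW.
  by split=> // /Az[].
have sH0 : SH D (fun z => (H z + (nrm (z - a))%:E)%E).
  apply: SH_add => //; apply: SH_nrm => // z _.
  by eexists; exact: cdfD (cdf_id z) (cdf_cst (- a) z).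
have [M hM] := SH_exhaustion_bound hs sH0.
(* Over [a] itself the lower bound is Psi a >= -1 - (m + 2), whence m + 3; over other points the two
   logarithms account for [H1] and for the distance to the graph. *)
exists (fun k => `|M k| + 1), (fun q => m + 3 + `|ln (nrm (q.1 - a))| + `|ln (nrm (q.2 - f q.1))|) => k c c0.
(* The bound 2^-k puts the points of [far_graph] where Q <= -c; the bound r keeps the region of
   doubtful subharmonicity where [H] is at least -m. *)
pose dl := Num.min r (2^-1 ^+ k).
have dl0 : 0 < dl by rewrite lt_min r0 exprn_gt0// invr_gt0.
have dlr : dl <= r by rewrite ge_min lexx.
have dlk : dl <= 2^-1 ^+ k by rewrite ge_min lexx orbT.
have [|Q [rho [rho0 cQ [Q0 Qa] Qc QSH]]] := @barrier R f a r dl (k%:R + 3) c r0 _ (large _) dl0 c0.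
  by move=> z /andP[z0 zr]; apply: hf; exact: inDA.
(* For |z - a| > rho / 2 the added logarithm then lowers [H] by at most 1. Half of [rho] is used
   because the estimate is needed on a neighbourhood of points with |z - a| >= rho. *)
pose l := `|ln (rho / 2)|; pose ka := (1 + l)^-1.
have lp : 0 <= l by exact: normr_ge0.
have l0 : 0 < 1 + l by rewrite ltr_pwDl.
have ka0 : 0 < ka by rewrite invr_gt0.
have ka1 : ka <= 1 by rewrite invf_le1 ?lerDl.
have kal : ka * l <= 1 by rewrite mulrC ler_pdivrMr ?mul1r ?lerDr.
pose H1 z := (H z + ka%:E * eln (nrm (z - a)%R))%E.
have sH1 : SH D H1.
  apply: SH_add => //; apply: SH_scale => //; apply: SH_eln => // z _.
  by eexists; exact: cdfD (cdf_id z) (cdf_cst (- a) z).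
have H1A z : A z -> H1 z = -oo%E.
  move=> Az; rewrite /H1; have [->|/eqP za] := eqVneq z a.
    by rewrite subrr nrm0 /eln lexx gt0_muleNy ?lte_fin// addeNy.
  by rewrite HA ?addNye// A7.
(* Lowering by m + 2 puts [Psi] strictly below H1 >= -m - 1 wherever it may fail to be
   subharmonic. *)
pose Psi (z : C) : R := Num.max (- c) (Q z) + (- (m + 2)).
have cPsi : continuous Psi.
  move=> z; apply: (@continuousD _ _ _ (fun y : C => Num.max (- c) (Q y)) (fun=> - (m + 2)) z); last exact: cst_continuous.
  apply: (@continuous_max R C (fun=> - c) Q z); first exact: cst_continuous.
  exact: cQ.
have Psi_le z : Psi z <= - (m + 2).
  by rewrite /Psi gerDr ge_max Q0 oppr_le0 (ltW c0).
have hPsi (z : C) : D z -> (exists U : set C, U z /\ SH U (fun z => (Psi z)%:E)) \/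
    exists U : set C, [/\ open U, U z & forall y, U y -> [/\ ~ A y, k%:R + 3 < nrm (f y) & ((Psi y)%:E < H1 y)%E]].
  move=> Dz; have [h|h] := pselect [\/ nrm (z - a) < rho, dl <= nrm (z - a) | nrm (f z) <= k%:R + 3].
    left; apply: locally_SH_add; last exact: locally_SH_cst.
    by apply: locally_SH_maxr; [exact: locally_SH_cst|exact: QSH].
  have z1' : rho <= nrm (z - a) by rewrite leNgt; apply/negP => h'; apply: h; constructor 1.
  have z2 : nrm (z - a) < dl by rewrite ltNge; apply/negP => h'; apply: h; constructor 2.
  have z3 : k%:R + 3 < nrm (f z) by rewrite ltNge; apply/negP => h'; apply: h; constructor 3.
  have DAz : (D `\` A) z by apply: inDA; [exact: lt_le_trans z1'|exact: ltW (lt_le_trans z2 dlr)].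
  right; exists [set y : C | [/\ ~ A y, k%:R + 3 < nrm (f y) & ((Psi y)%:E < H1 y)%E]]°; split.
  - exact: open_interior.
  - have [d hd] := hf z DAz; have e0 : 0 < nrm (f z) - (k%:R + 3) by rewrite subr_gt0.
    have [r1 r10 hr1] := cdf_ccont hd e0.
    have h1 : nbhs (z : C) (D `\` A) by apply: open_nbhs_nbhs.
    have m1 : 0 < Num.min r1 (Num.min (dl - nrm (z - a)) (rho / 2)).
      by rewrite !lt_min r10 subr_gt0 z2 divr_gt0.
    have h2 : nbhs (z : C) [set y : C | nrm (y - z) < Num.min r1 (Num.min (dl - nrm (z - a)) (rho / 2))].
      by apply/nbhsCP; exists (Num.min r1 (Num.min (dl - nrm (z - a)) (rho / 2))).
    apply: filterS2 h1 h2 => y [Dy nAy]; rewrite /= !lt_min => /and3P[/hr1 y1 y2 y3]; split=> //.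
      by have := nrmB_ge (f z) (f y); rewrite nrmBC; move: y1; clear; lra.
    have ya : nrm (y - a) < dl by have := nrm_tri y z a; move: y2; clear; lra.
    have yrho : rho / 2 < nrm (y - a).
      by have := nrm_tri z y a; rewrite (nrmBC z y); move: y3 z1'; clear; lra.
    have r20 : 0 < rho / 2 by rewrite divr_gt0.
    apply: (@le_lt_trans _ _ (- (m + 2))%:E); first by rewrite lee_fin.
    apply: (@lt_le_trans _ _ ((- m)%:E + (ka * - l)%:E)%E).
      by rewrite -EFinD lte_fin mulrN; move: kal; clear; lra.
    apply: leeD; first by apply: Hm; apply: az; exact: ltW (lt_le_trans ya dlr).
    rewrite EFinM; apply: lee_wpmul2l; first by rewrite lee_fin ltW.
    rewrite /eln (lt_geF (lt_trans r20 yrho)) lee_fin; apply: (@le_trans _ _ (ln (rho / 2))).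
      by rewrite lerNl; have := ler_norm (- ln (rho / 2)); rewrite normrN.
    by rewrite ler_ln ?posrE ?(lt_trans r20 yrho)// ltW.
  - by move=> y /interior_subset.
have [|z Dz Az|v [pv hv]] := @graph_approximation R D A f s H1 Psi k%:R oD hs oDA hf sH1 _ _ hPsi.
- by move=> z _; exact: cPsi.
- by rewrite H1A// ltNyr.
exists v; split=> // q [Dq _] sq; have [v1 v2 v3 v4] := hv q Dq sq.
- rewrite -lee_fin; apply: le_trans v4 _; rewrite ge_max; apply/andP; split.
    by rewrite lee_fin; have := Psi_le q.1; have := normr_ge0 (M k); move: m0; clear; lra.
  rewrite EFinD; apply: leeD2r; apply: (@le_trans _ _ (M k)%:E); last by rewrite lee_fin ler_norm.
  apply: le_trans (hM k q Dq sq); apply: leeD2l; apply: scale_eln_le; rewrite ?nrm_ge0//.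
  by rewrite ka0.
- move=> [/graphE hE hfar]; rewrite v2//.
  have qa : dl <= nrm (q.1 - a).
    case: hfar => [A2q|/(_ a Aa)]; last exact: le_trans.
    have qna : q.1 <> a by move=> qE; apply: nA2a; rewrite -qE.
    apply: le_trans dlr _; have := A7 _ (A2A _ A2q) qna; have := nrm_tri q.1 a b.
    by move: ab r0; clear; lra.
  rewrite /Psi max_l; last exact: Qc.
  by move: m0; clear; lra.
- move=> [qb hq]; have ln1 := normr_ge0 (ln (nrm (q.1 - a))); have ln2 := normr_ge0 (ln (nrm (q.2 - f q.1))).
  have [qa|/eqP qa] := eqVneq q.1 a.
    apply: le_trans v1; rewrite qa /Psi; have : -1 <= Num.max (- c) (Q a) by rewrite le_max Qa orbT.
    by move: ln1 ln2; rewrite qa; clear; lra.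
  have nA : ~ A q.1 by move=> Aq; have := A7 _ Aq qa; rewrite leNgt br.
  have qa0 : 0 < nrm (q.1 - a) by rewrite nrm_gt0; apply/negP => /eqP/subr0_eq.
  rewrite -lee_fin; apply: le_trans (v3 nA).
  apply: (@le_trans _ _ (- m + - `|ln (nrm (q.1 - a))| + - `|ln (nrm (q.2 - f q.1))|)%:E).
    by rewrite lee_fin; clear; lra.
  rewrite !EFinD; apply: leeD; last by apply: eln_min_ge; exact: nE.
  apply: leeD; first by apply: Hm; move: qb r0; clear; lra.
  apply: le_trans (eln_min_ge qa0) _; apply: mule_01_ge.
  by rewrite ka0.
Qed.

End GoodDisc.

(** * Countably many discs and the conclusion *)

Section CompletePluripolarity.
Context {R : realType}.
Local Notation C := (Cplx R).
Local Notation CC := (C * C)%type.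
Local Notation Re := (@complex.Re R).
Local Notation Im := (@complex.Im R).
Implicit Types (q : CC) (z a b : R[i]) (D A : set C) (f : R[i] -> R[i]).

Definition grid_disc (t : int * int * nat) : R[i] * R :=
  let: (i, j, n) := t in ((i%:~R / n.+1%:R +i* (j%:~R / n.+1%:R))%C, 3 / n.+1%:R).

(** Rounding both coordinates costs at most 2/(n + 1), below the radius 3/(n + 1). The factor 8
    makes room for the sevenfold disc around a centre that is itself within one radius of [z]. *)
Lemma grid_dense z (e : R) : 0 < e -> exists t,
  nrm (z - (grid_disc t).1) < (grid_disc t).2 /\ 8 * (grid_disc t).2 < e.
Proof.
move=> e0; have e24 : 0 < e / 24 by rewrite divr_gt0.
have [n hn] := inv_lt e24.
exists (Num.floor (Re z * n.+1%:R), Num.floor (Im z * n.+1%:R), n) => /=.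
have n0 : 0 < n.+1%:R :> R by rewrite ltr0n.
have fl (x : R) : `|x - (Num.floor (x * n.+1%:R))%:~R / n.+1%:R| <= n.+1%:R^-1.
  have -> : x - (Num.floor (x * n.+1%:R))%:~R / n.+1%:R = (x * n.+1%:R - (Num.floor (x * n.+1%:R))%:~R) / n.+1%:R.
    by rewrite mulrBl mulfK// gt_eqF.
  rewrite normrM normrV ?unitfE ?gt_eqF// [`|n.+1%:R|]gtr0_norm// ler_piMl ?invr_ge0//.
  have := @floor_itv R (x * n.+1%:R).
  rewrite intrD ler_norml => /andP[h1 h2]; apply/andP; split.
    by apply: (@le_trans _ _ 0); rewrite ?subr_ge0// oppr_le0.
  by rewrite lerBlDl ltW.
split; last by move: hn; rewrite (_ : 8 * (3 / n.+1%:R) = 24 * n.+1%:R^-1); [move: (_^-1) => x; clear; lra|ring].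
apply: le_lt_trans (nrm_ReIm _) _; rewrite cReD cImD cReN cImN /=.
apply: le_lt_trans (lerD (fl _) (fl _)) _.
have : 0 < n.+1%:R^-1 :> R by rewrite invr_gt0.
by move: (_^-1) => x; clear; lra.
Qed.

Lemma graph_set_complete_pluripolar D A (A2 : set C) f (u : C -> \bar R) z1 : open D -> open (D `\` A) ->
  (forall z, (D `\` A) z -> exists d, cdf f d z) -> A2 `<=` A -> A `<=` D ->
  SH setT u -> (-oo < u z1)%E -> (forall z, A z -> u z = -oo%E) ->
  not_extendable D A A2 f ->
  (forall a, A a -> ~ A2 a -> exists2 r : R, 0 < r & forall z, nrm (z - a) < r -> A z -> z = a) ->
  complete_pluripolar (D `*` [set: C]) (graph_set D A A2 f).
Proof.
move=> oD oDA hf A2A AD su uz1 uA hne hiso.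
have [s hs] := exists_exhaustion oD.
(* Numbers coding no disc get radius 0, which [good_disc] excludes. *)
pose dc (j : nat) : R[i] * R := if unpickle j is Some t then grid_disc t else (0, 0).
apply: (@complete_pluripolar_peeling R D s oD hs (graph_set D A A2 f) (far_graph D A A2 f)
  (fun j q => [/\ good_disc D A A2 (dc j).1 (dc j).2, nrm (q.1 - (dc j).1) < (dc j).2 & ~ graph_set D A A2 f q])).
- by move=> q [[[Dq _] _]|[/A2A/AD ? _]].
- move=> q Eq; have [A2q|nA2q] := pselect (A2 q.1); first by exists 0%N => k _; split=> //; left.
  case: (Eq) => [[DAq _]|[//]].
  have [e e0 he] := (openCP _).1 oDA _ DAq.
  (* A point over the open set D \ A keeps a positive distance [e] from [A], so it belongs to
     [far_graph] as soon as 2^-k < e. *)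
  have [K hK] := ex_lt_pow2 e^-1; exists K => k Kk; split=> //; right=> a Aa.
  rewrite leNgt; apply/negP => qa.
  have [|_] := he a; last by [].
  rewrite nrmBC; apply: lt_le_trans qa _; rewrite exprVn -[leRHS]invrK lef_pV2 ?posrE ?invr_gt0 ?exprn_gt0//.
  by apply: le_trans (ltW hK) _; rewrite ler_eXn2l// ltr1n.
- move=> q [Dq _] nE; have nA2 : ~ A2 q.1 by move=> A2q; apply: nE; right.
  have [r1 r10 hr1] : exists2 r : R, 0 < r & forall z, nrm (z - q.1) < r -> D z /\ (A z -> z = q.1).
    have [e e0 he] := (openCP D).1 oD _ Dq.
    have [Aq|nAq] := pselect (A q.1).
      have [r r0 hr] := hiso _ Aq nA2; exists (Num.min e r); first by rewrite lt_min e0.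
      by move=> z; rewrite lt_min => /andP[/he Dz /hr].
    have [r r0 hr] := (openCP _).1 oDA _ (conj Dq nAq); exists r => // z /hr[Dz nAz]; split=> // /nAz.
  have [t [t1 t2]] := grid_dense q.1 r10.
  exists (pickle t); rewrite /dc pickleK; split=> //; split; first by apply: le_lt_trans t1; exact: nrm_ge0.
  exists q.1 => // z zt.
  have [|Dz Az] := hr1 z.
    have := nrm_tri z (grid_disc t).1 q.1; rewrite (nrmBC (grid_disc t).1 q.1); move: t1 t2 zt.
    by move: (grid_disc t).2 => x; clear; lra.
  by split=> // /Az.
- move=> j; have [hg|hg] := pselect (good_disc D A A2 (dc j).1 (dc j).2).
    have [M [L h]] := good_disc_peel oD hs oDA hf A2A AD su uz1 uA hne hg.
    exists M, L => k c c0; have [v [v1 v2 v3 v4]] := h k c c0; exists v; split=> //.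
    by move=> q Wq sq [_ qb nE]; apply: v4.
  (* A disc that is not good has an empty set of points to protect, and the constant -c will do. *)
  exists (fun=> 0), (fun=> 0) => k c c0; exists (fun=> - c); split=> //.
  + by apply: psh_cst; [exact: open_fst|exact: ltry].
  + by move=> q _ _; rewrite oppr_le0 ltW.
  + by move=> q _ _ [].
Qed.

End CompletePluripolarity.

Theorem theorem1p1 (R : realType) (D A : set (Cplx R)) (f : Cplx R -> Cplx R) :
  domain D -> A `<=` D -> closed_in D A -> polar A ->
  holomorphic_on (D `\` A) f ->
  complete_pluripolar (D `*` setT) (graph_over D A f `|` (A `*` setT)) /\
  ((forall a, A a -> ~ extends_holo_at D A f a) ->
   complete_pluripolar (D `*` setT)
     (graph_over D A f `|` (accum_in D A `*` setT))).
Proof.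
move=> [oD _ _] AD [F [cF AE]] [u [/subharmonic_SH su [[z1 uz1] uA]]] hf.
have oDA : open (D `\` A).
  rewrite (_ : D `\` A = D `&` ~` F); first by apply: openI => //; exact: closed_openC.
  rewrite AE; apply/seteqP; split=> z; first by move=> [Dz nFD]; split=> // Fz; apply: nFD.
  by move=> [Dz nF]; split=> // -[].
have {}hf z : (D `\` A) z -> exists d, cdf f d z by move=> /hf/derivableCP.
have {}uz1 : (-oo < u z1)%E by rewrite ltNye; apply/eqP.
(* With [A2 = A] no point of [A] lies outside [A2], so the conditions on extension and isolation are
   vacuous. *)
split; first by apply: (@graph_set_complete_pluripolar R D A A f u z1) => // a r G Aa /(_ Aa).
move=> hne; apply: (@graph_set_complete_pluripolar R D A (accum_in D A) f u z1) => //.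
- move=> z [Dz lz]; rewrite AE; split=> //; apply: cF => V /lz[y [_ Ay Vy]].
  by exists y; split=> //; move: Ay; rewrite AE => -[].
- move=> a r G Aa _ r0 hr hG GE; apply: (hne a Aa).
  exists [set z | nrm (z - a) < r], G; split.
  + exact: open_disc.
  + by rewrite /= subrr nrm0.
  + by move=> z /hr[].
  + by move=> z /hG/derivableCP.
  + move=> z [/= zr nAz]; apply: GE; rewrite zr andbT nrm_gt0.
    by apply/negP => /eqP/subr0_eq za; apply: nAz; rewrite za.
- move=> a Aa nacc.
  have nl : ~ limit_point A a by move=> la; apply: nacc; split=> //; exact: AD.
  apply: contrapT => hn; apply: nl => V /nbhsCP[e e0 hV].
  apply: contrapT => hy; apply: hn; exists e => // z za Az.
  by apply/eqP; apply: contrapT => /negP zna; apply: hy; exists z; split=> //; exact: hV.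
Qed.
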